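(* Let $m\ge1$. There exists a constant $C$ independent of $h$ such that $$\|\mathcal R^mv_h\|_{e}\le C\,\Lambda_m\,\|v_h\|_{e}\qquad\text{for all }v_h\in V_{h,0}.$$
   Context: Mesh. $\Omega\subset\mathbb R^d$ ($d=2,3$) is a bounded convex polygonal (polyhedral) domain. $\mathcal T_h$ is a triangulation of $\Omega$ into triangles (tetrahedra); $h_K=\mathrm{diam}(K)$, $h=\max_K h_K$, $\rho=\min_K\rho_K$ with $\rho_K$ the radius of the largest ball inscribed in $K$. The meshes are quasi-uniform: $h\le C_\nu\rho$ with $C_\nu$ independent of $h$. $\mathcal E_h$ is the set of all $(d-1)$-dimensional faces (interior and boundary), $h_e=\mathrm{diam}(e)$. $\mathcal N_h$ is the set of mesh nodes (vertices); $\mathcal N_K$ is the set of vertices of $K$. Constants $C$ are independent of $h$. Patches. $w(K)=\{K'\in\mathcal T_h:\overline K\cap\overline{K'}\ne\varnothing\}$, $\mathcal S_0(K)=\{K\}$, $\mathcal S_{t+1}(K)=\bigcup_{K'\in\mathcal S_t(K)}w(K')$, $\mathcal I_t(K)=\bigcup_{K'\in\mathcal S_t(K)}\mathcal N_{K'}$. Given a fixed threshold $N_m>d+1$, let $t_K\ge 1$ be the smallest integer with $\#\mathcal I_{t_K}(K)\ge N_m$. The patch $\mathcal S(K)$ consists of $\mathcal S_{t_K-1}(K)$ together with elements of $\mathcal S_{t_K}(K)\setminus\mathcal S_{t_K-1}(K)$ added one at a time in order of increasing distance (between barycenters) to $K$, until $\mathcal I(K):=\bigcup_{K'\in\mathcal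 S(K)}\mathcal N_{K'}$ has at least $N_m$ nodes. $\mathcal D(K)$ is the interior of $\bigcup_{K'\in\mathcal S(K)}\overline{K'}$. $\mathcal P_m(D)$ is the space of polynomials of degree at most $m$ on $D$. Standing assumption: for every $K$ and $p\in\mathcal P_m(\mathcal D(K))$, $p|_{\mathcal I(K)}=0$ implies $p=0$ on $\mathcal D(K)$. Reconstruction. $V_h=\{v_h\in H^1(\Omega):v_h|_K\in\mathcal P_1(K)\ \forall K\}$, $V_{h,0}=V_h\cap H^1_0(\Omega)$. For $v_h\in V_h$, $\mathcal R_K^mv_h\in\mathcal P_m(\mathcal D(K))$ is the unique minimizer of $\sum_{\boldsymbol x\in\mathcal I(K)}|p(\boldsymbol x)-v_h(\boldsymbol x)|^2$ over $p\in\mathcal P_m(\mathcal D(K))$ subject to $p(\boldsymbol y)=v_h(\boldsymbol y)$ for all $\boldsymbol y\in\mathcal N_K$. $\mathcal R^mv_h$ is the piecewise polynomial with $(\mathcal R^mv_h)|_K=(\mathcal R_K^mv_h)|_K$ for every $K\in\mathcal T_h$. Further $$\Lambda_{m,K}^2=\max_{0\ne p\in\mathcal P_m(\mathcal D(K))}\frac{\|p\|_{L^2(K)}^2}{h_K^d\sum_{\boldsymbol x\in\mathcal I(K)}p(\boldsymbol x)^2},\qquad \Lambda_m=\max_{K\in\mathcal T_h}\bigl(1+\Lambda_{m,K}t_K\sqrt{\#\mathcal I(K)}\bigr).$$ Norm. On an interior face $e=\partial K^+\cap\partial K^-$, with $\boldsymbol{\mathrm n}=\boldsymbol{\mathrm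 n}^+$ the unit normal outward to $K^+$, $[\![v]\!]=v^+-v^-$; on a boundary face $[\![v]\!]$ is the trace of $v$ and $\boldsymbol{\mathrm n}$ is the unit outward normal. $\nabla_{\boldsymbol{\mathrm n}}v=\boldsymbol{\mathrm n}\cdot\nabla v$. For piecewise smooth $v$, $$\|v\|_e^2=\sum_{K\in\mathcal T_h}\|\Delta v\|_{L^2(K)}^2+\sum_{e\in\mathcal E_h}h_e^{-3}\|[\![v]\!]\|_{L^2(e)}^2+\sum_{e\in\mathcal E_h}h_e^{-1}\|[\![\nabla_{\boldsymbol{\mathrm n}}v]\!]\|_{L^2(e)}^2.$$ *)

(* Defs.v *)
From HB Require Import structures.
From mathcomp Require Import all_boot all_order all_algebra.
From mathcomp Require Import all_classical all_reals all_analysis.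
Set Implicit Arguments.
Unset Strict Implicit.
Unset Printing Implicit Defensive.
Import Order.TTheory GRing.Theory Num.Theory.
Import numFieldNormedType.Exports.
Local Open Scope classical_set_scope.
Local Open Scope ring_scope.

(* Row vectors carry the sigma-algebra generated by the coordinates, i.e. the
   Borel sets; [lebesgue n] is Lebesgue measure on R^n, built as the n-fold
   product of the one-dimensional one. *)
Definition rV_display : measure_display. Proof. exact: default_measure_display. Qed.

Section measurable_rV.
Context {R : realType}.
Variable n : nat.

Definition rV_coord (i : 'I_n) (x : 'rV[R]_n) : measurableTypeR R := x 0 i.

Let rV_set0 : g_sigma_preimage rV_coord set0.
Proof. exact: sigma_algebra0. Qed.

Let rV_setC A : g_sigma_preimage rV_coord A -> g_sigma_preimage rV_coord (~` A).
Proof. exact: sigma_algebraC. Qed.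

Let rV_bigcup (F : _^nat) : (forall i, g_sigma_preimage rV_coord (F i)) ->
  g_sigma_preimage rV_coord (\bigcup_i (F i)).
Proof. exact: sigma_algebra_bigcup. Qed.

HB.instance Definition _ := @isMeasurable.Build rV_display
  'rV[R]_n (g_sigma_preimage rV_coord) rV_set0 rV_setC rV_bigcup.

Lemma measurable_rV_coord (i : 'I_n) : measurable_fun setT (rV_coord i).
Proof.
move=> _ Y mY; rewrite setTI; apply: sub_sigma_algebra.
rewrite -bigcup_seq/=; exists i; first by rewrite /= mem_index_enum.
by exists Y => //; rewrite setTI.
Qed.

Lemma measurable_fun_rV d1 (T1 : measurableType d1) (f : T1 -> 'rV[R]_n) :
  (forall i, measurable_fun setT (rV_coord i \o f)) -> measurable_fun setT f.
Proof.
move=> mf.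
have sub : g_sigma_preimage (fun i => rV_coord i \o f) `<=` measurable.
  apply: smallest_sub; first exact: sigma_algebra_measurable.
  rewrite -bigcup_seq/=; apply: bigcup_sub => i _.
  by move=> A [B mB <-]; exact: mf.
rewrite g_sigma_preimage_comp in sub.
by move=> _ A mA; apply: sub; exists A.
Qed.
End measurable_rV.

Section lebesgue_rV.
Context {R : realType}.

Definition rV_cons n (p : measurableTypeR R * 'rV[R]_n) : 'rV[R]_n.+1 :=
  row_mx (p.1 : R)%:M p.2.

Lemma rV_cons0 n p : @rV_cons n p 0 ord0 = p.1.
Proof.
have -> : (ord0 : 'I_n.+1) = lshift n (ord0 : 'I_1) by exact: val_inj.
by rewrite /rV_cons (@row_mxEl _ _ 1 n) mxE mulr1n.
Qed.

Lemma rV_consS n p (j : 'I_n) : @rV_cons n p 0 (lift ord0 j) = p.2 0 j.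
Proof.
have -> : lift ord0 j = rshift 1 j by exact: val_inj.
by rewrite /rV_cons (@row_mxEr _ _ 1 n).
Qed.

Lemma measurable_rV_cons n : measurable_fun setT (@rV_cons n).
Proof.
apply: measurable_fun_rV => i; rewrite /rV_coord /rV_cons.
have [j ->|->] := unliftP ord0 i.
  rewrite (_ : _ \o _ = rV_coord j \o snd).
    by apply: measurableT_comp; [exact: measurable_rV_coord|exact: measurable_snd].
  by apply/funext => p /=; rewrite rV_consS.
rewrite (_ : _ \o _ = fst); first exact: measurable_fst.
by apply/funext => p /=; rewrite rV_cons0.
Qed.

Definition rV_uncons n (x : 'rV[R]_n.+1) : measurableTypeR R * 'rV[R]_n :=
  (x 0 0, rsubmx (x : 'rV[R]_(1 + n))).

Lemma rV_consK n : cancel (@rV_cons n) (@rV_uncons n).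
Proof.
by case=> a y; rewrite /rV_uncons rV_cons0 /rV_cons row_mxKr.
Qed.

Lemma measurable_rV_uncons n : measurable_fun setT (@rV_uncons n).
Proof.
apply/measurable_fun_pairP; split; first exact: (measurable_rV_coord ord0).
apply: measurable_fun_rV => i.
rewrite (_ : _ \o _ = rV_coord (rshift 1 i)); first exact: measurable_rV_coord.
by apply/funext => x; rewrite /rV_coord /= mxE.
Qed.

Section cons.
Context n (mu : {sigma_finite_measure set 'rV[R]_n -> \bar R}).

Definition lebesgue_cons : set 'rV[R]_n.+1 -> \bar R :=
  pushforward (lebesgue_measure \x mu)%E (@rV_cons n).

Let lebesgue_cons0 : lebesgue_cons set0 = 0%E.
Proof. by rewrite /lebesgue_cons /pushforward preimage_set0 measure0. Qed.

Let lebesgue_cons_ge0 A : (0 <= lebesgue_cons A)%E.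
Proof. by apply: integral_ge0 => x _; exact: measure_ge0. Qed.

Let lebesgue_cons_sigma_additive : semi_sigma_additive lebesgue_cons.
Proof.
move=> F mF tF mUF; rewrite /lebesgue_cons /pushforward preimage_bigcup.
apply: measure_semi_sigma_additive.
- by move=> k; rewrite -[X in measurable X]setTI; exact: measurable_rV_cons.
- apply/trivIsetP => /= i j _ _ ij; rewrite -preimage_setI.
  by move/trivIsetP : tF => /(_ _ _ _ _ ij) ->//; rewrite preimage_set0.
- rewrite -preimage_bigcup -[X in measurable X]setTI; exact: measurable_rV_cons.
Qed.

HB.instance Definition _ := isMeasure.Build _ _ _ lebesgue_cons
  lebesgue_cons0 lebesgue_cons_ge0 lebesgue_cons_sigma_additive.

Let lebesgue_cons_sigma_finite : sigma_finite setT lebesgue_cons.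
Proof.
have /sigma_finiteP[F [TF ndF Foo]] := sigma_finiteT (@lebesgue_measure R).
have /sigma_finiteP[G [TG ndG Goo]] := sigma_finiteT mu.
exists (fun k => @rV_uncons n @^-1` (F k `*` G k)).
  rewrite -preimage_bigcup (_ : \bigcup_i _ = setT) ?preimage_setT//.
  apply/seteqP; split=> // -[x y] _.
  have [[i _ Fx] [j _ Gy]] : (\bigcup_i F i) x /\ (\bigcup_i G i) y.
    by rewrite -TF -TG.
  exists (maxn i j) => //; split => /=.
    by move: x Fx; exact/subsetPset/ndF/leq_maxl.
  by move: y Gy; exact/subsetPset/ndG/leq_maxr.
move=> k; have [mF Fk] := Foo k; have [mG Gk] := Goo k; split.
  rewrite -[X in measurable X]setTI; apply: measurable_rV_uncons => //.
  exact: measurableX.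
rewrite /lebesgue_cons /pushforward -comp_preimage.
rewrite (_ : _ \o _ = id) ?preimage_id; last by apply/funext; exact: rV_consK.
by rewrite product_measure1E// lte_mul_pinfty// ge0_fin_numE.
Qed.

HB.instance Definition _ := Measure_isSigmaFinite.Build _ _ _ lebesgue_cons
  lebesgue_cons_sigma_finite.
End cons.

Fixpoint lebesgue n : {sigma_finite_measure set 'rV[R]_n -> \bar R} :=
  match n with
  | 0%N => dirac (0 : 'rV[R]_0)
  | k.+1 => lebesgue_cons (lebesgue k)
  end.
End lebesgue_rV.

Section calculus.
Context {R : realType} {d : nat}.
Local Notation E := 'rV[R]_d.

Definition dotp (x y : E) : R := \sum_i x 0 i * y 0 i.

(* The norm of the library's normedModType structure on row vectors is the
   sup-norm, so the Euclidean one is introduced separately. *)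
Definition eucl (x : E) : R := Num.sqrt (dotp x x).

Definition partial (i : 'I_d) (f : E -> R) (x : E) : R :=
  'D_(delta_mx 0 i) f x.

Definition gradient (f : E -> R) (x : E) : E := \row_i partial i f x.

Definition laplacian (f : E -> R) (x : E) : R :=
  \sum_i partial i (partial i f) x.

Definition hull (I : finType) (a : I -> E) (A : {set I}) : set E :=
  [set x | exists lam : I -> R, [/\ forall i, i \in A -> 0 <= lam i,
     \sum_(i in A) lam i = 1 & x = \sum_(i in A) lam i *: a i]].

Definition diam (A : set E) : R :=
  sup [set r | exists x y, [/\ A x, A y & r = eucl (x - y)]].

Definition inradius (A : set E) : R :=
  sup [set r | 0 <= r /\
    exists c, [set x | eucl (x - c) <= r] `<=` A].

(* Functions on R^d that are polynomials of total degree at most m. *)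
Definition poly_fun (m : nat) : set (E -> R) :=
  [set p : E -> R | exists c : {ffun 'I_d -> 'I_m.+1} -> R,
     forall x, p x =
       \sum_(a : {ffun 'I_d -> 'I_m.+1} | (\sum_i a i <= m)%N)
          c a * \prod_i x 0 i ^+ a i].

Definition convex_polytope (Omega : set E) :=
  [/\ open Omega, Omega !=set0, bounded_set Omega,
      convex_set (Omega : set (convex_lmodType E)) &
      exists (k : nat) (a : 'I_k -> E), closure Omega = hull a [set: 'I_k]%SET].

End calculus.

Section sobolev.
Context {R : realType} {d : nat}.
Local Notation E := 'rV[R]_d.
Implicit Types (Omega : set E) (f v phi : E -> R) (g : 'I_d -> E -> R).

Definition smooth f :=
  forall s : seq 'I_d, let h := foldr partial f s in
    continuous h /\ forall (i : 'I_d) x, derivable h x (delta_mx 0 i).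

Definition test_fun Omega : set (E -> R) :=
  [set phi : E -> R | smooth phi /\
    exists A, [/\ compact A, A `<=` Omega & forall x, ~ A x -> phi x = 0]].

Definition L2 Omega : set (E -> R) :=
  [set f : E -> R | measurable_fun Omega (f : E -> measurableTypeR R) /\
    (\int[lebesgue d]_(x in Omega) (f x ^+ 2)%:E < +oo)%E].

Definition weak_gradient Omega v g :=
  forall i phi, test_fun Omega phi ->
    \int[lebesgue d]_(x in Omega) (v x * partial i phi x) =
    - \int[lebesgue d]_(x in Omega) (g i x * phi x).

Definition H1 Omega : set (E -> R) :=
  [set v : E -> R | L2 Omega v /\
    exists g, (forall i, L2 Omega (g i)) /\ weak_gradient Omega v g].

(* The closure of the test functions in the H^1 norm. *)
Definition H10 Omega : set (E -> R) :=
  [set v : E -> R | L2 Omega v /\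
    exists g, [/\ forall i, L2 Omega (g i), weak_gradient Omega v g &
      exists phi : nat -> E -> R, (forall n, test_fun Omega (phi n)) /\
        (fun n => \int[lebesgue d]_(x in Omega) ((v x - phi n x) ^+ 2)%:E +
           \sum_i \int[lebesgue d]_(x in Omega)
             ((g i x - partial i (phi n) x) ^+ 2)%:E)%E @ \oo --> 0%E]].

End sobolev.

Record mesh (R : realType) (d : nat) := Mesh {
  node : finType;
  pos : node -> 'rV[R]_d;
  elts : {set {set node}} (* each element is given by its set of vertices *)
}.

Section mesh.
Context {R : realType} {d : nat}.
Local Notation E := 'rV[R]_d.
Variable M : mesh R d.
Local Notation N := (node M).
Local Notation pos := (@pos R d M).
Local Notation elts := (@elts R d M).
Implicit Types (K e : {set N}) (S : {set {set N}}) (v : E -> R).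

Definition cell K : set E := interior (hull pos K).

Definition triangulation (Omega : set E) :=
  [/\ injective pos,
      forall x : N, exists2 K, K \in elts & x \in K,
      forall K, K \in elts -> #|K| = d.+1 /\
        forall lam : N -> R,
          \sum_(x in K) lam x = 0 -> \sum_(x in K) lam x *: pos x = 0 ->
          forall x, x \in K -> lam x = 0,
      forall K K', K \in elts -> K' \in elts ->
        hull pos K `&` hull pos K' = hull pos (K :&: K')%SET &
      closure Omega = [set x | exists2 K, K \in elts & hull pos K x]].

Definition h_ K : R := diam (hull pos K).
(* The sups and infs over the elements are maxima and minima. *)
Definition meshsize : R := sup [set r | exists2 K, K \in elts & r = h_ K].
Definition rho : R :=
  inf [set r | exists2 K, K \in elts & r = inradius (hull pos K)].

Definition faces : {set {set N}} :=
  [set e : {set N} | (#|e| == d) && [exists K in elts, e \subset K]]%SET.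

Definition neighbours K : {set {set N}} :=
  [set K' in elts | `[< hull pos K `&` hull pos K' !=set0 >]]%SET.

Fixpoint layers (t : nat) K : {set {set N}} :=
  if t is t'.+1 then (\bigcup_(K' in layers t' K) neighbours K')%SET
  else [set K]%SET.

(* [finset.cover S] is the set of all vertices of the elements of S. *)
Definition is_depth (Nm : nat) K (t : nat) :=
  [/\ (1 <= t)%N, (Nm <= #|finset.cover (layers t K)|)%N &
      forall s, (1 <= s < t)%N -> (#|finset.cover (layers s K)| < Nm)%N].

Definition barycenter K : E := #|K|%:R^-1 *: \sum_(x in K) pos x.
Definition bdist K K' : R := eucl (barycenter K' - barycenter K).

(* Elements at equal distance from K may be added in any order: [s] is any
   enumeration of the last layer sorted by distance, and the patch collects
   the shortest sufficient prefix of it. *)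
Definition is_patch (Nm : nat) K (t : nat) S :=
  exists s : seq {set N},
    [/\ perm_eq s (enum (layers t K :\: layers t.-1 K)%SET),
        sorted (fun A B => bdist K A <= bdist K B) s &
        exists n,
          let S_ k := (layers t.-1 K :|: [set:: take k s])%SET in
          [/\ S = S_ n, (Nm <= #|finset.cover (S_ n)|)%N &
              forall k, (k < n)%N -> (#|finset.cover (S_ k)| < Nm)%N]].

Definition patch_domain S : set E :=
  interior [set x | exists2 K, K \in S & hull pos K x].

(* Trace on the boundary of K, from inside K, of a piecewise smooth f. *)
Definition trace K (f : E -> R) (x : E) : R :=
  lim (f @ within (cell K) (nbhs x)).

(* The one or two elements having e as a face; the first one plays K^+. *)
Definition sides e : seq {set N} := enum [set K in elts | e \subset K]%SET.

Definition jump e (f : E -> R) (x : E) : R :=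
  match sides e with
  | K :: K' :: _ => trace K f x - trace K' f x
  | [:: K] => trace K f x
  | [::] => 0
  end.

Definition outward_normal K e : E :=
  get [set n | [/\ eucl n = 1,
    forall x y, x \in e -> y \in e -> dotp n (pos x - pos y) = 0 &
    forall x z, x \in e -> z \in K -> z \notin e ->
      dotp n (pos z - pos x) < 0]].

Definition face_normal e : E := outward_normal (head finset.set0 (sides e)) e.

Definition normal_derivative e v (x : E) : R := dotp (face_normal e) (gradient v x).

Definition ref_simplex (k : nat) : set 'rV[R]_k :=
  [set t | (forall i, 0 <= t 0 i) /\ \sum_i t 0 i <= 1].

(* Surface integral over the (d-1)-dimensional simplex e, through its affine
   parametrization by the reference simplex, with Gram determinant. *)
Definition face_integral e (f : E -> R) : R :=
  let p := [seq pos x | x <- enum e] in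
  let J : 'M[R]_(d.-1, d) := \matrix_(i < d.-1) (p`_i.+1 - p`_0) in
  Num.sqrt (\det (J *m J^T)) *
  \int[lebesgue d.-1]_(t in @ref_simplex d.-1) f (p`_0 + t *m J).

Definition broken_norm v : R :=
  Num.sqrt (
    \sum_(K in elts) \int[lebesgue d]_(x in cell K) (laplacian v x ^+ 2)
  + \sum_(e in faces) h_ e ^- 3 * face_integral e (fun x => jump e v x ^+ 2)
  + \sum_(e in faces) (h_ e)^-1 *
      face_integral e (fun x => jump e (normal_derivative e v) x ^+ 2)).

(* Elements of V_h are identified with their continuous representative: the
   equality with a polynomial is required on the closed element, so that nodal
   values make sense. *)
Definition Vh (Omega : set E) : set (E -> R) :=
  [set v : E -> R | H1 Omega v /\ forall K, K \in elts ->
     exists2 p, poly_fun 1 p & {in hull pos K, v =1 p}].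

Definition Vh0 (Omega : set E) : set (E -> R) := Vh Omega `&` H10 Omega.

Section reconstruction.
Variable m : nat.
Variable patch : {set N} -> {set {set N}}.
Local Notation I K := (finset.cover (patch K)).

(* A polynomial on the open set D(K) is represented by its unique extension
   to R^d. *)
Definition unisolvent := forall K, K \in elts -> forall p, poly_fun m p ->
  (forall x, x \in I K -> p (pos x) = 0) ->
  forall y, patch_domain (patch K) y -> p y = 0.

Definition residual v K (p : E -> R) : R :=
  \sum_(x in I K) `|p (pos x) - v (pos x)| ^+ 2.

Definition admissible v K : set (E -> R) :=
  [set p : E -> R | poly_fun m p /\ forall y, y \in K -> p (pos y) = v (pos y)].

Definition local_reconstruction v K : E -> R :=
  get [set p : E -> R | admissible v K p /\
    forall q, admissible v K q -> residual v K p <= residual v K q].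

(* Defined to be 0 on the skeleton of the mesh. *)
Definition reconstruction v (x : E) : R :=
  if [pick K in elts | x \in cell K] is Some K
  then local_reconstruction v K x else 0.

(* When [unisolvent] holds the supremum is attained, i.e. it is a maximum. *)
Definition LambdaK K : R := Num.sqrt (sup [set r |
  exists p, [/\ poly_fun m p,
    exists2 y, patch_domain (patch K) y & p y != 0 &
    r = (\int[lebesgue d]_(x in cell K) (p x ^+ 2)) /
        (h_ K ^+ d * \sum_(x in I K) p (pos x) ^+ 2)]]).

Definition Lambda (depth : {set N} -> nat) : R :=
  sup [set r | exists2 K, K \in elts &
    r = 1 + LambdaK K * (depth K)%:R * Num.sqrt #|I K|%:R].

End reconstruction.

End mesh.

(* Main.v *)
Require Import Defs.
From mathcomp Require Import all_boot all_order all_algebra.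
From mathcomp Require Import all_classical all_reals all_analysis.
From mathcomp Require Import measurable_realfun zify ring lra.

(** Let [H] be the mesh size, [v_K] the affine function that coincides with [v] on the
    element [K], and [q_K] the correction [R_K v - v_K] made by the reconstruction.

    The norm of [v] consists of its values on the boundary faces and of the jumps of
    its normal derivative, which are constant on each face. As the reconstruction is
    [v_K + q_K] on [K], its Laplacian and its jumps are those of [v] plus those of the
    corrections, and the former are paid for by the norm of [v]. Everything therefore
    rests on a bound of the corrections in terms of the jumps of the gradient of [v],
    in three steps.

    - Inverse estimates ([poly_inverse_estimates]): every element contains a cube and
      is contained in a cube, both of size comparable to [H]. Hence the values and the
      derivatives of [q_K] are bounded by suitable powers of [H] times its L^2 norm.

    - The constant [Lambda] bounds this L^2 norm by the values of [q_K] at the nodes of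
      the patch ([LambdaK_bound]). Since [v_K] is a competitor in the least-squares
      problem that defines [R_K v], these are controlled by the values of [v_K - v] at
      the same nodes ([local_reconstruction_sub]).

    - If [x] is a node of the patch, [K] can be joined to an element that contains [x]
      by a chain of boundedly many elements, each of which shares a facet with the next
      ([facet_chain]). Across a facet [v_K] changes by the jump of the normal derivative
      times a distance of order [H] ([adjacent_diff]), so [v_K x - v x] is at most a
      constant times [H] times the jumps near [K] ([extension_error]).

    The powers of [H] in these estimates cancel, and a jump is used for boundedly many
    elements only, because boundedly many elements lie within a fixed multiple of [H]
    from a given one ([card_nearby]). *)

Set Implicit Arguments.
Unset Strict Implicit.
Unset Printing Implicit Defensive.
Import Order.TTheory GRing.Theory Num.Theory.
Import numFieldNormedType.Exports.
Local Open Scope classical_set_scope.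
Local Open Scope ring_scope.

(** * Cubes, and comparison of integrals *)

Section boxes.
Context {R : realType}.

(** Balls of the sup norm: unlike Euclidean balls they have an explicit measure. *)
Definition box n (a : 'rV[R]_n) (s : R) : set 'rV[R]_n :=
  [set x | forall i, `|x 0 i - a 0 i| <= s].

Lemma measurable_box n (a : 'rV[R]_n) s : measurable (box a s).
Proof.
rewrite (_ : box a s = \bigcap_(i in [set: 'I_n])
    (rV_coord i @^-1` `[a 0 i - s, a 0 i + s])); last first.
  apply/seteqP; split=> x /=.
    move=> xa i _ /=; rewrite /rV_coord in_itv/=.
    by have := xa i; rewrite ler_distl.
  move=> xa i; have := xa i Logic.I; rewrite /= /rV_coord in_itv/=.
  by rewrite ler_distl.
apply: fin_bigcap_measurable => [|i _]; first exact: finite_finset.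
rewrite -[X in measurable X]setTI; apply: measurable_rV_coord => //.
Qed.

Lemma lebesgue_box n (a : 'rV[R]_n) s : 0 <= s ->
  lebesgue n (box a s) = ((2 * s) ^+ n)%:E.
Proof.
move=> s0; elim: n a => [|n IH] a.
  rewrite /= diracE expr0.
  by rewrite mem_set// => -[].
rewrite [LHS]/= /lebesgue_cons /pushforward.
have -> : @rV_cons R n @^-1` box a s =
    `[a 0 0 - s, a 0 0 + s] `*` box (rsubmx (a : 'rV_(1 + n))) s.
  apply/seteqP; split=> -[t y] /=.
    move=> ta; split=> [|i] /=.
      by have := ta 0; rewrite rV_cons0/= in_itv/= ler_distl.
    have := ta (lift 0 i); rewrite rV_consS /= mxE.
    by have -> : lift 0 i = rshift 1 i by exact: val_inj.
  move=> [/= ta ya] i; have [j ->|->] := unliftP 0 i.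
    rewrite rV_consS /=; have := ya j; rewrite mxE.
    by have -> : lift 0 j = rshift 1 j by exact: val_inj.
  by move: ta; rewrite rV_cons0 in_itv/= -ler_distl.
rewrite product_measure1E//; last exact: measurable_box.
rewrite IH exprS EFinM; congr (_ * _)%E.
apply: etrans (lebesgue_measure_itv `[a 0 0 - s, a 0 0 + s]) _ => /=.
rewrite lte_fin; case: ifPn => [_|]; first by rewrite -EFinB; congr _%:E; lra.
by rewrite -leNgt => s0'; congr _%:E; lra.
Qed.

Section monotone_integral.
Context dp (T : measurableType dp) (mu : {measure set T -> \bar R}).
Implicit Types (D : set T) (f : T -> R).
Import HBNNSimple.

(** The integral of a nonnegative function is a supremum over the simple functions
    below it, hence it is monotone for arbitrary functions. Laplacians and jumps of
    discrete functions are compared with constants in this way. *)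
Lemma ge0_le_integral_subset D D' f g : D `<=` D' ->
  (forall x, D x -> 0 <= f x) -> (forall x, D' x -> 0 <= g x) ->
  (forall x, D x -> f x <= g x) ->
  (\int[mu]_(x in D) (f x)%:E <= \int[mu]_(x in D') (g x)%:E)%E.
Proof.
move=> DD' f0 g0 fg.
rewrite ge0_integralE; last by move=> x Dx; rewrite lee_fin f0.
rewrite ge0_integralE; last by move=> x Dx; rewrite lee_fin g0.
apply: ereal_sup_le => _ [h /= hf <-]; exists h => //= x.
apply: le_trans (hf x) _; rewrite !patchE.
have [Dx|nDx] := boolP (x \in D).
  by rewrite inE in Dx; rewrite mem_set ?lee_fin ?fg//; exact: DD'.
have [D'x|//] := boolP (x \in D').
by rewrite inE in D'x; rewrite lee_fin g0.
Qed.

Lemma ge0_le_Rintegral_subset D D' f g : D `<=` D' ->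
  (forall x, D x -> 0 <= f x) -> (forall x, D' x -> 0 <= g x) ->
  (forall x, D x -> f x <= g x) ->
  (\int[mu]_(x in D') (g x)%:E < +oo)%E ->
  \int[mu]_(x in D) f x <= \int[mu]_(x in D') g x.
Proof.
move=> DD' f0 g0 fg goo.
have fleg := ge0_le_integral_subset DD' f0 g0 fg.
apply: fine_le => //; rewrite ge0_fin_numE//.
- by apply: le_lt_trans goo.
- by apply: integral_ge0 => x Dx; rewrite lee_fin f0.
- by apply: integral_ge0 => x Dx; rewrite lee_fin g0.
Qed.

Lemma integral_cst_lty D c : measurable D -> (mu D < +oo)%E ->
  (\int[mu]_(x in D) c%:E < +oo)%E.
Proof.
move=> mD Doo; rewrite integral_cst//.
have : (mu D \is a fin_num)%E by rewrite ge0_fin_numE.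
by move=> /fineK <-; rewrite -EFinM ltry.
Qed.

Lemma integrable_cst_lty D c : measurable D -> (mu D < +oo)%E ->
  mu.-integrable D (EFin \o cst c).
Proof.
move=> mD Doo; apply/integrableP; split; first by apply/measurable_EFinP; exact: measurable_cst.
exact: (integral_cst_lty `|c| mD Doo).
Qed.

Lemma Rintegral_le_cst D D' f c : measurable D' -> (mu D' < +oo)%E -> 0 <= c ->
  D `<=` D' -> (forall x, D x -> 0 <= f x <= c) ->
  \int[mu]_(x in D) f x <= c * fine (mu D').
Proof.
move=> mD' D'oo c0 DD' fc; rewrite -Rintegral_cst//.
apply: ge0_le_Rintegral_subset => //; [| |exact: integral_cst_lty].
  by move=> x /fc/andP[].
by move=> x /fc/andP[].
Qed.

Lemma Rintegral_ge_cst D D' B f c b : measurable D' -> measurable B ->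
  (mu B < +oo)%E -> 0 <= c -> 0 <= b -> D' `<=` D -> D `<=` B ->
  (forall x, D x -> 0 <= f x <= b) -> (forall x, D' x -> c <= f x) ->
  c * fine (mu D') <= \int[mu]_(x in D) f x.
Proof.
move=> mD' mB Boo c0 b0 D'D DB fb fc; rewrite -Rintegral_cst//.
apply: ge0_le_Rintegral_subset => //; first by move=> x /fb/andP[].
apply: le_lt_trans (integral_cst_lty b mB Boo).
by apply: ge0_le_integral_subset => // x /fb/andP[].
Qed.

(** The trace of an affine function on a face plays the role of [g]; its integral
    enters the norm to be bounded, so it has to be split off. *)
Lemma Rintegral_le_sqr D f g a b : measurable D -> (mu D < +oo)%E ->
  0 <= a -> 0 <= b -> measurable_fun D (g : T -> measurableTypeR R) ->
  (exists c, forall x, D x -> `|g x| <= c) ->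
  (forall x, D x -> 0 <= f x <= a * g x ^+ 2 + b) ->
  \int[mu]_(x in D) f x <= a * \int[mu]_(x in D) (g x ^+ 2) + b * fine (mu D).
Proof.
move=> mD Doo a0 b0 mg [c gc] fb.
have c20 x : D x -> g x ^+ 2 <= c ^+ 2.
  by move=> Dx; rewrite -ler_sqrt ?sqr_ge0// !sqrtr_sqr (le_trans (gc x Dx))// ler_norm.
have ig : mu.-integrable D (EFin \o (fun x => g x ^+ 2)).
  apply: (@le_integrable _ _ _ mu D mD _ (cst (c ^+ 2)%:E)) => //.
  - by apply/measurable_EFinP; exact: measurable_funX.
  - move=> x Dx /=; rewrite lee_fin ger0_norm ?sqr_ge0//.
    by rewrite ger0_norm ?sqr_ge0// c20.
  - exact: integrable_cst_lty.
have -> : a * \int[mu]_(x in D) (g x ^+ 2) + b * fine (mu D) =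
    \int[mu]_(x in D) (a * g x ^+ 2 + b).
  rewrite RintegralD//.
  - by rewrite RintegralZl// Rintegral_cst.
  - exact: (integrableZl mD a ig).
  - exact: integrable_cst_lty.
apply: ge0_le_Rintegral_subset => //.
- by move=> x /fb/andP[].
- by move=> x _; rewrite addr_ge0// mulr_ge0// sqr_ge0.
- by move=> x /fb/andP[].
apply: le_lt_trans (integral_cst_lty (a * c ^+ 2 + b) mD Doo).
apply: ge0_le_integral_subset => // x Dx.
- by rewrite addr_ge0// mulr_ge0// sqr_ge0.
- by rewrite addr_ge0// mulr_ge0// sqr_ge0.
- by rewrite lerD2r ler_wpM2l// c20.
Qed.

End monotone_integral.

Lemma lebesgue_box_lty n (a : 'rV[R]_n) s : 0 <= s ->
  (lebesgue n (box a s) < +oo)%E.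
Proof. by move=> s0; rewrite lebesgue_box// ltry. Qed.

Lemma Rintegral_le_box n D (f : 'rV[R]_n -> R) a s c : 0 <= s -> 0 <= c ->
  D `<=` box a s -> (forall x, D x -> 0 <= f x <= c) ->
  \int[lebesgue n]_(x in D) f x <= c * (2 * s) ^+ n.
Proof.
move=> s0 c0 Da fc; have boo := lebesgue_box_lty a s0.
apply: le_trans (Rintegral_le_cst (measurable_box a s) boo c0 Da fc) _.
rewrite (_ : fine _ = (2 * s) ^+ n)//.
exact: etrans (congr1 fine (lebesgue_box a s0)) _.
Qed.

Lemma Rintegral_ge_box n D (f : 'rV[R]_n -> R) a s a' s' c b : 0 <= s -> 0 <= s' ->
  0 <= c -> 0 <= b -> box a s `<=` D -> D `<=` box a' s' ->
  (forall x, D x -> 0 <= f x <= b) -> (forall x, box a s x -> c <= f x) ->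
  c * (2 * s) ^+ n <= \int[lebesgue n]_(x in D) f x.
Proof.
move=> s0 s'0 c0 b0 aD Da' fb fc; have boo := lebesgue_box_lty a' s'0.
have := Rintegral_ge_cst (measurable_box a s) (measurable_box a' s') boo
  c0 b0 aD Da' fb fc.
rewrite (_ : fine _ = (2 * s) ^+ n)//.
exact: etrans (congr1 fine (lebesgue_box a s0)) _.
Qed.

Lemma measurable_ref_simplex k : measurable (@ref_simplex R k).
Proof.
rewrite (_ : @ref_simplex R k = (\bigcap_(i in [set: 'I_k])
    (rV_coord i @^-1` `[0, +oo[)) `&`
    ((fun t : 'rV[R]_k => \sum_i t 0 i) @^-1` `]-oo, 1])); last first.
  apply/seteqP; split=> t /=.
    by move=> [t0 t1]; split=> [i _ /=|]; rewrite in_itv/= ?andbT//; exact: t0.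
  move=> [t0 t1]; split=> [i|]; last by move: t1; rewrite in_itv.
  by have := t0 i Logic.I; rewrite /= in_itv/= andbT.
apply: measurableI.
  apply: fin_bigcap_measurable => [|i _]; first exact: finite_finset.
  rewrite -[X in measurable X]setTI; apply: measurable_rV_coord => //.
rewrite -[X in measurable X]setTI.
have : measurable_fun setT (fun t : 'rV[R]_k => \sum_i t 0 i : measurableTypeR R).
  by apply: measurable_sum => i; exact: measurable_rV_coord.
by apply => //; exact: measurable_itv.
Qed.

Lemma ref_simplex_box k : @ref_simplex R k `<=` box 0 1.
Proof.
move=> t [t0 t1] i; rewrite mxE subr0 ger0_norm//.
apply: le_trans t1; rewrite (bigD1 i)//= lerDl.
by apply: sumr_ge0.
Qed.

Lemma lebesgue_ref_simplex_lty k : (lebesgue k (@ref_simplex R k) < +oo)%E.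
Proof.
apply: (@le_lt_trans _ _ (lebesgue k (box 0 1))); last first.
  by rewrite lebesgue_box// ltry.
apply: le_measure; rewrite ?inE; [exact: measurable_ref_simplex|
  exact: measurable_box|exact: ref_simplex_box].
Qed.

Lemma lebesgue_ref_simplex_gt0 k : 0 < fine (lebesgue k (@ref_simplex R k)).
Proof.
(* The cube with side [r] and a corner at the origin lies in the simplex. *)
have [r [r0 rk]] : exists r : R, 0 < r /\ r *+ k <= 1.
  exists k.+1%:R^-1; rewrite invr_gt0 ltr0Sn; split=> //.
  by rewrite -[_ *+ k]mulr_natl ler_pdivrMr ?ltr0Sn// mul1r ler_nat leqnSn.
have r20 : 0 <= r / 2 by lra.
apply: (@lt_le_trans _ _
    (fine (lebesgue k (box (const_mx (r / 2) : 'rV[R]_k) (r / 2))))).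
  by rewrite lebesgue_box//= exprn_gt0//; lra.
apply: fine_le.
- by rewrite lebesgue_box.
- by rewrite ge0_fin_numE// lebesgue_ref_simplex_lty.
apply: le_measure; rewrite ?inE; [exact: measurable_box|
  exact: measurable_ref_simplex|].
move=> t ta; have t01 i : 0 <= t 0 i <= r.
  have := ta i; rewrite mxE ler_distl => /andP[h1 h2].
  by apply/andP; split; lra.
split=> [i|]; first by have /andP[] := t01 i.
apply: (@le_trans _ _ (\sum_(i < k) r)).
  by apply: ler_sum => i _; have /andP[] := t01 i.
by rewrite sumr_const card_ord.
Qed.

End boxes.

(** * Inverse estimates for polynomials *)

Section scaled_polynomials.
Context {R : realType} (d m : nat).
Local Notation E := 'rV[R]_d.
Local Notation idx := {ffun 'I_d -> 'I_m.+1}.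
Implicit Types (a x : E) (s : R) (c : idx -> R) (n : 'I_d -> nat) (p : E -> R).

(** Polynomials of degree at most [m] in each variable, written in the coordinates
    [(x - a) / s] of the cube of centre [a] and half side [s]; [n j] is the order of
    differentiation in the variable [j]. In this form a derivative costs exactly one
    factor [s^-1], see [partial_spoly], and the coefficients are those of a polynomial
    on the reference cube. *)
Definition spoly a s c n x : R :=
  \sum_(b : idx) c b * \prod_j (('X^(b j))^`(n j)).[(x 0 j - a 0 j) / s].

(** Each power [x 0 j ^+ k] is expanded around [a 0 j] separately; the product over
    [j] of these sums is a sum over all the choices of exponents. *)
Lemma poly_fun_spoly p a s : poly_fun m p -> s != 0 ->
  exists c, p = spoly a s c (fun=> 0%N).
Proof.
move=> [c pc] s0.
pose T (b : idx) (j : 'I_d) (l : 'I_m.+1) : R :=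
  (((a 0 j)%:P + s *: 'X : {poly R}) ^+ b j)`_l.
exists (fun e => \sum_(b : idx | (\sum_i b i <= m)%N) c b * \prod_j T b j (e j)).
apply/funext => x; rewrite pc /spoly.
under [RHS]eq_bigr do rewrite mulr_suml.
rewrite exchange_big /=; apply: eq_bigr => b _.
under [RHS]eq_bigr do rewrite -mulrA -big_split/=.
rewrite -mulr_sumr; congr (_ * _).
rewrite -(bigA_distr_bigA (fun j l => T b j l * (('X^l)^`(0)).[(x 0 j - a 0 j) / s])).
apply: eq_bigr => j _.
under [RHS]eq_bigr do rewrite derivn0 hornerXn.
rewrite -horner_coef_wide.
  rewrite horner_exp hornerD hornerZ hornerX hornerC.
  by rewrite mulrCA divff// mulr1 subrKC.
apply: leq_trans (size_poly_exp_leq _ _) _; rewrite ltnS.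
have sz : ((size ((a 0 j)%:P + s *: 'X : {poly R})%R).-1 <= 1)%N.
  rewrite -subn1 leq_subLR; apply: leq_trans (size_polyD _ _) _.
  rewrite geq_max (leq_trans (size_polyC_leq1 _))//=.
  by apply: leq_trans (size_scale_leq _ _) _; rewrite size_polyX.
apply: leq_trans (leq_mul sz (leqnn _)) _.
by rewrite mul1n -ltnS.
Qed.

Lemma derive_line (f : E -> R) x (v : E) (P : {poly R}) :
  (forall h, f (h *: v + x) = P.[h]) ->
  derivable f x v /\ 'D_v f x = P^`().[0].
Proof.
move=> fP; have dP := is_derive_poly P 0.
have fE : (fun h => f (h *: v + x)) = horner P by apply/funext.
split; first by apply/derivable1P; rewrite fE; apply: ex_derive.
rewrite -(@derive_val _ _ _ _ _ _ _ dP) /derive.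
have fx : f x = P.[0] by rewrite -fP scale0r add0r.
suff E h : h^-1 *: ((f \o shift x) (h *: v) - f x) =
    h^-1 *: ((horner P \o shift 0) h%:A - P.[0]) by rewrite (funext E).
by rewrite /= fP fx addr0 [h%:A]mulr1.
Qed.

Definition succ_at (i : 'I_d) n : 'I_d -> nat := fun j => (n j + (j == i))%N.

Lemma derive_spoly a s c n i x :
  derivable (spoly a s c n) x (delta_mx 0 i) /\
  partial i (spoly a s c n) x = s^-1 * spoly a s c (succ_at i n) x.
Proof.
pose l (j : 'I_d) : {poly R} := s^-1 *: 'X + ((x 0 j - a 0 j) / s)%:P.
pose P : {poly R} := \sum_(b : idx) (c b *
    \prod_(j | j != i) (('X^(b j))^`(n j)).[(x 0 j - a 0 j) / s]) *:
    (('X^(b i))^`(n i) \Po l i).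
have [|h1 h2] := @derive_line (spoly a s c n) x (delta_mx 0 i) P.
  move=> h; rewrite /spoly horner_sum; apply: eq_bigr => b _.
  rewrite hornerZ horner_comp (bigD1 i)//= -[RHS]mulrA [_.[_] * _]mulrC.
  congr (_ * (_ * _)).
    apply: eq_bigr => j ji; rewrite !mxE (negPf ji) andbF mulr0 add0r.
    by [].
  rewrite /l hornerD hornerZ hornerX hornerC !mxE !eqxx mulr1.
  by congr horner; rewrite -addrA mulrDl mulrC.
split=> //; rewrite /partial h2 /P raddf_sum /= horner_sum /spoly mulr_sumr.
apply: eq_bigr => b _; rewrite derivZ hornerZ deriv_comp hornerM horner_comp.
rewrite /l derivD derivC addr0 derivZ derivX -/(l i) hornerZ hornerC mulr1.
rewrite hornerD hornerZ hornerX hornerC mulr0 add0r.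
rewrite [\prod_j _ in RHS](bigD1 i)//= /succ_at eqxx addn1 derivnS.
under [in RHS]eq_bigr => j ji do rewrite (negPf ji) addn0.
ring.
Qed.

Lemma partial_spoly a s c n i :
  partial i (spoly a s c n) = fun x => s^-1 * spoly a s c (succ_at i n) x.
Proof. by apply/funext => x; have [] := derive_spoly a s c n i x. Qed.

Lemma partial2_spoly a s c n i x :
  partial i (partial i (spoly a s c n)) x =
  s^-1 ^+ 2 * spoly a s c (succ_at i (succ_at i n)) x.
Proof.
rewrite partial_spoly /partial; have [h1 h2] := derive_spoly a s c (succ_at i n) i x.
rewrite (_ : (fun x => _) = s^-1 *: spoly a s c (succ_at i n)); last by apply/funext.
by rewrite deriveZ// -/(partial i _ x) h2 expr2 -mulrA.
Qed.

Lemma continuous_mul_fun (T : topologicalType) (f g : T -> R) :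
  continuous f -> continuous g -> continuous (fun t => f t * g t).
Proof. by move=> cf cg t; apply: cvgM; [exact: cf|exact: cg]. Qed.

Lemma continuous_add_fun (T : topologicalType) (f g : T -> R) :
  continuous f -> continuous g -> continuous (fun t => f t + g t).
Proof. by move=> cf cg t; apply: cvgD; [exact: cf|exact: cg]. Qed.

Lemma continuous_sum_fun (T : topologicalType) (I : Type) (r : seq I) (F : I -> T -> R) :
  (forall i, continuous (F i)) -> continuous (fun t => \sum_(i <- r) F i t).
Proof.
move=> cF; elim: r => [|i r IH] x.
  by under eq_fun do rewrite big_nil; exact: cvg_cst.
by under eq_fun do rewrite big_cons; apply: cvgD; [exact: cF|exact: IH].
Qed.

Lemma continuous_prod_fun (T : topologicalType) (I : Type) (r : seq I) (F : I -> T -> R) :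
  (forall i, continuous (F i)) -> continuous (fun t => \prod_(i <- r) F i t).
Proof.
move=> cF; elim: r => [|i r IH] x.
  by under eq_fun do rewrite big_nil; exact: cvg_cst.
by under eq_fun do rewrite big_cons; apply: cvgM; [exact: cF|exact: IH].
Qed.

Lemma continuous_spoly a s c n : continuous (spoly a s c n).
Proof.
apply: continuous_sum_fun => b.
apply: continuous_mul_fun; first exact: cst_continuous.
apply: continuous_prod_fun => j x.
apply: (@continuous_comp _ _ _ (fun x : E => (x 0 j - a 0 j) / s)
  (horner ('X^(b j))^`(n j))) => //; last exact: continuous_horner.
apply: (@continuous_mul_fun _ (fun x : E => x 0 j - a 0 j) (cst s^-1));
  last exact: cst_continuous.
apply: (@continuous_add_fun _ (fun x : E => x 0 j) (cst (- a 0 j)));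
  last exact: cst_continuous.
exact: coord_continuous.
Qed.

Lemma fact_homo : {homo factorial : k l / (k <= l)%N}.
Proof.
apply: homo_leq => [//|? ? ?|k]; first exact: leq_trans.
by rewrite factS leq_pmull.
Qed.

(** Bounds a derivative of a monomial on the cube with half side [k], for [1 <= k]. *)
Definition mono_bound (k : R) : R := (m`!%:R * k ^+ m) ^+ d.

Lemma spoly_le a s c n (C k : R) x : 0 < s -> 1 <= k ->
  (forall b, `|c b| <= C) -> box a (k * s) x ->
  `|spoly a s c n x| <= #|{: idx}|%:R * (C * mono_bound k).
Proof.
move=> s0 k1 cC xk; apply: le_trans (ler_norm_sum _ _ _) _.
rewrite mulr_natl -sumr_const; apply: ler_sum => b _.
rewrite normrM ler_pM// normr_prod.
apply: le_trans (_ : \prod_(j < d) (m`!%:R * k ^+ m) <= _); last first.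
  by rewrite prodr_const card_ord.
apply: ler_prod => j _; rewrite normr_ge0/= derivnXn hornerMn hornerXn normrMn.
rewrite -[_ *+ _ ^_ _]mulr_natl; have bm : (b j <= m)%N by rewrite -ltnS.
apply: ler_pM => //.
  rewrite ler_nat; apply: leq_trans (_ : ((b j)`! <= _)%N); last exact: fact_homo.
  have [nb|nb] := leqP (n j) (b j); last by rewrite ffact_small.
  by rewrite -(ffact_fact nb) leq_pmulr// fact_gt0.
rewrite normrX; apply: le_trans (_ : k ^+ (b j - n j) <= _).
  rewrite lerXn2r ?nnegrE ?normr_ge0//; first lra.
  by rewrite normrM normfV ler_pdivrMr ?normr_gt0 ?gt_eqF// (gtr0_norm s0) xk.
by rewrite ler_weXn2l// leq_subLR (leq_trans bm)// leq_addl.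
Qed.

(** The nodes lie in [0, 1), at distance at least 1 / (m + 1) from 1: this leaves room
    for a small cube around every point of the grid. *)
Definition grid_node (j : 'I_m.+1) : R := j%:R / m.+1%:R.

Definition grid a s (g : idx) : E := \row_j (a 0 j + s * grid_node (g j)).

Lemma grid_node_itv j : 0 <= grid_node j <= 1 - m.+1%:R^-1.
Proof.
rewrite divr_ge0//= ler_pdivrMr ?ltr0Sn// mulrBl mul1r mulVf ?pnatr_eq0//.
by rewrite lerBrDr natr1 ler_nat.
Qed.

Lemma grid_inverse : exists W : 'I_m.+1 -> 'I_m.+1 -> R, forall k l : 'I_m.+1,
  \sum_j grid_node j ^+ k * W j l = (k == l)%:R.
Proof.
pose V : 'M[R]_m.+1 := Vandermonde m.+1 (\row_j grid_node j).
have Vu : V \in unitmx.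
  rewrite unitmxE unitfE det_Vandermonde; apply/prodf_neq0 => i _.
  apply/prodf_neq0 => j ij; rewrite !mxE subr_eq0 /grid_node.
  rewrite -subr_eq0 -mulrBl mulf_neq0 ?invr_eq0 ?pnatr_eq0//.
  by rewrite subr_eq0 eqr_nat gtn_eqF.
exists (fun j l => invmx V j l) => k l.
have /matrixP/(_ k l) := mulmxV Vu; rewrite !mxE => <-.
by apply: eq_bigr => j _; rewrite /V !mxE.
Qed.

(** The inverse of a tensor product of Vandermonde matrices is the tensor product of
    their inverses. It expresses the coefficients by the values on the grid, with
    factors that depend on [d] and [m] only. *)
Lemma coef_le_grid : exists2 W : R, 0 < W & forall a s c (M : R), 0 < s ->
  (forall g, `|spoly a s c (fun=> 0%N) (grid a s g)| <= M) ->
  forall b, `|c b| <= W * M.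
Proof.
have [W WP] := grid_inverse.
exists (1 + \sum_(b : idx) \sum_(g : idx) \prod_j `|W (g j) (b j)|).
  rewrite ltr_pwDl// sumr_ge0// => b _; rewrite sumr_ge0// => g _.
  by rewrite prodr_ge0.
move=> a s c M s0 cM b.
have M0 : 0 <= M by apply: le_trans (cM [ffun=> ord0]).
have -> : c b = \sum_(g : idx) spoly a s c (fun=> 0%N) (grid a s g) *
    \prod_j W (g j) (b j).
  under eq_bigr do rewrite /spoly mulr_suml.
  rewrite exchange_big /=.
  have E e : \sum_(g : idx) c e * \prod_j (('X^(e j))^`(0)).[(grid a s g 0 j - a 0 j) / s] *
      \prod_j W (g j) (b j) = c e * \prod_j \sum_l grid_node l ^+ e j * W l (b j).
    rewrite (bigA_distr_bigA (fun j l => grid_node l ^+ e j * W l (b j))) mulr_sumr.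
    apply: eq_bigr => g _; rewrite -mulrA -big_split/=; congr (_ * _).
    apply: eq_bigr => j _; rewrite hornerXn mxE [_ + s * _]addrC addrK.
    by rewrite [s * _]mulrC (mulfK (lt0r_neq0 s0)).
  under eq_bigr do rewrite E.
  rewrite (bigD1 b)//= [X in _ = _ + X]big1 ?addr0 => [|e eb].
    by rewrite big1 ?mulr1// => j _; rewrite WP eqxx.
  have [j ej] : exists j, e j != b j.
    apply/existsP; rewrite -negb_forall; apply: contra eb => /forallP eb.
    by apply/eqP/ffunP => j; exact/eqP/eb.
  by rewrite (bigD1 j)//= WP (negPf ej) mul0r mulr0.
apply: le_trans (ler_norm_sum _ _ _) _.
apply: le_trans (_ : (\sum_(g : idx) \prod_j `|W (g j) (b j)|) * M <= _); last first.
  rewrite ler_wpM2r// [X in _ <= 1 + X](bigD1 b)//= addrCA lerDl addr_ge0// sumr_ge0// => e _.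
  by rewrite sumr_ge0// => g _; rewrite prodr_ge0.
rewrite mulr_suml; apply: ler_sum => g _; rewrite normrM normr_prod mulrC.
by rewrite ler_wpM2l// prodr_ge0.
Qed.

Lemma exprn_lip (y z : R) k : `|y| <= 1 -> `|z| <= 1 ->
  `|y ^+ k - z ^+ k| <= k%:R * `|y - z|.
Proof.
move=> y1 z1; rewrite subrXX normrM mulrC ler_wpM2r//.
apply: le_trans (ler_norm_sum _ _ _) _.
apply: le_trans (_ : \sum_(i < k) 1 <= _); last by rewrite sumr_const card_ord.
apply: ler_sum => i _; rewrite normrM !normrX.
by rewrite mulr_ile1 ?exprn_ge0 ?exprn_ile1.
Qed.

Lemma prod_lip (I : Type) (r : seq I) (y z : I -> R) :
  (forall i, `|y i| <= 1) -> (forall i, `|z i| <= 1) ->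
  `|\prod_(i <- r) y i - \prod_(i <- r) z i| <= \sum_(i <- r) `|y i - z i|.
Proof.
move=> y1 z1; elim: r => [|i r IH]; first by rewrite !big_nil subrr normr0.
rewrite !big_cons.
have -> : forall p q : R, y i * p - z i * q = (y i - z i) * p + z i * (p - q).
  by move=> p q; ring.
apply: le_trans (ler_normD _ _) _; rewrite !normrM lerD//.
  by rewrite ler_piMr// normr_prod prodr_ile1// => j; rewrite normr_ge0 y1.
by apply: le_trans IH; rewrite ler_piMl.
Qed.

Lemma poly_continuous p : poly_fun m p -> continuous p.
Proof.
move=> /(poly_fun_spoly 0)/(_ (oner_neq0 R))[c ->]; exact: continuous_spoly.
Qed.

Lemma poly_partial_continuous p i : poly_fun m p -> continuous (partial i p).
Proof.
move=> /(poly_fun_spoly 0)/(_ (oner_neq0 R))[c ->]; rewrite partial_spoly.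
apply: continuous_mul_fun; [exact: cst_continuous|exact: continuous_spoly].
Qed.

Lemma poly_derivable p i x : poly_fun m p -> derivable p x (delta_mx 0 i).
Proof.
move=> /(poly_fun_spoly 0)/(_ (oner_neq0 R))[c ->].
by have [] := derive_spoly 0 1 c (fun=> 0%N) i x.
Qed.

Lemma poly_partial_derivable p i x : poly_fun m p ->
  derivable (partial i p) x (delta_mx 0 i).
Proof.
move=> /(poly_fun_spoly 0)/(_ (oner_neq0 R))[c ->]; rewrite partial_spoly.
have [h _] := derive_spoly 0 1 c (succ_at i (fun=> 0%N)) i x.
rewrite (_ : (fun x => _) = 1^-1 *: spoly 0 1 c (succ_at i (fun=> 0%N))); last exact/funext.
exact: derivableZ.
Qed.

Lemma poly_bounded_box p a s : poly_fun m p ->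
  exists2 B, 0 <= B & forall x, box a s x -> `|p x| <= B.
Proof.
move=> /(poly_fun_spoly 0)/(_ (oner_neq0 R))[c ->].
pose C := \sum_b `|c b|.
pose k := 1 + `|s| + \sum_j `|a 0 j|.
have k1 : 1 <= k by rewrite /k -addrA lerDl addr_ge0// sumr_ge0.
exists (#|{: idx}|%:R * (C * mono_bound k)).
  rewrite mulr_ge0// mulr_ge0//; first exact: sumr_ge0.
  by rewrite /mono_bound exprn_ge0// mulr_ge0// exprn_ge0//; lra.
move=> x xa; apply: spoly_le => // [b|j].
  by rewrite /C (bigD1 b)//= lerDl sumr_ge0.
rewrite mxE subr0 mulr1; have := xa j.
have : `|a 0 j| <= \sum_j `|a 0 j| by rewrite (bigD1 j)//= lerDl sumr_ge0.
have := ler_normD (x 0 j - a 0 j) (a 0 j); rewrite subrK.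
have := ler_norm s; rewrite /k; lra.
Qed.

Definition poly_bounds (k s M : R) a (p : E -> R) := forall x, box a (k * s) x ->
  [/\ `|p x| <= M, forall i, `|partial i p x| <= M / s & `|laplacian p x| <= M / s ^+ 2].

(** Let [Mg] be the maximum of [p] in absolute value on the grid. It bounds the
    coefficients of [p], hence [p] and its derivatives on any multiple of the cube.
    For the same reason [p] varies slowly, and [Mg / 2 <= `|p|] on a cube of half side
    [s * e] around the point of the grid where the maximum is reached, with a fixed
    [e]. So the L^2 norm of [p] bounds [Mg]. *)
Lemma poly_inverse_estimates (k : R) : 1 <= k -> exists2 C : R, 0 < C &
  forall p a s, poly_fun m p -> 0 < s -> exists M, [/\ 0 <= M,
    poly_bounds k s M a p &
    forall D a' s', box a s `<=` D -> D `<=` box a' s' -> 0 <= s' ->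
      s ^+ d * M ^+ 2 <= C * \int[lebesgue d]_(x in D) (p x ^+ 2)].
Proof.
move=> k1; have [W W0 cW] := coef_le_grid.
pose L := W * (\sum_(b : idx) \sum_(j < d) (b j)%:R) : R.
(* [p] varies by at most [L * e * Mg <= Mg / 2] on a cube of half side [s * e], and a
   cube of this size around a point of the grid stays in [box a s]. *)
pose e := (2 * L + m.+1%:R)^-1 : R.
pose N := #|{: idx}|%:R * (W * mono_bound k) : R.
have m1 : 1 <= m.+1%:R :> R by rewrite ler1n.
have L0 : 0 <= L.
  by rewrite mulr_ge0 ?(ltW W0)// sumr_ge0// => b _; rewrite sumr_ge0.
have e0 : 0 < e by rewrite invr_gt0; lra.
have N0 : 0 <= N.
  rewrite mulr_ge0// mulr_ge0 ?(ltW W0)// /mono_bound exprn_ge0// mulr_ge0//.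
  by rewrite exprn_ge0//; lra.
pose F := 1 + N + d%:R * N.
have F0 : 1 <= F by rewrite /F -addrA lerDl addr_ge0// mulr_ge0.
exists (4 * F ^+ 2 / (2 * e) ^+ d).
  by rewrite divr_gt0 ?mulr_gt0 ?exprn_gt0//; lra.
move=> p a s pp s0; have [c pc] := poly_fun_spoly a pp (lt0r_neq0 s0).
case: (@arg_maxP _ _ _ [ffun=> ord0] xpredT (fun g : idx => `|p (grid a s g)|)) => // g _ gmax.
set Mg := `|p (grid a s g)| in gmax.
have Mg0 : 0 <= Mg by exact: normr_ge0.
have cM b : `|c b| <= W * Mg by apply: (cW a s c Mg) => // g'; rewrite -pc; exact: gmax.
exists (F * Mg); split; first by rewrite mulr_ge0//; lra.
  have NM : N * Mg <= F * Mg.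
    by rewrite ler_wpM2r// /F; have := mulr_ge0 (ler0n R d) N0; lra.
  have bnd n x : box a (k * s) x -> `|spoly a s c n x| <= N * Mg.
    move=> xk; apply: le_trans (spoly_le n s0 k1 cM xk) _.
    by rewrite /N le_eqVlt; apply/orP; left; apply/eqP; ring.
  move=> x xk; split.
  - by rewrite pc (le_trans (bnd _ _ xk)).
  - move=> i; rewrite pc partial_spoly normrM mulrC [`|s^-1|]gtr0_norm ?invr_gt0//.
    by rewrite ler_wpM2r ?invr_ge0 ?(ltW s0)// (le_trans (bnd _ _ xk)).
  - rewrite pc /laplacian; apply: le_trans (ler_norm_sum _ _ _) _.
    apply: le_trans (_ : \sum_(i < d) N * Mg / s ^+ 2 <= _).
      apply: ler_sum => i _; rewrite partial2_spoly normrM mulrC exprVn.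
      rewrite [`|(s ^+ 2)^-1|]gtr0_norm ?invr_gt0 ?exprn_gt0//.
      by rewrite ler_wpM2r ?invr_ge0 ?exprn_ge0 ?(ltW s0)// bnd.
    rewrite sumr_const card_ord -[_ *+ d]mulr_natl mulrA.
    rewrite ler_wpM2r ?invr_ge0 ?exprn_ge0 ?(ltW s0)// mulrA ler_wpM2r//.
    by rewrite /F; lra.
move=> D a' s' aD Da' s'0.
pose g0 := grid a s g.
have se0 : 0 < s * e by rewrite mulr_gt0.
have em : e <= m.+1%:R^-1 by rewrite lef_pV2 ?posrE ?ltr0Sn//; lra.
have g0in j : `|grid_node (g j)| + e <= 1.
  have /andP[h1 h2] := grid_node_itv (g j); rewrite ger0_norm//.
  by apply: le_trans (lerD h2 em) _; rewrite subrK.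
have sub : box g0 (s * e) `<=` box a s.
  move=> x xg j; have := xg j; rewrite mxE => h.
  have -> : x 0 j - a 0 j = (x 0 j - (a 0 j + s * grid_node (g j))) + s * grid_node (g j).
    by ring.
  apply: le_trans (ler_normD _ _) _; rewrite normrM (gtr0_norm s0).
  apply: le_trans (lerD h (lexx _)) _; rewrite -mulrDr addrC.
  by rewrite ler_piMr ?(ltW s0)// g0in.
have low x : box g0 (s * e) x -> Mg / 2 <= `|p x|.
  move=> xg.
  have dist : `|p x - p g0| <= Mg / 2.
    pose y j := (x 0 j - a 0 j) / s; pose z j := grid_node (g j).
    have yz j : `|y j - z j| <= e.
      rewrite -(ler_pM2l s0) -{1}(gtr0_norm s0) -normrM.
      have -> : s * (y j - z j) = x 0 j - g0 0 j.
        by rewrite mxE /y /z mulrBr [s * (_ / s)]mulrC divfK ?gt_eqF//; ring.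
      exact: xg.
    have z1 j : `|z j| <= 1 by have := g0in j; rewrite -/(z j); lra.
    have y1 j : `|y j| <= 1.
      have := g0in j; rewrite -/(z j); have := yz j.
      have := ler_normD (y j - z j) (z j); rewrite subrK; lra.
    rewrite pc /spoly -sumrB; apply: le_trans (ler_norm_sum _ _ _) _.
    apply: le_trans (_ : \sum_(b : idx) W * Mg * (\sum_(j < d) (b j)%:R * e) <= _).
      apply: ler_sum => b _; rewrite -mulrBr normrM ler_pM//.
      apply: le_trans (_ : `|\prod_j y j ^+ b j - \prod_j z j ^+ b j| <= _).
        rewrite le_eqVlt; apply/orP; left; apply/eqP; congr `|_ - _|.
          by apply: eq_bigr => j _; rewrite /= hornerXn.
        apply: eq_bigr => j _; rewrite /= hornerXn mxE [a 0 j + _]addrC addrK.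
        by rewrite [s * _]mulrC mulfK ?gt_eqF.
      apply: le_trans (prod_lip _ _ _) _.
      - by move=> j; rewrite normrX exprn_ile1.
      - by move=> j; rewrite normrX exprn_ile1.
      apply: ler_sum => j _; apply: le_trans (exprn_lip _ _ _) _ => //.
      by rewrite ler_wpM2l.
    have -> : \sum_(b : idx) W * Mg * (\sum_(j < d) (b j)%:R * e) = L * e * Mg.
      rewrite /L -mulr_sumr; under eq_bigr do rewrite -mulr_suml.
      by rewrite -mulr_suml; ring.
    have Le : L * e <= 2^-1.
      rewrite /e ler_pdivrMr; last lra.
      lra.
    by rewrite mulrC ler_wpM2l.
  have := ler_normD (p g0 - p x) (p x); rewrite subrK distrC -[`|p g0|]/Mg; lra.
have [B B0 pB] := poly_bounded_box a' s' pp.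
have sq (u v : R) : 0 <= u -> u <= `|v| -> u ^+ 2 <= v ^+ 2.
  by move=> u0 uv; rewrite -[v ^+ 2]real_normK ?num_real// lerXn2r ?nnegrE.
have h1 x : D x -> 0 <= p x ^+ 2 <= B ^+ 2.
  move=> Dx; rewrite sqr_ge0/= -[p x ^+ 2]real_normK ?num_real//.
  by rewrite lerXn2r ?nnegrE ?normr_ge0// pB//; exact: Da'.
have h2 x : box g0 (s * e) x -> (Mg / 2) ^+ 2 <= p x ^+ 2.
  by move=> xg; apply: sq; [lra|exact: low].
have h := Rintegral_ge_box (ltW se0) s'0 (sqr_ge0 (Mg / 2)) (sqr_ge0 B)
  (subset_trans sub aD) Da' h1 h2.
have -> : s ^+ d * (F * Mg) ^+ 2 = 4 * F ^+ 2 / (2 * e) ^+ d *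
    ((Mg / 2) ^+ 2 * (2 * (s * e)) ^+ d).
  rewrite !exprMn; field; rewrite !expf_neq0 ?gt_eqF//=.
by rewrite ler_wpM2l// divr_ge0 ?mulr_ge0 ?exprn_ge0//; lra.
Qed.

End scaled_polynomials.

(** * Least squares and spaces of polynomial functions *)

Section least_squares.
Context {R : realType}.

Lemma sqnorm_mx n (v : 'rV[R]_n) : (v *m v^T) 0 0 = \sum_j v 0 j ^+ 2.
Proof. by rewrite mxE; apply: eq_bigr => j _; rewrite mxE. Qed.

Lemma sqnorm_mx_eq0 n (v : 'rV[R]_n) : v *m v^T = 0 -> v = 0.
Proof.
move=> /matrixP/(_ 0 0); rewrite sqnorm_mx mxE => /eqP.
rewrite psumr_eq0 => [/allP v0|j _]; last exact: sqr_ge0.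
apply/rowP => j; rewrite mxE; apply/eqP.
by have := v0 j (mem_index_enum j); rewrite /= sqrf_eq0.
Qed.

(** If [u *m A *m A^T = 0] then the square of the norm of [u *m A] vanishes; so
    [A *m A^T] and [A^T] have the same rank, and the same row space. *)
Lemma normal_equations k n (A : 'M[R]_(k, n)) (b : 'rV[R]_n) :
  exists u : 'rV_k, (b - u *m A) *m A^T = 0.
Proof.
have sub : (A^T <= A *m A^T)%MS.
  have /mxrank_leqif_sup[le eqr] : (A *m A^T <= A^T)%MS by exact: submxMl.
  rewrite -eqr eqn_leq le mxrank_tr.
  have /mxrankS : (kermx (A *m A^T) <= kermx A)%MS.
    apply/rV_subP => u /sub_kermxP uA; apply/sub_kermxP/sqnorm_mx_eq0.
    by rewrite trmx_mul !mulmxA -[u *m A *m _]mulmxA uA mul0mx.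
  rewrite !mxrank_ker => h.
  by have := rank_leq_row A; have := rank_leq_row (A *m A^T); lia.
have /submxP[u uE] : (b *m A^T <= A *m A^T)%MS by apply: submx_trans sub; exact: submxMl.
by exists u; rewrite mulmxBl uE mulmxA subrr.
Qed.

Lemma least_squares k n (A : 'M[R]_(k, n)) (b : 'rV[R]_n) :
  exists u : 'rV_k, forall w : 'rV_k,
    \sum_j ((b - u *m A) 0 j) ^+ 2 <= \sum_j ((b - w *m A) 0 j) ^+ 2.
Proof.
have [u uP] := normal_equations A b; exists u => w.
rewrite -!sqnorm_mx.
have -> : b - w *m A = (b - u *m A) + (u - w) *m A.
  by rewrite mulmxBl addrA subrK.
set r := b - u *m A in uP *; set t := _ *m A.
have rt : r *m t^T = 0 by rewrite trmx_mul mulmxA uP mul0mx.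
have tr : t *m r^T = 0 by rewrite -[LHS]trmxK trmx_mul trmxK rt trmx0.
have -> : (r + t) *m (r + t)^T = r *m r^T + t *m t^T.
  by rewrite [(r + t)^T]linearD/= mulmxDl !mulmxDr rt tr addr0 add0r.
rewrite [X in _ <= X]mxE lerDl.
by rewrite sqnorm_mx sumr_ge0// => j _; rewrite sqr_ge0.
Qed.
End least_squares.

Section polynomial_functions.
Context {R : realType} {d : nat}.
Local Notation E := 'rV[R]_d.
Implicit Types (p q f : E -> R).

Definition mono m (b : {ffun 'I_d -> 'I_m.+1}) (x : E) : R := \prod_i x 0 i ^+ b i.

Lemma poly_fun_mono m (b : {ffun 'I_d -> 'I_m.+1}) :
  (\sum_i b i <= m)%N -> poly_fun m (mono b).
Proof.
move=> bm; exists (fun e => (e == b)%:R) => x; rewrite (bigD1 b)//= eqxx mul1r.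
by rewrite [X in _ + X]big1 ?addr0// => e /andP[_ /negPf->]; rewrite mul0r.
Qed.

Lemma poly_fun_lin m p q (k : R) : poly_fun m p -> poly_fun m q ->
  poly_fun m (fun x => p x + k * q x).
Proof.
move=> [c pc] [e qe]; exists (fun b => c b + k * e b) => x.
rewrite pc qe mulr_sumr -big_split/=; apply: eq_bigr => b _.
by rewrite mulrDl mulrA.
Qed.

Lemma poly_fun0 m : poly_fun m (fun _ : E => 0 : R).
Proof. by exists (fun=> 0) => x; rewrite big1// => b _; rewrite mul0r. Qed.

Lemma poly_fun_sum m (I : finType) (P : pred I) (F : I -> E -> R) (c : I -> R) :
  (forall i, P i -> poly_fun m (F i)) ->
  poly_fun m (fun x => \sum_(i | P i) c i * F i x).
Proof.
move=> FP; rewrite (_ : (fun x => _) = fun x : E => \sum_(i <- enum P) c i * F i x);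
  last by apply/funext => x; rewrite big_enum.
have : all P (enum P) by apply/allP => i; rewrite mem_enum.
elim: (enum P) => [_|i s IH /= /andP[Pi Ps]].
  rewrite (_ : (fun x => _) = fun _ : E => 0); first exact: poly_fun0.
  by apply/funext => x; rewrite big_nil.
rewrite (_ : (fun x => _) = fun x => \sum_(j <- s) c j * F j x + c i * F i x).
  by apply: poly_fun_lin; [exact: IH|exact: FP].
by apply/funext => x; rewrite big_cons addrC.
Qed.

Lemma poly_fun_affine m (a : R) (g : E) : (1 <= m)%N ->
  poly_fun m (fun x => a + dotp g x).
Proof.
move=> m1.
have c1 : poly_fun m (fun _ : E => 1 : R).
  have -> : (fun _ : E => 1 : R) = mono [ffun=> (ord0 : 'I_m.+1)].
    by apply/funext => x; rewrite /mono big1// => i _; rewrite ffunE.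
  by apply: poly_fun_mono; rewrite big1// => i _; rewrite ffunE.
have cX i : poly_fun m (fun x : E => x 0 i).
  pose b : {ffun 'I_d -> 'I_m.+1} := [ffun j => inord (j == i)].
  have bE j : b j = (j == i) :> nat.
    by rewrite ffunE inordK// ltnS; case: eqP.
  have -> : (fun x : E => x 0 i) = mono b.
    apply/funext => x; rewrite /mono (bigD1 i)//= bE eqxx expr1 big1 ?mulr1//.
    by move=> j ji; rewrite bE (negPf ji).
  apply: poly_fun_mono; rewrite (bigD1 i)//= bE eqxx big1 ?addn0//.
  by move=> j ji; rewrite bE (negPf ji).
rewrite (_ : (fun x => _) = fun x : E => \sum_(i < d) g 0 i * x 0 i + a * 1).
  by apply: poly_fun_lin => //; exact: poly_fun_sum.
by apply/funext => x; rewrite mulr1 addrC.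
Qed.

Lemma affine_poly_fun1 p : poly_fun 1 p ->
  exists a (g : E), forall x, p x = a + dotp g x.
Proof.
move=> [c pc].
have /choice[ag agP] : forall b : {ffun 'I_d -> 'I_2}, exists ag : R * E,
    (\sum_i b i <= 1)%N -> forall x, mono b x = ag.1 + dotp ag.2 x.
  move=> b; have [[i bi]|b0] := pselect (exists i, b i != ord0).
    exists (0, delta_mx 0 i) => b1 x.
    have bi1 : b i = 1%N :> nat.
      by move: bi; rewrite -val_eqE /=; have := ltn_ord (b i); lia.
    have bj j : j != i -> b j = 0%N :> nat.
      move=> ji; move: b1; rewrite (bigD1 i)//= (bigD1 j)//= bi1; lia.
    rewrite /mono /dotp (bigD1 i)//= bi1 expr1 [in RHS](bigD1 i)//= !mxE !eqxx mul1r.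
    rewrite big1 => [|j ji]; last by rewrite bj.
    rewrite big1 => [|j ji]; last by rewrite mxE (negPf ji) andbF mul0r.
    by rewrite add0r addr0 mulr1.
  exists (1, 0) => _ x; rewrite /mono /dotp !big1 ?addr0// => i _.
    by rewrite mxE mul0r.
  have [->|bi] := eqVneq (b i) ord0; first by rewrite expr0.
  by case: b0; exists i.
exists (\sum_(b : {ffun 'I_d -> 'I_2} | (\sum_i b i <= 1)%N) c b * (ag b).1).
exists (\sum_(b : {ffun 'I_d -> 'I_2} | (\sum_i b i <= 1)%N) c b *: (ag b).2) => x.
rewrite pc; transitivity (\sum_(b : {ffun 'I_d -> 'I_2} | (\sum_i b i <= 1)%N)
    (c b * (ag b).1 + c b * dotp (ag b).2 x)).
  by apply: eq_bigr => b b1; rewrite -mulrDr -agP.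
rewrite big_split/=; congr (_ + _); rewrite /dotp.
under [RHS]eq_bigr do rewrite summxE mulr_suml.
rewrite exchange_big/=; apply: eq_bigr => b _; rewrite mulr_sumr.
by apply: eq_bigr => i _; rewrite mxE mulrA.
Qed.

(** The coefficients at exponents of total degree above [m] are ignored, so that every
    row vector represents an element of [poly_fun m]. *)
Definition coeff_poly m (u : 'rV[R]_#|{: {ffun 'I_d -> 'I_m.+1}}|) (x : E) : R :=
  \sum_k (if (\sum_i (enum_val k : {ffun 'I_d -> 'I_m.+1}) i <= m)%N
    then u 0 k * mono (enum_val k) x else 0).

Lemma poly_fun_coeff m p : poly_fun m p -> exists u, p = @coeff_poly m u.
Proof.
move=> [c pc]; exists (\row_k c (enum_val k)); apply/funext => x.
rewrite pc big_mkcond (reindex_onto _ _ (in1W enum_rankK))/=.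
by apply: eq_big => [k|k _]; rewrite ?enum_valK ?eqxx// mxE.
Qed.

Lemma coeff_poly_fun m u : poly_fun m (@coeff_poly m u).
Proof.
exists (fun b => u 0 (enum_rank b)) => x; rewrite [RHS]big_mkcond.
rewrite [RHS](reindex_onto _ _ (in1W enum_rankK))/=.
by apply: eq_big => [k|k _]; rewrite ?enum_valK ?eqxx.
Qed.

(** The columns of the nodes outside [A] are zero: the matrices of all sets of nodes
    have the same size. *)
Definition eval_mx m (N : finType) (pos : N -> E) (A : {set N}) :
    'M[R]_(#|{: {ffun 'I_d -> 'I_m.+1}}|, #|N|) :=
  \matrix_(k, j) (if (\sum_i (enum_val k : {ffun 'I_d -> 'I_m.+1}) i <= m)%N
    && (enum_val j \in A) then mono (enum_val k) (pos (enum_val j)) else 0).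

Lemma mul_eval_mx m (N : finType) (pos : N -> E) (A : {set N}) u j :
  (u *m eval_mx m pos A) 0 j =
  if enum_val j \in A then coeff_poly u (pos (enum_val j)) else 0.
Proof.
rewrite mxE; have [jA|jA] := boolP (_ \in A).
  by apply: eq_bigr => k _; rewrite mxE jA andbT; case: ifP; rewrite ?mulr0.
by apply: big1 => k _; rewrite mxE (negPf jA) andbF mulr0.
Qed.

End polynomial_functions.

(** * Barycentric coordinates *)

Section affine_functions.
Context {R : realType} {d : nat}.
Local Notation E := 'rV[R]_d.
Implicit Types (x y w g : E) (s t : R) (A : set E).

Lemma nbhs_box x A : nbhs x A <-> exists2 s, 0 < s & box x s `<=` A.
Proof.
split=> [/nbhs_ballP[s /= s0 sA]|[s s0 sA]].
  exists (s / 2) => [|y xy]; first by rewrite divr_gt0.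
  apply: sA; split=> // i j; rewrite ord1 /ball/= distrC.
  by apply: le_lt_trans (xy j) _; rewrite ltr_pdivrMr// ltr_pMr// ltr1n.
apply/nbhs_ballP; exists s => //= y [_ xy]; apply: sA => j.
by have := xy 0 j; rewrite /ball/= distrC => /ltW.
Qed.

Lemma interior_box x A : interior A x <-> exists2 s, 0 < s & box x s `<=` A.
Proof. exact: nbhs_box. Qed.

Lemma box_center x s : 0 <= s -> box x s x.
Proof. by move=> s0 i; rewrite subrr normr0. Qed.

Lemma box_shift x s t i : `|t| <= s -> box x s (x + t *: delta_mx 0 i).
Proof.
move=> ts j; rewrite !mxE [_ + t * _]addrC addrK eqxx/=.
by case: eqP => _; rewrite ?mulr1 ?mulr0 ?normr0// (le_trans _ ts).
Qed.

Lemma dotpDr g x y : dotp g (x + y) = dotp g x + dotp g y.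
Proof. by rewrite /dotp -big_split/=; apply: eq_bigr => i _; rewrite mxE mulrDr. Qed.

Lemma dotpZr g t x : dotp g (t *: x) = t * dotp g x.
Proof. by rewrite /dotp mulr_sumr; apply: eq_bigr => i _; rewrite mxE mulrCA. Qed.

Lemma dotpC x y : dotp x y = dotp y x.
Proof. by rewrite /dotp; apply: eq_bigr => i _; rewrite mulrC. Qed.

Lemma dotp0l x : dotp 0 x = 0.
Proof. by rewrite /dotp big1// => i _; rewrite mxE mul0r. Qed.

Lemma dotp0r x : dotp x 0 = 0.
Proof. by rewrite dotpC dotp0l. Qed.

Lemma dotpNr g x : dotp g (- x) = - dotp g x.
Proof. by rewrite -scaleN1r dotpZr mulN1r. Qed.

Lemma dotpBr g x y : dotp g (x - y) = dotp g x - dotp g y.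
Proof. by rewrite dotpDr dotpNr. Qed.

Lemma dotpBl g x y : dotp (x - y) g = dotp x g - dotp y g.
Proof. by rewrite dotpC dotpBr dotpC [dotp g y]dotpC. Qed.

Lemma dotpZl g t x : dotp (t *: x) g = t * dotp x g.
Proof. by rewrite dotpC dotpZr dotpC. Qed.

Lemma dotp_sumr (I : finType) (P : pred I) g (c : I -> R) (x : I -> E) :
  dotp g (\sum_(i | P i) c i *: x i) = \sum_(i | P i) c i * dotp g (x i).
Proof.
rewrite /dotp; under eq_bigr do rewrite summxE mulr_sumr.
rewrite exchange_big/=; apply: eq_bigr => i _; rewrite mulr_sumr.
by apply: eq_bigr => j _; rewrite mxE mulrCA.
Qed.

Lemma dotp_delta g i : dotp g (delta_mx 0 i) = g 0 i.
Proof.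
rewrite /dotp (bigD1 i)//= mxE !eqxx mulr1 big1 ?addr0// => j ji.
by rewrite mxE (negPf ji) andbF mulr0.
Qed.

Lemma dotp_eq0 g : (forall x, dotp g x = 0) -> g = 0.
Proof. by move=> g0; apply/rowP => i; rewrite -dotp_delta g0 mxE. Qed.

Lemma dotp_ge0 x : 0 <= dotp x x.
Proof. by apply: sumr_ge0 => i _; rewrite -expr2 sqr_ge0. Qed.

Lemma dotp_self_eq0 x : dotp x x = 0 -> x = 0.
Proof.
move=> /eqP; rewrite psumr_eq0 => [/allP x0|i _]; last by rewrite -expr2 sqr_ge0.
apply/rowP => i; have := x0 i (mem_index_enum i).
by rewrite mxE /= mulf_eq0 orbb => /eqP.
Qed.

Lemma coord_le_eucl x i : `|x 0 i| <= eucl x.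
Proof.
rewrite -sqrtr_sqr /eucl ler_sqrt ?dotp_ge0// /dotp (bigD1 i)//= -expr2 lerDl.
by apply: sumr_ge0 => j _; rewrite -expr2 sqr_ge0.
Qed.

Lemma eucl_le x s : (forall i, `|x 0 i| <= s) -> eucl x <= d%:R * s.
Proof.
move=> xs; have [d0|d0] := posnP d.
  rewrite /eucl /dotp big1 ?sqrtr0; first by rewrite d0 mul0r.
  by move=> i; have := ltn_ord i; lia.
have s0 : 0 <= s by apply: le_trans (xs (Ordinal d0)).
rewrite -[leRHS]ger0_norm ?mulr_ge0// -sqrtr_sqr ler_sqrt ?sqr_ge0//.
apply: le_trans (_ : \sum_(i < d) s ^+ 2 <= _).
  apply: ler_sum => i _; rewrite -expr2 -[_ ^+ 2]real_normK ?num_real//.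
  by rewrite lerXn2r ?nnegrE.
rewrite sumr_const card_ord -[_ *+ d]mulr_natl exprMn ler_wpM2r ?sqr_ge0//.
by rewrite expr2 ler_peMl// ler1n.
Qed.

Lemma normr_dotp g x s t : (forall i, `|g 0 i| <= s) -> (forall i, `|x 0 i| <= t) ->
  `|dotp g x| <= d%:R * (s * t).
Proof.
move=> gs xt; apply: le_trans (ler_norm_sum _ _ _) _.
rewrite mulr_natl -[X in _ *+ X](card_ord d) -sumr_const; apply: ler_sum => i _.
by rewrite normrM ler_pM.
Qed.

Lemma continuous_affine (b : R) g : continuous (fun w => b + dotp g w).
Proof.
apply: continuous_add_fun; first exact: cst_continuous.
apply: continuous_sum_fun => i; apply: continuous_mul_fun.
  exact: cst_continuous.
exact: coord_continuous.
Qed.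

End affine_functions.

Section simplex.
Context {R : realType} {d : nat} (N : finType) (pos : N -> 'rV[R]_d).
Local Notation E := 'rV[R]_d.
Implicit Types (w c : E) (s t : R) (A B K : {set N}) (x y z : N).

Definition affinely_independent K := forall lam : N -> R,
  \sum_(x in K) lam x = 0 -> \sum_(x in K) lam x *: pos x = 0 ->
  forall x, x \in K -> lam x = 0.

(** [b x + dotp (g x) w] is the barycentric coordinate of [w] at the vertex [x]. *)
Definition barycentric K (b : N -> R) (g : N -> E) :=
  [/\ forall w, \sum_(x in K) (b x + dotp (g x) w) = 1,
      forall w, \sum_(x in K) (b x + dotp (g x) w) *: pos x = w &
      forall x y, x \in K -> y \in K -> b x + dotp (g x) (pos y) = (x == y)%:R].

(** By affine independence the square matrix with rows [(1, pos x)] is invertible; the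
    barycentric coordinates are the affine functions given by the columns of its
    inverse. *)
Lemma barycentric_exists K : #|K| = d.+1 -> affinely_independent K ->
  exists b g, barycentric K b g.
Proof.
move=> cK indK.
pose P : 'M[R]_(#|K|, 1 + d) := row_mx (const_mx 1) (\matrix_k pos (enum_val k)).
have Pfree : row_free P.
  apply: inj_row_free => u; rewrite mul_mx_row -row_mx0 => /eq_row_mx[u1 upos].
  have [x0 x0K] : exists x0, x0 \in K by apply/set0Pn; rewrite -card_gt0 cK.
  pose lam x := u 0 (enum_rank_in x0K x).
  have lamE k : lam (enum_val k) = u 0 k by rewrite /lam enum_valK_in.
  have lam0 : forall x, x \in K -> lam x = 0.
    apply: indK; rewrite big_enum_val.
      have /matrixP/(_ 0 0) := u1; rewrite !mxE => u10; rewrite -[RHS]u10.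
      by apply: eq_bigr => k _; rewrite lamE mxE mulr1.
    rewrite -[RHS]upos; apply/rowP => i; rewrite summxE mxE.
    by apply: eq_bigr => k _; rewrite lamE !mxE.
  by apply/rowP => k; rewrite mxE -lamE lam0// enum_valP.
have Pfull : row_full P by rewrite /row_full (eqP Pfree) cK.
have [x0 x0K] : exists x0, x0 \in K by apply/set0Pn; rewrite -card_gt0 cK.
pose Q := pinvmx P; have QP : Q *m P = 1%:M by exact: mulVpmx.
pose b x := Q (lshift d 0) (enum_rank_in x0K x).
pose g x : E := \row_i Q (rshift 1 i) (enum_rank_in x0K x).
have lamE w k : b (enum_val k) + dotp (g (enum_val k)) w = (row_mx 1%:M w *m Q) 0 k.
  rewrite mxE big_split_ord/= big_ord1 row_mxEl mxE eqxx mul1r /b enum_valK_in.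
  congr (_ + _); apply: eq_bigr => i _.
  by rewrite row_mxEr mxE enum_valK_in mulrC.
have lamP w : row_mx 1%:M w *m Q *m P = row_mx 1%:M w by rewrite -mulmxA QP mulmx1.
have lam1 w : \sum_(x in K) (b x + dotp (g x) w) = 1.
  have /matrixP/(_ 0 (lshift d 0)) := lamP w.
  rewrite [RHS]row_mxEl [RHS]mxE eqxx [LHS]mxE => l1.
  rewrite -[RHS]l1 big_enum_val; apply: eq_bigr => k _.
  by rewrite lamE /P row_mxEl [X in _ = _ * X]mxE mulr1.
have lampos w : \sum_(x in K) (b x + dotp (g x) w) *: pos x = w.
  apply/rowP => i; have /matrixP/(_ 0 (rshift 1 i)) := lamP w.
  rewrite [RHS]row_mxEr [LHS]mxE => <-; rewrite summxE big_enum_val.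
  by apply: eq_bigr => k _; rewrite lamE mxE /P row_mxEr [X in _ = _ * X]mxE.
exists b, g; split=> // x y xK yK; apply/eqP; rewrite -subr_eq0; apply/eqP.
move: x xK; apply: (indK (fun x => b x + dotp (g x) (pos y) - (x == y)%:R)).
  rewrite sumrB lam1 (bigD1 y)//= eqxx big1 ?addr0 ?subrr//.
  by move=> x /andP[_ /negPf->].
under eq_bigr do rewrite scalerBl.
rewrite sumrB lampos (bigD1 y)//= eqxx scale1r big1 ?addr0 ?subrr//.
by move=> x /andP[_ /negPf->]; rewrite scale0r.
Qed.

Lemma hullS A B : A \subset B -> hull pos A `<=` hull pos B.
Proof.
move=> AB w [c [c0 c1 ->]]; exists (fun x => if x \in A then c x else 0); split.
- by move=> x _; case: ifP => [/c0|].
- rewrite -c1 -big_mkcondr/=; apply: eq_bigl => x.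
  by rewrite andb_idl// => /(fintype.subsetP AB).
- rewrite [RHS](_ : _ = \sum_(x in B | x \in A) c x *: pos x).
    by apply: eq_bigl => x; rewrite andb_idl// => /(fintype.subsetP AB).
  rewrite [RHS]big_mkcondr/=; apply: eq_bigr => x _.
  by case: ifP => //; rewrite scale0r.
Qed.

Lemma hull_vertex A x : x \in A -> hull pos A (pos x).
Proof.
move=> xA; exists (fun y => (y == x)%:R); split.
- by move=> y _; rewrite ler0n.
- by rewrite (bigD1 x)//= eqxx big1 ?addr0// => y /andP[_ /negPf->].
- rewrite (bigD1 x)//= eqxx scale1r big1 ?addr0// => y /andP[_ /negPf->].
  by rewrite scale0r.
Qed.

Lemma hull_convex A w c t : hull pos A w -> hull pos A c -> 0 <= t <= 1 ->
  hull pos A ((1 - t) *: w + t *: c).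
Proof.
move=> [f [c0 c1 ->]] [e [e0 e1 ->]] /andP[t0 t1].
exists (fun x => (1 - t) * f x + t * e x); split.
- by move=> x xA; rewrite addr_ge0// mulr_ge0 ?subr_ge0// ?c0 ?e0.
- by rewrite big_split/= -!mulr_sumr c1 e1 !mulr1 subrK.
- rewrite !scaler_sumr -big_split/=; apply: eq_bigr => x _.
  by rewrite [RHS]scalerDl !scalerA.
Qed.

Section barycentric.
Variables (K : {set N}) (b : N -> R) (g : N -> E).
Hypothesis bar : barycentric K b g.
Let lam x w := b x + dotp (g x) w.

Lemma affine_comb (a : R) (h : E) A (c : N -> R) : \sum_(y in A) c y = 1 ->
  a + dotp h (\sum_(y in A) c y *: pos y) = \sum_(y in A) c y * (a + dotp h (pos y)).
Proof.
move=> c1; rewrite dotp_sumr -{1}[a]mul1r -c1 mulr_suml -big_split/=.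
by apply: eq_bigr => y _; rewrite mulrDr.
Qed.

Lemma affine_bary (a : R) (h : E) w :
  a + dotp h w = \sum_(x in K) lam x w * (a + dotp h (pos x)).
Proof.
by have [b1 bp _] := bar; rewrite -(affine_comb _ _ (b1 w)) bp.
Qed.

Lemma hullP w : hull pos K w <-> forall x, x \in K -> 0 <= lam x w.
Proof.
have [b1 bp bd] := bar; split=> [[c [c0 c1 ->]] x xK|l0]; last first.
  by exists (fun x => lam x w); split; [exact: l0|exact: b1|rewrite bp].
rewrite /lam affine_comb// sumr_ge0// => y yK.
by rewrite bd// mulr_ge0 ?c0 ?ler0n.
Qed.

Lemma bary_face0 A x w : A \subset K -> x \in K -> x \notin A -> hull pos A w ->
  lam x w = 0.
Proof.
have [b1 bp bd] := bar => AK xK xA [c [c0 c1 ->]].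
rewrite /lam affine_comb// big1// => y yA.
rewrite bd//; last exact: fintype.subsetP AK y yA.
rewrite (_ : x == y = false) ?mulr0//.
by apply/eqP => xy; rewrite xy yA in xA.
Qed.

Lemma bary_le1 x w : x \in K -> hull pos K w -> lam x w <= 1.
Proof.
move=> xK /hullP l0; have [b1 _ _] := bar.
rewrite -[leRHS](b1 w) (bigD1 x)//= lerDl sumr_ge0// => y /andP[yK _].
exact: l0.
Qed.

Lemma bary_grad_neq0 x y : x \in K -> y \in K -> x != y -> g x != 0.
Proof.
have [_ _ bd] := bar => xK yK xy; apply/eqP => g0.
have := bd x x xK xK; have := bd x y xK yK.
rewrite eqxx (negPf xy) g0 !dotp0l !addr0 => -> /eqP.
by rewrite eq_sym oner_eq0.
Qed.

(** A nonconstant affine function that is nonnegative around [w] is positive at [w]. *)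
Lemma cell_bary_gt0 w z : z \in K -> interior (hull pos K) w -> 0 < lam z w.
Proof.
move=> zK /interior_box[s s0 sub]; have [_ _ bd] := bar.
have [[i gi]|g0] := pselect (exists i, g z 0 i != 0).
  have l0 t : `|t| <= s -> 0 <= lam z w + t * g z 0 i.
    move=> ts; have /hullP/(_ z zK) := sub _ (box_shift w i ts).
    by rewrite /lam dotpDr dotpZr dotp_delta addrA.
  have := l0 s; have := l0 (- s); rewrite normrN gtr0_norm// => /(_ (lexx _)) h1 /(_ (lexx _)) h2.
  have : s * `|g z 0 i| <= lam z w.
    by rewrite -{1}(gtr0_norm s0) -normrM ler_norml; apply/andP; split; lra.
  by apply: lt_le_trans; rewrite mulr_gt0// normr_gt0.
have gz : g z = 0.
  by apply/rowP => i; rewrite mxE; apply/eqP/negPn/negP => gi; apply: g0; exists i.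
by have := bd z z zK zK; rewrite /lam gz !dotp0l eqxx !addr0 => ->; rewrite ltr01.
Qed.

Lemma cell_not_face A z w : A \subset K -> z \in K -> z \notin A ->
  interior (hull pos K) w -> ~ hull pos A w.
Proof.
move=> AK zK zA /(cell_bary_gt0 zK) + Aw.
by rewrite (bary_face0 AK zK zA Aw) ltxx.
Qed.

(** A barycentric coordinate varies by at most 1 on a segment of length [2 * s]. *)
Lemma bary_grad_le c s x i : 0 < s -> box c s `<=` hull pos K -> x \in K ->
  `|g x 0 i| <= (2 * s)^-1.
Proof.
move=> s0 sub xK.
have l01 t : `|t| <= s -> 0 <= lam x c + t * g x 0 i <= 1.
  move=> ts; have h := sub _ (box_shift c i ts).
  have := bary_le1 xK h; have /hullP/(_ x xK) := h.
  by rewrite /lam dotpDr dotpZr dotp_delta addrA => -> ->.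
have := l01 s; have := l01 (- s); rewrite normrN gtr0_norm// => /(_ (lexx _))/andP[h1 h2].
move=> /(_ (lexx _))/andP[h3 h4].
rewrite -[leRHS]mul1r ler_pdivlMr ?mulr_gt0// -[X in _ * X]gtr0_norm ?mulr_gt0//.
by rewrite -normrM ler_norml; apply/andP; split; lra.
Qed.

(** The barycentric coordinate at [x] decreases from 1 to 0 along the edge, while its
    gradient is bounded by [bary_grad_le]. *)
Lemma bary_edge c s x y t : 0 < s -> box c s `<=` hull pos K -> x \in K -> y \in K ->
  x != y -> (forall i, `|pos x 0 i - pos y 0 i| <= t) -> 2 * s <= d%:R * t.
Proof.
move=> s0 sub xK yK xy xyt; have [_ _ bd] := bar.
have E1 : dotp (g x) (pos x - pos y) = 1.
  have := bd x x xK xK; have := bd x y xK yK; rewrite eqxx (negPf xy) dotpBr/=.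
  lra.
have := @normr_dotp _ _ (g x) (pos x - pos y) (2 * s)^-1 t.
rewrite E1 normr1 => h; have {}h : 1 <= d%:R * ((2 * s)^-1 * t).
  by apply: h => i; [exact: (bary_grad_le _ s0 sub)|rewrite !mxE].
rewrite -[leLHS]mul1r -ler_pdivlMr ?mulr_gt0//.
by apply: le_trans h _; rewrite [_^-1 * t]mulrC mulrA.
Qed.

Lemma hull_closed : closed (hull pos K).
Proof.
rewrite (_ : hull pos K = \bigcap_(x in [set` K]) [set w | 0 <= lam x w]).
  apply: closed_bigI => x _.
  apply: (@closed_comp _ _ (lam x) [set t | 0 <= t]); last exact: closed_ge.
  by move=> w _; exact: continuous_affine.
by apply/seteqP; split=> w /hullP.
Qed.

(** The homothety of centre [w] and ratio [t] maps the cube into the hull. *)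
Lemma hull_shrink_cell c s w t : 0 < s -> box c s `<=` hull pos K ->
  hull pos K w -> 0 < t <= 1 -> interior (hull pos K) ((1 - t) *: w + t *: c).
Proof.
move=> s0 sub Kw /andP[t0 t1]; apply/interior_box; exists (t * s).
  by rewrite mulr_gt0.
move=> y yw; pose z := t^-1 *: (y - (1 - t) *: w).
have -> : y = (1 - t) *: w + t *: z.
  by rewrite /z scalerA divff ?gt_eqF// scale1r addrC subrK.
apply: hull_convex; rewrite ?(ltW t0)//; apply: sub => i.
rewrite -(ler_pM2l t0) -{1}(gtr0_norm t0) -normrM mulrBr.
have := yw i; rewrite !mxE mulrA divff ?gt_eqF// mul1r.
by rewrite opprD addrA.
Qed.

(** Only the term at [z] remains in the expansion of the function in barycentric
    coordinates. *)
Lemma affine_face (a : R) (h : E) z : z \in K ->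
  (forall x, x \in K -> x != z -> a + dotp h (pos x) = 0) ->
  (forall w, a + dotp h w = (a + dotp h (pos z)) * lam z w) /\
  h = (a + dotp h (pos z)) *: g z.
Proof.
move=> zK f0; have fE w : a + dotp h w = (a + dotp h (pos z)) * lam z w.
  rewrite [LHS]affine_bary (bigD1 z zK)/= [X in _ + X]big1.
    by rewrite addr0 mulrC.
  by move=> x /andP[xK xz]; rewrite f0 ?mulr0.
split=> //; apply/eqP; rewrite -subr_eq0; apply/eqP/dotp_eq0 => w.
rewrite dotpBl dotpZl; have := fE w; have := fE 0.
rewrite /lam mulrDr !dotp0r mulr0 !addr0 mulrDr => <-; lra.
Qed.

Lemma normal_exists z : (0 < d)%N -> #|K| = d.+1 -> z \in K -> exists n : E,
  [/\ eucl n = 1,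
    forall x y, x \in K :\ z -> y \in K :\ z -> dotp n (pos x - pos y) = 0 &
    forall x y, x \in K :\ z -> y \in K -> y \notin K :\ z ->
      dotp n (pos y - pos x) < 0].
Proof.
move=> d0 cK zK; have [_ _ bd] := bar.
have [x0 x0z] : exists x0, x0 \in K :\ z.
  by apply/set0Pn; rewrite -card_gt0; have := cardsD1 z K; rewrite zK cK; lia.
have /andP[x0z' x0K] : (x0 != z) && (x0 \in K) by rewrite -in_setD1.
have gz : 0 < dotp (g z) (g z).
  rewrite lt_neqAle dotp_ge0 andbT eq_sym; apply/negP => /eqP/dotp_self_eq0 /eqP.
  by apply/negP; apply: bary_grad_neq0 zK x0K _; rewrite eq_sym.
have ez : 0 < eucl (g z) by rewrite sqrtr_gt0.
have dE x y : x \in K -> y \in K ->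
    dotp (- (eucl (g z))^-1 *: g z) (pos y - pos x) =
    (eucl (g z))^-1 * ((z == x)%:R - (z == y)%:R).
  by move=> xK yK; rewrite dotpZl dotpBr mulNr -!bd//; ring.
exists (- (eucl (g z))^-1 *: g z); split.
- rewrite {1}/eucl dotpZl dotpC dotpZl mulrA mulrNN -expr2 -[dotp _ _]sqr_sqrtr ?ltW//.
  by rewrite -/(eucl (g z)) -exprMn mulVf ?gt_eqF// expr1n sqrtr1.
- move=> x y /setD1P[xz xK] /setD1P[yz yK]; rewrite dE// ![z == _]eq_sym.
  by rewrite (negPf xz) (negPf yz) subrr mulr0.
- move=> x y /setD1P[xz xK] yK; rewrite !inE yK andbT negbK => /eqP yz.
  rewrite dE// eq_sym (negPf xz) yz eqxx sub0r mulrN1 oppr_lt0 invr_gt0//.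
Qed.

(** Both vectors are multiples of the gradient of the barycentric coordinate at [z]. *)
Lemma normal_span z (n h : E) : (0 < d)%N -> #|K| = d.+1 -> z \in K -> eucl n = 1 ->
  (forall x y, x \in K :\ z -> y \in K :\ z -> dotp n (pos x - pos y) = 0) ->
  (forall x y, x \in K :\ z -> y \in K :\ z -> dotp h (pos x - pos y) = 0) ->
  h = dotp n h *: n.
Proof.
move=> d0 cK zK n1 nz hz.
have [x0 x0z] : exists x0, x0 \in K :\ z.
  by apply/set0Pn; rewrite -card_gt0; have := cardsD1 z K; rewrite zK cK; lia.
have mulg (f : E) : (forall x y, x \in K :\ z -> y \in K :\ z ->
    dotp f (pos x - pos y) = 0) -> exists k, f = k *: g z.
  move=> fz; have [|_ fE] := @affine_face (- dotp f (pos x0)) f z zK.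
    by move=> x xK xz; rewrite addrC -dotpBr fz//; apply/setD1P.
  by eexists; exact: fE.
have [k nk] := mulg n nz; have [l hl] := mulg h hz.
have dn : dotp n n = 1.
  by have := n1; rewrite /eucl => /(congr1 (fun t => t ^+ 2)); rewrite sqr_sqrtr ?dotp_ge0// expr1n.
have k0 : k != 0.
  apply/eqP => k0; move: dn; rewrite nk k0 scale0r /dotp big1 => [/eqP|i _].
    by rewrite eq_sym oner_eq0.
  by rewrite mxE mul0r.
have -> : h = (l / k) *: n by rewrite nk scalerA divfK.
by rewrite dotpC dotpZl dn mulr1.
Qed.

End barycentric.

(** If [z2] were on the side of [z1], the barycentre of the common facet, moved
    slightly towards [z2], would lie in both simplices but not in the facet;
    and [z2] is not in the hyperplane of the facet, by affine independence. *)
Lemma opposite_sides K1 K2 b1 g1 b2 g2 z1 z2 : barycentric K1 b1 g1 ->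
  barycentric K2 b2 g2 -> z1 \in K1 -> z2 \in K2 -> K1 :\ z1 = K2 :\ z2 ->
  (0 < d)%N -> #|K1| = d.+1 ->
  z1 \notin K2 -> hull pos K1 `&` hull pos K2 `<=` hull pos (K1 :\ z1) ->
  b1 z1 + dotp (g1 z1) (pos z2) < 0.
Proof.
move=> bar1 bar2 z1K z2K e12 d0 cK z1K2 inter; have [_ _ bd1] := bar1.
set e := K1 :\ z1 in e12 inter.
have ce : #|e| = d by have := cardsD1 z1 K1; rewrite z1K cK /e; lia.
have [_ _ bd2] := bar2.
rewrite ltNge; apply/negP => l0.
pose B := \sum_(x in K1) `|b1 x + dotp (g1 x) (pos z2)|.
have B0 : 0 <= B by apply: sumr_ge0.
have d0' : 0 < d%:R :> R by rewrite ltr0n.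
pose t := (1 + d%:R * B)^-1.
have Bp : 0 < 1 + d%:R * B by rewrite ltr_pwDl// mulr_ge0// ltW.
have t0 : 0 < t by rewrite invr_gt0.
have t1 : t <= 1 by rewrite invf_le1// lerDl mulr_ge0// ltW.
(* [m] is the barycentre of the facet, and [t] is small enough for the barycentric
   coordinates of [w] at the vertices of the facet to remain nonnegative. *)
pose m := \sum_(x in e) d%:R^-1 *: pos x.
have sm : \sum_(x in e) d%:R^-1 = 1 :> R.
  by rewrite sumr_const ce -[_ *+ d]mulr_natl divff ?gt_eqF.
have hm : hull pos e m by exists (fun=> d%:R^-1); split=> // x _; rewrite invr_ge0 ltW.
pose w := (1 - t) *: m + t *: pos z2.
have lw x : b1 x + dotp (g1 x) w = (1 - t) * (b1 x + dotp (g1 x) m) +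
    t * (b1 x + dotp (g1 x) (pos z2)).
  by rewrite dotpDr !dotpZr; ring.
have eK1 : e \subset K1 by exact: subsetDl.
have eK2 : e \subset K2 by rewrite e12 subsetDl.
have lm x : x \in e -> b1 x + dotp (g1 x) m = d%:R^-1.
  move=> xe; have xK := fintype.subsetP eK1 x xe.
  rewrite affine_comb// (bigD1 x)//= bd1// eqxx mulr1.
  rewrite big1 ?addr0// => y /andP[ye yx]; have yK := fintype.subsetP eK1 y ye.
  by rewrite bd1// eq_sym (negPf yx) mulr0.
have z1e : z1 \notin e by rewrite !inE eqxx.
have lm1 : b1 z1 + dotp (g1 z1) m = 0 by exact: (bary_face0 bar1 eK1).
have w2 : hull pos K2 w.
  apply: hull_convex; [exact: hullS hm|exact: hull_vertex|].
  by rewrite (ltW t0).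
have w1 : hull pos K1 w.
  apply/(hullP bar1) => x xK; rewrite lw; have [->|xz] := eqVneq x z1.
    by rewrite lm1 mulr0 add0r mulr_ge0// ltW.
  rewrite lm; last by rewrite in_setD1 xz.
  have : `|b1 x + dotp (g1 x) (pos z2)| <= B.
    by rewrite /B (bigD1 x)//= lerDl sumr_ge0.
  rewrite ler_norml => /andP[h _].
  have : 0 <= (1 - t) * d%:R^-1 - t * B.
    have -> : (1 - t) * d%:R^-1 - t * B = d%:R^-1 * (1 - t * (1 + d%:R * B)).
      by field; rewrite gt_eqF.
    by rewrite /t mulVf ?gt_eqF// subrr mulr0.
  have : t * - B <= t * (b1 x + dotp (g1 x) (pos z2)) by rewrite ler_wpM2l// ltW.
  by rewrite mulrN; lra.
have := bary_face0 bar1 eK1 z1K z1e (inter w (conj w1 w2)).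
rewrite lw lm1 mulr0 add0r => /eqP; rewrite mulf_eq0 gt_eqF//= => /eqP l0'.
have := affine_bary bar2 (b1 z1) (g1 z1) (pos z1).
rewrite bd1// eqxx big1 => [/eqP|x xK]; first by rewrite oner_eq0.
have [->|xz] := eqVneq x z2; first by rewrite l0' mulr0.
have xe : x \in e by rewrite e12 in_setD1 xz.
have xK1 := fintype.subsetP eK1 x xe.
by rewrite bd1// (_ : z1 == x = false) ?mulr0//; apply/eqP => zx; rewrite zx xe in z1e.
Qed.

End simplex.

(** * Quasi-uniform meshes *)

Section finite_extrema.
Context {R : realType} (I : finType) (P : pred I) (F : I -> R).

Lemma le_sup_finType i : P i -> F i <= sup [set r | exists2 i, P i & r = F i].
Proof.
move=> Pi; apply: ub_le_sup; last by exists i.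
exists (\sum_j `|F j|) => _ [j _ ->].
by apply: le_trans (ler_norm _) _; rewrite (bigD1 j)//= lerDl sumr_ge0.
Qed.

Lemma ge_inf_finType i : P i -> inf [set r | exists2 i, P i & r = F i] <= F i.
Proof.
move=> Pi; apply: ge_inf; last by exists i.
exists (- \sum_j `|F j|) => _ [j _ ->].
rewrite lerNl; apply: le_trans (ler_norm _) _.
by rewrite normrN (bigD1 j)//= lerDl sumr_ge0.
Qed.
End finite_extrema.

Section diameter.
Context {R : realType} {d : nat} (N : finType) (pos : N -> 'rV[R]_d).
Implicit Types (x y : 'rV[R]_d) (A B : {set N}).

Lemma hull_bounded A : exists2 r : R, 0 <= r & hull pos A `<=` box 0 r.
Proof.
pose r := \sum_x \sum_i `|pos x 0 i|.
exists r => [|_ [c [c0 c1 ->]] i].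
  by apply: sumr_ge0 => x _; apply: sumr_ge0.
rewrite mxE subr0 summxE; apply: le_trans (ler_norm_sum _ _ _) _.
rewrite -[leRHS]mul1r -c1 mulr_suml; apply: ler_sum => x xA.
rewrite mxE normrM ger0_norm ?c0// ler_wpM2l ?c0//.
rewrite /r (bigD1 x)//= (bigD1 i)//= -addrA lerDl addr_ge0//.
  exact: sumr_ge0.
by apply: sumr_ge0 => y _; apply: sumr_ge0.
Qed.

Lemma eucl_le_diam A x y : hull pos A x -> hull pos A y ->
  eucl (x - y) <= diam (hull pos A).
Proof.
move=> Ax Ay; apply: ub_le_sup; last by exists x, y.
have [r r0 Ar] := hull_bounded A.
exists (d%:R * (r + r)) => _ [u [v [/Ar ur /Ar vr ->]]].
apply: eucl_le => i; rewrite !mxE; apply: le_trans (ler_normB _ _) _.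
by apply: lerD; [have := ur i|have := vr i]; rewrite mxE subr0.
Qed.

Lemma diam_ge0 A x : hull pos A x -> 0 <= diam (hull pos A).
Proof. by move=> Ax; apply: le_trans (eucl_le_diam Ax Ax); exact: sqrtr_ge0. Qed.

Lemma diamS A B x : A \subset B -> hull pos A x ->
  diam (hull pos A) <= diam (hull pos B).
Proof.
move=> AB Ax; apply: ge_sup; first by exists (eucl (x - x)); exists x, x.
move=> _ [u [v [/(hullS AB) Bu /(hullS AB) Bv ->]]]; exact: eucl_le_diam.
Qed.

End diameter.

Section shape_regularity.
Context {R : realType} {d : nat} (d1 : (1 < d)%N).
Local Notation E := 'rV[R]_d.
Variables (Omega : set E) (hOmega : convex_polytope Omega) (M : mesh R d).
Hypothesis tri : triangulation M Omega.
Variable Cnu : R.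
Hypothesis qu : meshsize M <= Cnu * rho M.
Local Notation N := (node M).
Implicit Types (K e : {set N}) (x y : N).

(** Every element contains a cube of half side [shape * meshsize M], see [elt_box].
    The maximum with 1 makes this a positive constant for every [Cnu]. *)
Definition shape : R := (2 * d%:R * Num.max Cnu 1)^-1.

Lemma shape_gt0 : 0 < shape.
Proof.
rewrite invr_gt0 !mulr_gt0 ?ltr0n//; first exact: ltnW.
by rewrite lt_max ltr01 orbT.
Qed.

Lemma elt_card K : K \in elts M -> #|K| = d.+1.
Proof. by have [_ _ h _ _] := tri => /h[]. Qed.

Lemma elt_bary K : K \in elts M -> exists b g, barycentric (@pos R d M) K b g.
Proof.
by have [_ _ h _ _] := tri => /h[cK indK]; exact: barycentric_exists.
Qed.

Lemma elts_neq0 : exists K, K \in elts M.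
Proof.
have [_ [x Ox] _ _ _] := hOmega; have [_ _ _ _ cl] := tri.
have : closure Omega x by exact: subset_closure.
by rewrite cl => -[K KM _]; exists K.
Qed.

Lemma elt_le_meshsize K : K \in elts M -> h_ K <= meshsize M.
Proof. exact: (@le_sup_finType _ _ (mem (elts M))). Qed.

Lemma eucl_sub_eq0 (x y : E) : eucl (x - y) = 0 -> x = y.
Proof.
move=> /eqP; rewrite sqrtr_eq0 => h; apply/eqP; rewrite -subr_eq0; apply/eqP.
by apply: dotp_self_eq0; apply/eqP; rewrite eq_le h dotp_ge0.
Qed.

Lemma meshsize_gt0 : 0 < meshsize M.
Proof.
have [K KM] := elts_neq0; apply: lt_le_trans (elt_le_meshsize KM).
have /card_gt1P[x [y [xK yK xy]]] : (1 < #|K|)%N by rewrite elt_card// ltnS ltnW.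
have := eucl_le_diam (hull_vertex (@pos R d M) xK) (hull_vertex (@pos R d M) yK).
apply: lt_le_trans; rewrite lt_neqAle sqrtr_ge0 andbT eq_sym.
apply/eqP => /eucl_sub_eq0; have [inj _ _ _ _] := tri => /inj xy'.
by rewrite xy' eqxx in xy.
Qed.

Lemma inradius_ge0 (A : set E) : 0 <= inradius A.
Proof.
rewrite /inradius; set S := [set _ | _].
have [hS|hS] := pselect (has_sup S); last by rewrite sup_out.
have [[r Sr] uS] := hS; apply: le_trans (ub_le_sup uS Sr).
by case: Sr.
Qed.

Lemma meshsize_le_inradius K : K \in elts M ->
  meshsize M <= Num.max Cnu 1 * inradius (hull (@pos R d M) K).
Proof.
move=> KM; apply: le_trans qu _.
have rho0 : 0 <= rho M.
  apply: lb_le_inf; first by exists (inradius (hull (@pos R d M) K)); exists K.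
  by move=> _ [K' _ ->]; exact: inradius_ge0.
apply: le_trans (_ : Num.max Cnu 1 * rho M <= _).
  by rewrite ler_wpM2r// le_max lexx.
rewrite ler_wpM2l ?le_max ?ler01 ?orbT//.
exact: (@ge_inf_finType _ _ (mem (elts M))).
Qed.

(** An element contains a ball whose radius is at least half of its inradius, and the
    ball contains a cube. *)
Lemma elt_box K : K \in elts M ->
  exists c, box c (shape * meshsize M) `<=` hull (@pos R d M) K.
Proof.
move=> KM; have H0 := meshsize_gt0; have Hr := meshsize_le_inradius KM.
have c0 : 0 < Num.max Cnu 1 by rewrite lt_max ltr01 orbT.
have d0 : 0 < d%:R :> R by rewrite ltr0n; lia.
have r0 : 0 < inradius (hull (@pos R d M) K).
  by rewrite -(pmulr_rgt0 _ c0); apply: lt_le_trans Hr.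
move: Hr r0; rewrite /inradius; set S := [set _ | _] => Hr r0.
have hS : has_sup S.
  by apply: contrapT => hS; move: r0; rewrite sup_out// ltxx.
have [r [rge0 [c cr]] rS] := sup_adherent (divr_gt0 r0 (ltr0n R 2)) hS.
exists c => x xc; apply: cr => /=.
apply: le_trans (@eucl_le _ _ (x - c) (shape * meshsize M) _) _.
  by move=> i; rewrite !mxE.
apply: le_trans (ltW rS); rewrite /shape.
have -> : d%:R * ((2 * d%:R * Num.max Cnu 1)^-1 * meshsize M) =
   meshsize M / Num.max Cnu 1 / 2 by field; rewrite !gt_eqF.
have -> : sup S - sup S / 2 = sup S / 2 by field.
by rewrite ler_wpM2r// ler_pdivrMr// mulrC.
Qed.

Lemma elt_coord_le K (u v : E) : K \in elts M -> hull (@pos R d M) K u ->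
  hull (@pos R d M) K v -> forall i, `|u 0 i - v 0 i| <= meshsize M.
Proof.
move=> KM Ku Kv i; apply: le_trans (elt_le_meshsize KM).
by apply: le_trans (eucl_le_diam Ku Kv); have := coord_le_eucl (u - v) i; rewrite !mxE.
Qed.

Lemma faceP e : e \in faces M -> #|e| = d /\ exists2 K, K \in elts M & e \subset K.
Proof. by rewrite inE => /andP[/eqP ce /existsP[K /andP[KM eK]]]; split=> //; exists K. Qed.

Lemma face_diam_le e : e \in faces M -> h_ e <= meshsize M.
Proof.
move=> /faceP[ce [K KM eK]]; apply: le_trans (elt_le_meshsize KM).
have /set0Pn[x xe] : e != finset.set0 by rewrite -card_gt0 ce ltnW.
exact: (diamS eK (hull_vertex (@pos R d M) xe)).
Qed.

Lemma vertex_dist K x y : K \in elts M -> x \in K -> y \in K -> x != y ->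
  2 * shape * meshsize M / d%:R <= eucl (pos x - pos y).
Proof.
move=> KM xK yK xy; have [c sub] := elt_box KM; have [b [g bar]] := elt_bary KM.
have s0 : 0 < shape * meshsize M by rewrite mulr_gt0 ?shape_gt0 ?meshsize_gt0.
rewrite ler_pdivrMr ?ltr0n; last lia.
rewrite -mulrA mulrC -[leRHS]mulrC [_ * 2]mulrC.
apply: (bary_edge bar s0 sub xK yK xy) => i.
by have := coord_le_eucl (pos x - pos y) i; rewrite !mxE.
Qed.

Lemma face_diam_ge e : e \in faces M -> 2 * shape * meshsize M / d%:R <= h_ e.
Proof.
move=> /faceP[ce [K KM eK]].
have /card_gt1P[x [y [xe ye xy]]] : (1 < #|e|)%N by rewrite ce.
apply: le_trans (eucl_le_diam (hull_vertex (@pos R d M) xe) (hull_vertex (@pos R d M) ye)).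
by apply: (vertex_dist KM) => //; exact: fintype.subsetP eK _ _.
Qed.

(** Otherwise [w] would lie in a proper face of [K], on which one of the barycentric
    coordinates vanishes. *)
Lemma cell_hull_eq K K' (w : E) : K \in elts M -> K' \in elts M ->
  cell (M:=M) K w -> hull (@pos R d M) K' w -> K = K'.
Proof.
move=> KM K'M Kw K'w; have [_ _ _ inter _] := tri.
have [b [g bar]] := elt_bary KM.
have [sub|/subsetPn[z zK zK']] := boolP (K \subset K').
  by apply/eqP; rewrite eqEcard sub !elt_card// leqnn.
have : hull (@pos R d M) (K :&: K')%SET w.
  by rewrite -inter//; split=> //; exact: interior_subset.
move=> h; case: (cell_not_face bar _ zK _ Kw h); first exact: subsetIl.
by rewrite inE (negPf zK') andbF.
Qed.

End shape_regularity.

(** * Adjacent and nearby elements *)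

Section generic_points.
Context {R : realType} {d : nat}.
Local Notation E := 'rV[R]_d.

Lemma avoid_hyperplanes (s : seq (R * E)) (U : set E) : open U -> U !=set0 ->
  (forall p, p \in s -> p.2 != 0) ->
  exists2 y, U y & forall p, p \in s -> p.1 + dotp p.2 y != 0.
Proof.
elim: s U => [|p s IH] U oU [x Ux] s0; first by exists x.
pose V := U `&` [set y | p.1 + dotp p.2 y != 0].
have oV : open V.
  apply: openI => //; apply: (@open_comp _ _ (fun y => p.1 + dotp p.2 y) [set t | t != 0]).
    by move=> y _; exact: continuous_affine.
  exact: open_neq.
have [|q qs|y [Uy py] ys] := IH V oV.
- have [px|px] := eqVneq (p.1 + dotp p.2 x) 0; last by exists x.
  have [i pi] : exists i, p.2 0 i != 0.
    apply/not_existsP => h; move: (s0 p (mem_head _ _)) => /eqP; apply.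
    by apply/rowP => i; rewrite mxE; apply/eqP/negPn/negP/h.
  have /nbhs_box[r r0 rU] : nbhs x U by exact: open_nbhs_nbhs.
  exists (x + r *: delta_mx 0 i); split.
    by apply/rU/box_shift; rewrite gtr0_norm.
  rewrite /= dotpDr addrA px add0r dotpZr dotp_delta.
  by apply: mulf_neq0 => //; rewrite gt_eqF.
- by apply: s0; rewrite inE qs orbT.
- exists y => // q; rewrite inE => /predU1P[->//|]; exact: ys.
Qed.

Lemma orthogonal_exists (N : finType) (f : {set N}) (u : N -> E) : (#|f| < d)%N ->
  exists2 a : E, a != 0 & forall z, z \in f -> dotp a (u z) = 0.
Proof.
move=> fd; pose A : 'M[R]_(d, #|f|) := \matrix_(i, k) u (enum_val k) 0 i.
have kA : kermx A != 0.
  by rewrite -mxrank_eq0 mxrank_ker; have := rank_leq_col A; lia.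
exists (nz_row (kermx A)); first by rewrite nz_row_eq0.
move=> z zf; have /sub_kermxP := nz_row_sub (kermx A).
move=> /matrixP/(_ 0 (enum_rank_in zf z)); rewrite [LHS]mxE [RHS]mxE => aA.
rewrite -[RHS]aA; apply: eq_bigr => i _.
by rewrite [A _ _]mxE enum_rankK_in.
Qed.

Lemma segment_closed_cover (A B : set R) : closed A -> closed B -> A 0 -> B 1 ->
  (forall t, 0 <= t <= 1 -> A t \/ B t) -> exists2 t, 0 <= t <= 1 & A t /\ B t.
Proof.
move=> cA cB A0 B1 cov; apply: contrapT => h.
have dis t : 0 <= t <= 1 -> A t -> ~ B t by move=> t01 At Bt; apply: h; exists t.
have itvE t : (`[0 : R, 1]%classic) t = (0 <= t <= 1) :> Prop by rewrite /= in_itv.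
have AE : `[0 : R, 1]%classic `&` A = `[0, 1]%classic.
  apply: (@segment_connected R 0 1).
  - by exists 0; split=> //; rewrite itvE lexx ler01.
  - exists (~` B); first exact: closed_openC.
    apply/seteqP; split=> t [t01 At]; split=> //; rewrite itvE in t01.
      exact: dis.
    by have [] := cov t t01.
  - by exists A.
have : (`[0 : R, 1]%classic `&` A) 1 by rewrite AE itvE ler01 lexx.
by move=> [_ A1]; apply: (dis 1) => //; rewrite ler01 lexx.
Qed.

End generic_points.

Section mesh_topology.
Context {R : realType} {d : nat} (d1 : (1 < d)%N).
Local Notation E := 'rV[R]_d.
Variables (Omega : set E) (hOmega : convex_polytope Omega) (M : mesh R d).
Hypothesis tri : triangulation M Omega.
Variable Cnu : R.
Hypothesis qu : meshsize M <= Cnu * rho M.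
Local Notation N := (node M).
Local Notation H := (meshsize M).
Local Notation s := (shape (d:=d) Cnu).
Implicit Types (K e : {set N}) (x y z : N) (k : R).

Definition nearby k K : {set {set N}} := [set K' in elts M |
  `[< exists u w : E, [/\ hull (@pos R d M) K u, hull (@pos R d M) K' w &
      forall i, `|u 0 i - w 0 i| <= k * H] >]]%SET.

Lemma nearbyP k K K' : reflect (K' \in elts M /\ exists u w : E,
    [/\ hull (@pos R d M) K u, hull (@pos R d M) K' w &
      forall i, `|u 0 i - w 0 i| <= k * H]) (K' \in nearby k K).
Proof. by rewrite inE; apply: (iffP andP) => -[? /asboolP]. Qed.

Lemma nearby_sym k K K' : K \in elts M -> K' \in nearby k K -> K \in nearby k K'.
Proof.
move=> KM /nearbyP[K'M [u [w [uK wK' uw]]]]; apply/nearbyP; split=> //.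
by exists w, u; split=> // i; rewrite distrC.
Qed.

Definition near_bound k : nat := ((Num.truncn (2 * (k + 2) / s)).+1 ^ d)%N.

(** Let every element be given the centre of a cube of half side [s * H] that it
    contains. Rounding the centres to a grid of step [s * H] is injective on elements:
    centres that are rounded to the same point lie in each other's cubes. *)
Lemma card_nearby k K : 0 <= k -> K \in elts M -> (#|nearby k K| <= near_bound k)%N.
Proof.
move=> k0 KM; have H0 := meshsize_gt0 d1 hOmega tri.
have s0 : 0 < s by exact: (shape_gt0 d1).
have sH0 : 0 < s * H by rewrite mulr_gt0.
have /choice[cen cenP] : forall K', exists c, K' \in elts M ->
    box c (s * H) `<=` hull (@pos R d M) K'.
  move=> K'; have [K'M|K'M] := boolP (K' \in elts M); last by exists 0.
  by have [c] := elt_box d1 hOmega tri qu K'M; exists c.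
have cen_hull K' : K' \in elts M -> hull (@pos R d M) K' (cen K').
  by move=> K'M; apply: cenP => //; exact: box_center (ltW sH0).
pose a K' (i : 'I_d) : R := (cen K' 0 i - cen K 0 i + (k + 2) * H) / (s * H).
have a_itv K' i : K' \in nearby k K -> 0 <= a K' i <= 2 * (k + 2) / s.
  move=> /nearbyP[K'M [u [w [uK wK' /(_ i)]]]].
  have := elt_coord_le KM (cen_hull K KM) uK i.
  have := elt_coord_le K'M (cen_hull K' K'M) wK' i.
  rewrite !ler_norml => /andP[h1 h2] /andP[h3 h4] /andP[h5 h6].
  apply/andP; split; first by rewrite divr_ge0 ?(ltW sH0)//; lra.
  rewrite ler_pdivrMr//.
  have -> : 2 * (k + 2) / s * (s * H) = 2 * (k * H) + 4 * H by field; rewrite gt_eqF.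
  lra.
pose n := Num.truncn (2 * (k + 2) / s).
pose f K' : {ffun 'I_d -> 'I_n.+1} := [ffun i => inord (Num.truncn (a K' i))].
have fE K' i : K' \in nearby k K -> f K' i = Num.truncn (a K' i) :> nat.
  move=> h; have /andP[h1 h2] := a_itv K' i h; rewrite ffunE inordK// ltnS; exact: le_truncn.
have finj : {in nearby k K &, injective f}.
  move=> K1 K2 n1 n2 f12.
  have /nearbyP[K1M _] := n1; have /nearbyP[K2M _] := n2.
  apply: esym; apply: (cell_hull_eq tri (w := cen K2)) => //.
    by apply/interior_box; exists (s * H) => //; exact: cenP.
  apply: cenP => // i.
  have E12 : Num.truncn (a K1 i) = Num.truncn (a K2 i) by rewrite -!fE// f12.
  have /andP[/truncn_itv/andP[h1 h2] _] := a_itv K1 i n1.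
  have /andP[/truncn_itv/andP[h3 h4] _] := a_itv K2 i n2.
  have -> : cen K2 0 i - cen K1 0 i = (a K2 i - a K1 i) * (s * H).
    by rewrite /a; field; rewrite !gt_eqF.
  rewrite normrM (gtr0_norm sH0) ler_piMl ?(ltW sH0)// ler_norml.
  rewrite E12 in h1 h2; rewrite -natr1 in h2 h4; apply/andP; split; lra.
rewrite -(card_in_imset finj); apply: leq_trans (max_card _) _.
by rewrite card_ffun !card_ord.
Qed.

Lemma facetE K e : K \in elts M -> #|e| = d -> e \subset K ->
  exists2 z, z \in K & e = K :\ z.
Proof.
move=> KM ce eK; have : #|K :\: e| == 1%N.
  by rewrite cardsDS// (elt_card tri KM) ce subSnn.
move=> /cards1P[z zE]; have : z \in K :\: e by rewrite zE inE.
rewrite inE => /andP[ze zK]; exists z => //.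
apply/eqP; rewrite eqEcard; apply/andP; split.
  by apply/fintype.subsetP => x xe; rewrite !inE (fintype.subsetP eK)// andbT;
    apply: contraNneq ze => <-.
have := cardsD1 z K; rewrite zK (elt_card tri KM) ce => -[h].
exact: eq_leq (esym h).
Qed.

Lemma opposite K1 K2 z1 z2 b1 g1 : K1 \in elts M -> K2 \in elts M -> K1 <> K2 ->
  z1 \in K1 -> z2 \in K2 -> K1 :\ z1 = K2 :\ z2 -> barycentric (@pos R d M) K1 b1 g1 ->
  b1 z1 + dotp (g1 z1) (pos z2) < 0.
Proof.
move=> K1M K2M K12 z1K z2K e12 bar1; have [b2 [g2 bar2]] := elt_bary tri K2M.
have z1K2 : z1 \notin K2.
  apply/negP => z1K2; apply: K12; apply/eqP; rewrite eqEcard !(elt_card tri)// leqnn andbT.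
  by rewrite -(finset.setD1K z1K) finset.subUset finset.sub1set z1K2 e12 subsetDl.
apply: (opposite_sides bar1 bar2) => //; [exact: ltnW|exact: (elt_card tri)|].
have [_ _ _ inter _] := tri; rewrite inter//; apply: hullS.
apply/fintype.subsetP => x; rewrite !inE => /andP[xK1 xK2]; rewrite xK1 andbT.
by apply: contraNneq z1K2 => <-.
Qed.

(** An affine function vanishing on [e] and equal to 1 at [z1] is negative at [z2] and
    at [z3]. So these points would lie on the same side of [e], which is impossible
    for the opposite vertices of two elements. *)
Lemma face_two_sides K1 K2 K3 e : K1 \in elts M -> K2 \in elts M -> K3 \in elts M ->
  #|e| = d -> e \subset K1 -> e \subset K2 -> e \subset K3 ->
  K1 <> K2 -> K1 <> K3 -> K2 = K3.
Proof.
move=> K1M K2M K3M ce e1 e2 e3 K12 K13; apply: contrapT => K23.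
have [z1 z1K E1] := facetE K1M ce e1; have [z2 z2K E2] := facetE K2M ce e2.
have [z3 z3K E3] := facetE K3M ce e3.
have [b1 [g1 bar1]] := elt_bary tri K1M; have [b2 [g2 bar2]] := elt_bary tri K2M.
have l12 := opposite K1M K2M K12 z1K z2K (etrans (esym E1) E2) bar1.
have l13 := opposite K1M K3M K13 z1K z3K (etrans (esym E1) E3) bar1.
have l23 := opposite K2M K3M K23 z2K z3K (etrans (esym E2) E3) bar2.
have [_ _ bd1] := bar1.
have [|fE _] := affine_face bar2 (a := b1 z1) (h := g1 z1) z2K.
  move=> x xK xz; have : x \in e by rewrite E2 !inE xz.
  by rewrite E1 !inE => /andP[xz1 xK1]; rewrite bd1// eq_sym (negPf xz1).
by move: l13; rewrite fE ltNge mulr_le0// ltW.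
Qed.

Lemma mem_sides e K : (K \in sides e) = (K \in elts M) && (e \subset K).
Proof. by rewrite /sides mem_enum inE. Qed.

Lemma sides_pair K1 K2 e : K1 \in elts M -> K2 \in elts M -> K1 <> K2 -> #|e| = d ->
  e \subset K1 -> e \subset K2 -> sides e = [:: K1; K2] \/ sides e = [:: K2; K1].
Proof.
move=> K1M K2M K12 ce e1 e2.
have m1 : K1 \in sides e by rewrite mem_sides K1M.
have m2 : K2 \in sides e by rewrite mem_sides K2M.
have mem K : K \in sides e -> K = K1 \/ K = K2.
  rewrite mem_sides => /andP[KM eK].
  have [->|K1K] := pselect (K1 = K); [by left|right].
  exact: esym (face_two_sides K1M K2M KM ce e1 e2 eK K12 K1K).
have : uniq (sides e) by exact: enum_uniq.
case: (sides e) m1 m2 mem => [//|A [|B S]] m1 m2 mem u.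
  by move: m1 m2; rewrite !inE => /eqP <- /eqP K21; case: K12.
have AB : A != B by move: u; rewrite /= inE negb_or => /andP[/andP[]].
have mA := mem A (mem_head _ _).
have mB : B = K1 \/ B = K2 by apply: mem; rewrite !inE eqxx orbT.
case: S u mem {m1 m2} => [|C S] u mem.
  case: mA mB AB => -> [] ->; rewrite ?eqxx// => _; [by left|by right].
have mC : C = K1 \/ C = K2 by apply: mem; rewrite !inE eqxx !orbT.
move: u; rewrite /= !inE !negb_or -!andbA => /and5P[_ AC _ BC _].
by case: mA mB mC AB AC BC => -> [] -> [] ->; rewrite ?eqxx.
Qed.

End mesh_topology.

(** * Jumps of gradients, and chains of elements *)

Section jumps.
Context {R : realType} {d : nat} (d1 : (1 < d)%N).
Local Notation E := 'rV[R]_d.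
Variables (Omega : set E) (hOmega : convex_polytope Omega) (M : mesh R d).
Hypothesis tri : triangulation M Omega.
Variable Cnu : R.
Hypothesis qu : meshsize M <= Cnu * rho M.
Local Notation N := (node M).
Local Notation H := (meshsize M).
Implicit Types (K e : {set N}) (x y z : N) (k : R).

(** The counterpart of [jump] for a family of functions, one for each element, that
    are defined everywhere: it is additive. *)
Definition jump_of e (F : {set N} -> E -> R) (w : E) : R :=
  match sides e with
  | K :: K' :: _ => F K w - F K' w
  | [:: K] => F K w
  | [::] => 0
  end.

Lemma jump_ofD e F1 F2 w :
  jump_of e (fun K w => F1 K w + F2 K w) w = jump_of e F1 w + jump_of e F2 w.
Proof. by rewrite /jump_of; case: (sides e) => [|K [|K' S]]//; [rewrite addr0|ring]. Qed.

Lemma face_normalP e : e \in faces M -> eucl (face_normal e) = 1 /\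
  forall x y, x \in e -> y \in e -> dotp (face_normal e) (pos x - pos y) = 0.
Proof.
move=> eF; have [ce [K KM eK]] := faceP eF.
have : head finset.set0 (sides e) \in sides e.
  have : K \in sides e by rewrite mem_sides KM.
  by case: (sides e) => [//|A S] _; rewrite mem_head.
rewrite mem_sides => /andP[]; rewrite /face_normal; set K0 := head _ _ => K0M eK0.
have [z zK0 eE] := facetE tri K0M ce eK0; have [b [g bar]] := elt_bary tri K0M.
have := normal_exists bar (ltnW d1) (elt_card tri K0M) zK0.
by rewrite -eE => /getPex; rewrite -/(outward_normal K0 e) => -[].
Qed.

Variables (v : E -> R) (a : {set N} -> R) (G : {set N} -> E).
Hypothesis vE : forall K, K \in elts M -> forall w, hull (@pos R d M) K w ->
  v w = a K + dotp (G K) w.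

(** The normal derivative of [v] is constant on each side of [e], so the point [0] is
    arbitrary. *)
Definition grad_jump e : R := jump_of e (fun K _ => dotp (face_normal e) (G K)) 0.

(** The affine functions of two adjacent elements agree on their common facet, so the
    difference of their gradients is normal to it, and equals the jump of the normal
    derivative times the normal. *)
Lemma adjacent_diff K1 K2 z (w : E) (t : R) : K1 \in elts M -> K2 \in elts M ->
  K1 <> K2 -> #|K1 :&: K2|%SET = d -> z \in (K1 :&: K2)%SET ->
  (forall i, `|w 0 i - pos z 0 i| <= t) ->
  `|(a K1 + dotp (G K1) w) - (a K2 + dotp (G K2) w)| <=
    `|grad_jump (K1 :&: K2)%SET| * (d%:R * t).
Proof.
move=> K1M K2M K12; set e := (K1 :&: K2)%SET => ce ze wt.
have e1 : e \subset K1 by exact: subsetIl.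
have e2 : e \subset K2 by exact: subsetIr.
have eF : e \in faces M.
  by rewrite inE ce eqxx; apply/existsP; exists K1; rewrite K1M.
have [n1 nort] := face_normalP eF; set n := face_normal e in n1 nort.
have agree x : x \in e -> a K1 + dotp (G K1) (pos x) = a K2 + dotp (G K2) (pos x).
  move=> xe; rewrite -!vE//; apply: hull_vertex; first exact: fintype.subsetP e2 x xe.
  exact: fintype.subsetP e1 x xe.
pose h := G K1 - G K2.
have hort x y : x \in e -> y \in e -> dotp h (pos x - pos y) = 0.
  move=> /agree + /agree; rewrite dotpBl !dotpBr; lra.
have [z1 z1K eE] := facetE tri K1M ce e1; have [b [g bar]] := elt_bary tri K1M.
have hn : h = dotp n h *: n.
  by apply: (normal_span bar (ltnW d1) (elt_card tri K1M) z1K n1); rewrite -eE.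
have -> : a K1 + dotp (G K1) w - (a K2 + dotp (G K2) w) = dotp h (w - pos z).
  by have := agree z ze; rewrite dotpBl !dotpBr; lra.
rewrite hn dotpZl normrM ler_pM//.
  have -> // : `|dotp n h| = `|grad_jump e|.
  rewrite /grad_jump /jump_of dotpBr.
  by have [->|->] := sides_pair d1 tri K1M K2M K12 ce e1 e2; rewrite // distrC.
apply: le_trans (normr_dotp (s := 1) (t := t) _ _) _; last by rewrite mul1r.
  by move=> i; rewrite -n1 coord_le_eucl.
by move=> i; rewrite !mxE.
Qed.

Lemma closure_Omega_convex (u w : E) t : closure Omega u -> closure Omega w ->
  0 <= t <= 1 -> closure Omega ((1 - t) *: u + t *: w).
Proof.
have [_ _ _ _ [k [p ->]]] := hOmega; exact: hull_convex.
Qed.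

Definition meets_segment (y u : E) K := exists2 t, 0 <= t <= 1 &
  hull (@pos R d M) K ((1 - t) *: y + t *: u).

(** [y] is chosen off the hyperplanes spanned by [u] and the faces of codimension
    two, so that the segment from [y] to [u] crosses from one element to the next
    through the interior of a common facet. *)
Lemma generic_segment K0 K (u : E) : K0 \in elts M -> K \in elts M -> cell K0 u ->
  exists2 y, cell K y & forall e, (#|e| < d)%N -> forall t, 0 <= t < 1 ->
    ~ hull (@pos R d M) e ((1 - t) *: y + t *: u).
Proof.
move=> K0M KM uK0.
have /choice[n nP] : forall e, exists n : E, (#|e| < d)%N ->
    n != 0 /\ forall z, z \in e -> dotp n (pos z - u) = 0.
  move=> e; have [ed|_] := boolP (#|e| < d)%N; last by exists 0.
  by have [n n0 nz] := orthogonal_exists (fun z => pos z - u) ed; exists n.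
(* For each set of fewer than [d] nodes, a hyperplane through [u] that contains it. *)
pose S := [seq (- dotp (n e) u, n e) | e <- enum [set e : {set N} | (#|e| < d)%N]%SET].
have cK : cell (M:=M) K !=set0.
  have [c sub] := elt_box d1 hOmega tri qu KM.
  exists c; apply/interior_box; exists (shape (d:=d) Cnu * H) => //.
  by rewrite mulr_gt0 ?(shape_gt0 d1)// (meshsize_gt0 d1 hOmega tri).
have [|y yK yS] := avoid_hyperplanes (s := S) (@open_interior _ _) cK.
  move=> p /mapP[e]; rewrite mem_enum inE => ed -> /=.
  by have [] := nP e ed.
exists y => // e ed t /andP[t0 t1] [c [c0 c1 wE]]; have [n0 nz] := nP e ed.
have : dotp (n e) ((1 - t) *: y + t *: u - u) = 0.
  have -> : (1 - t) *: y + t *: u - u = \sum_(z in e) c z *: (pos z - u).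
    under eq_bigr do rewrite scalerBr.
    by rewrite sumrB -wE -scaler_suml c1 scale1r.
  by rewrite dotp_sumr big1// => z ze; rewrite nz// mulr0.
have -> : (1 - t) *: y + t *: u - u = (1 - t) *: (y - u).
  by apply/rowP => i; rewrite !mxE; ring.
rewrite dotpZr => /eqP; rewrite mulf_eq0 subr_eq0 (gt_eqF t1)/= dotpBr => /eqP h.
have /negP[] : - dotp (n e) u + dotp (n e) y != 0.
  by apply: (yS (_, _)); apply/mapP; exists e; rewrite ?mem_enum ?inE.
by apply/eqP; lra.
Qed.

Lemma closed_meets (y u : E) (B : pred {set N}) : (forall K, B K -> K \in elts M) ->
  closed [set t : R | exists2 K, B K & hull (@pos R d M) K ((1 - t) *: y + t *: u)].
Proof.
move=> BM; rewrite (_ : [set t | _] = \bigcup_(K in [set` [set K | B K]%SET])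
    ((fun t : R => (1 - t) *: y + t *: u) @^-1` hull (@pos R d M) K)); last first.
  apply/seteqP; split=> t /=; first by move=> [K BK h]; exists K => //=; rewrite inE.
  by move=> [K /=]; rewrite inE => BK h; exists K.
apply: closed_bigcup => [|K /=]; first exact: finite_finset.
rewrite inE => /BM /(elt_bary tri)[b [g bar]].
apply: closed_comp; last exact: (hull_closed bar).
move=> t _; apply: cvgD; apply: cvgZr_tmp => //.
by apply: cvgB => //; exact: cvg_cst.
Qed.

(** The elements met by a generic segment from [K] to [K0] are connected to each other
    through common facets: otherwise two disjoint closed sets would cover the segment.
    They are all near [K], which bounds the length of a chain without repetition. *)
Lemma facet_chain k K0 K : 1 <= k -> K0 \in elts M -> K \in elts M ->
  (forall u y : E, hull (@pos R d M) K0 u -> hull (@pos R d M) K y ->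
     forall i, `|u 0 i - y 0 i| <= k * H) ->
  exists p : seq {set N}, [/\ K0 = last K p, (size p <= near_bound (d:=d) Cnu k)%N &
    path (fun A B => [&& #|(A :&: B)%SET| == d, A \in nearby k K & B \in nearby k K]) K p].
Proof.
move=> k1 K0M KM dist.
have cK0 : cell (M:=M) K0 !=set0.
  have [c sub] := elt_box d1 hOmega tri qu K0M.
  exists c; apply/interior_box; exists (shape (d:=d) Cnu * H) => //.
  by rewrite mulr_gt0 ?(shape_gt0 d1)// (meshsize_gt0 d1 hOmega tri).
have [u uK0] := cK0; have huK0 := interior_subset uK0.
have [y yK gen] := generic_segment K0M KM uK0; have hyK := interior_subset yK.
pose A : {set {set N}} := [set K' in elts M | `[< meets_segment y u K' >]]%SET.
have AP K' : reflect (K' \in elts M /\ meets_segment y u K') (K' \in A).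
  by rewrite inE; apply: (iffP andP) => -[? /asboolP].
have Anear K' : K' \in A -> K' \in nearby k K.
  move=> /AP[K'M [t /andP[t0 t1] tK']]; apply/nearbyP; split=> //.
  exists y, ((1 - t) *: y + t *: u); split=> // i; rewrite !mxE.
  have -> : y 0 i - ((1 - t) * y 0 i + t * u 0 i) = t * (y 0 i - u 0 i) by ring.
  rewrite normrM distrC (ger0_norm t0); apply: le_trans (_ : 1 * (k * H) <= _).
    by apply: ler_pM => //; exact: dist.
  by rewrite mul1r.
pose adj (X Y : {set N}) := [&& #|(X :&: Y)%SET| == d, X \in A & Y \in A].
have KA : K \in A.
  apply/AP; split=> //; exists 0; rewrite ?lexx ?ler01//.
  by rewrite subr0 scale1r scale0r addr0.
have K0A : K0 \in A.
  apply/AP; split=> //; exists 1; rewrite ?lexx ?ler01//.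
  by rewrite subrr scale0r scale1r add0r.
have con : connect adj K K0.
  apply/negP => /negP ncon.
  pose B1 := [pred X | (X \in A) && connect adj K X].
  pose B2 := [pred X | (X \in A) && ~~ connect adj K X].
  have [||||t tt|t /andP[t0 t1] [[X1 /andP[X1A c1] h1] [X2 /andP[X2A c2] h2]]] :=
      segment_closed_cover (closed_meets (y := y) (u := u) (B := B1) _)
        (closed_meets (y := y) (u := u) (B := B2) _).
  - by move=> X /andP[/AP[]].
  - by move=> X /andP[/AP[]].
  - exists K; first by rewrite /B1/= KA connect0.
    by rewrite subr0 scale1r scale0r addr0.
  - exists K0; first by rewrite /B2/= K0A ncon.
    by rewrite subrr scale0r scale1r add0r.
  - have : closure Omega ((1 - t) *: y + t *: u).
      have [_ _ _ _ clE] := tri.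
      by apply: closure_Omega_convex => //; rewrite clE; [exists K|exists K0].
    have [_ _ _ _ clE] := tri; rewrite clE => -[X XM hX].
    have XA : X \in A by apply/AP; split=> //; exists t.
    have [cX|cX] := boolP (connect adj K X); [left|right]; exists X => //=.
      by rewrite XA.
    by rewrite XA.
  have /AP[X1M _] := X1A; have /AP[X2M _] := X2A.
  have X12 : X1 != X2 by apply: contraNneq c2 => <-.
  move: t1; rewrite le_eqVlt => /predU1P[t1|t1].
    move: h1 h2; rewrite t1 subrr scale0r scale1r add0r => h1 h2.
    move: X12; rewrite -(cell_hull_eq tri K0M X1M uK0 h1).
    by rewrite -(cell_hull_eq tri K0M X2M uK0 h2) eqxx.
  have [_ _ _ inter _] := tri.
  have h12 : hull (@pos R d M) (X1 :&: X2)%SET ((1 - t) *: y + t *: u) by rewrite -inter.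
  have card12 : (#|(X1 :&: X2)%SET| <= d)%N.
    rewrite -ltnS -(elt_card tri X1M) ltn_neqAle subset_leq_card ?subsetIl// andbT.
    apply: contra X12 => c12; rewrite eqEcard !(elt_card tri)// leqnn andbT.
    by apply/finset.setIidPl/eqP; rewrite eqEcard subsetIl (eqP c12) leqnn.
  move: card12; rewrite leq_eqVlt => /orP[c12|c12].
    by move: c2; rewrite (connect_trans c1)// connect1// /adj c12 X1A X2A.
  by apply: (gen _ c12 t _ h12); rewrite t0.
have /connectP[p0 /shortenP[p pp up _] pl] := con.
exists p; split=> //; last first.
  by apply: sub_path pp => X Y /and3P[XY /Anear nX /Anear nY]; apply/and3P.
apply: leq_trans (card_nearby d1 hOmega tri qu (le_trans ler01 k1) KM).
have pA : {subset p <= A}.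
  move: pp {pl up}; elim: p (K) => [//|X p IH] Y /= /andP[/and3P[_ _ XA] pp] Z.
  by rewrite inE => /predU1P[->//|]; exact: (IH X).
move: up; rewrite /= => /andP[_ /card_uniqP <-].
apply: subset_leq_card; apply/fintype.subsetP => X /pA; exact: Anear.
Qed.

(** Telescoping along a chain from [K] to [K0]: in each step [adjacent_diff] is used
    with a vertex of the common facet, which lies within [(2 * k + 3) * H] of [x]. *)
Lemma extension_error k K0 K x (J : R) : 1 <= k -> K0 \in elts M -> K \in elts M ->
  (forall u y : E, hull (@pos R d M) K0 u -> hull (@pos R d M) K y ->
     forall i, `|u 0 i - y 0 i| <= k * H) -> x \in K0 -> 0 <= J ->
  (forall e K', e \in faces M -> e \subset K' -> K' \in nearby k K ->
     `|grad_jump e| <= J) ->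
  `|a K + dotp (G K) (pos x) - v (pos x)| <=
    (near_bound (d:=d) Cnu k)%:R * (J * (d%:R * ((2 * k + 3) * H))).
Proof.
move=> k1 K0M KM dist xK0 J0 Jle.
have [p [K0E psize pp]] := facet_chain k1 K0M KM dist.
have H0 := meshsize_gt0 d1 hOmega tri.
have near_dist X z : X \in nearby k K -> z \in X -> forall i,
    `|pos x 0 i - pos z 0 i| <= (2 * k + 3) * H.
  move=> /nearbyP[XM [u [w [uK wX uw]]]] zX i.
  have h1 := dist _ _ (hull_vertex _ xK0) uK i.
  have h2 := uw i; have h3 := elt_coord_le XM wX (hull_vertex _ zX) i.
  have -> : pos x 0 i - pos z 0 i = (pos x 0 i - u 0 i) +
    ((u 0 i - w 0 i) + (w 0 i - pos z 0 i)) by ring.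
  apply: le_trans (ler_normD _ _) _; apply: le_trans (lerD (lexx _) (ler_normD _ _)) _.
  by lra.
have -> : v (pos x) = a K0 + dotp (G K0) (pos x) by apply: vE => //; exact: hull_vertex.
apply: le_trans (_ : (size p)%:R * (J * (d%:R * ((2 * k + 3) * H))) <= _); last first.
  rewrite ler_wpM2r ?ler_nat// mulr_ge0// mulr_ge0// mulr_ge0 ?(ltW H0)//; lra.
pose L X := a X + dotp (G X) (pos x); rewrite -/(L K) -/(L K0).
pose c := J * (d%:R * ((2 * k + 3) * H)); rewrite -/c.
have step X Y : [&& #|(X :&: Y)%SET| == d, X \in nearby k K & Y \in nearby k K] ->
    `|L X - L Y| <= c.
  move=> /and3P[/eqP cXY nX nY]; have /nearbyP[XM _] := nX; have /nearbyP[YM _] := nY.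
  have [z zXY] : exists z, z \in (X :&: Y)%SET.
    by apply/set0Pn; rewrite -card_gt0 cXY ltnW.
  have XY : X <> Y.
    move=> XY; move: cXY; rewrite -XY finset.setIid (elt_card tri XM) => /eqP.
    by rewrite eqn_leq ltnn.
  have t0 : 0 <= d%:R * ((2 * k + 3) * H).
    by rewrite mulr_ge0// mulr_ge0 ?(ltW H0)//; lra.
  apply: le_trans (adjacent_diff XM YM XY cXY zXY (t := (2 * k + 3) * H) _) _.
    by apply: (near_dist X) => //; exact: fintype.subsetP (subsetIl _ _) z zXY.
  rewrite ler_wpM2r//; apply: (Jle _ X) => //; last exact: subsetIl.
  by rewrite inE cXY eqxx; apply/existsP; exists X; rewrite XM subsetIl.
pose r : rel {set N} := fun A B =>
  [&& #|(A :&: B)%SET| == d, A \in nearby k K & B \in nearby k K].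
have {}pp : path r K p by [].
rewrite K0E; elim: p {psize K0E} (K) pp => [|X p IH] Y /=.
  by rewrite subrr normr0 mul0r.
move=> /andP[h1 h2]; have h := step Y X h1; have h' := IH X h2.
have -> : L Y - L (last X p) = (L Y - L X) + (L X - L (last X p)) by ring.
apply: le_trans (ler_normD _ _) _; rewrite -natr1 mulrDl mul1r addrC.
exact: lerD.
Qed.

End jumps.

(** * Areas of faces, and traces *)

Section gram.
Context {R : realType} {d : nat}.
Local Notation E := 'rV[R]_d.
Implicit Types (a b g : E) (t u : R).

Lemma sqr_eucl a : eucl a ^+ 2 = dotp a a.
Proof. by rewrite sqr_sqrtr// dotp_ge0. Qed.

Lemma eucl_ge0 a : 0 <= eucl a.
Proof. exact: sqrtr_ge0. Qed.

Lemma gramE n (J : 'M[R]_(n, d)) i j : (J *m J^T) i j = dotp (row i J) (row j J).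
Proof. by rewrite mxE; apply: eq_bigr => k _; rewrite !mxE. Qed.

Lemma det_mx2 (A : 'M[R]_2) : \det A = A 0 0 * A 1 1 - A 0 1 * A 1 0.
Proof.
rewrite (expand_det_row _ 0) !big_ord_recl big_ord0 /cofactor !det_mx11 !mxE.
have -> : lift 0 (0 : 'I_1) = 1 :> 'I_2 by exact: val_inj.
have -> : lift (1 : 'I_2) (0 : 'I_1) = 0 :> 'I_2 by exact: val_inj.
by rewrite /= addr0 expr0 mul1r expr1 mulN1r mulrN.
Qed.

Lemma det_gram2 (J : 'M[R]_(2, d)) (a := row 0 J) (b := row 1 J) :
  \det (J *m J^T) = dotp a a * dotp b b - dotp a b ^+ 2.
Proof. by rewrite det_mx2 !gramE -/a -/b [dotp b a]dotpC expr2. Qed.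

(** The Gram determinant is the square of the length of [a] times the square of the
    height of [b] over [a]; as [g] vanishes on [a] and is 1 at [b], this height cannot
    be small when [g] is bounded. *)
Lemma gram_height a b g t u : 0 < t -> t <= eucl a -> dotp g a = 0 -> dotp g b = 1 ->
  (forall i, `|g 0 i| <= u) -> d%:R * u * t <= 1 ->
  t ^+ 4 <= dotp a a * dotp b b - dotp a b ^+ 2.
Proof.
move=> t0 ta ga gb gu ut; have aa0 : 0 < dotp a a.
  by rewrite -sqr_eucl exprn_gt0// (lt_le_trans t0).
pose l := dotp a b / dotp a a; pose c := b - l *: a.
have -> : dotp a a * dotp b b - dotp a b ^+ 2 = dotp a a * dotp c c.
  rewrite /c dotpBl !dotpBr !dotpZl !dotpZr [dotp b a]dotpC /l.
  by field; rewrite gt_eqF.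
have gc : dotp g c = 1 by rewrite /c dotpBr dotpZr ga mulr0 subr0.
have tc : t <= eucl c.
  have h : `|dotp g c| <= d%:R * (u * eucl c).
    by apply: normr_dotp => //; exact: coord_le_eucl.
  rewrite gc normr1 in h; rewrite leNgt; apply/negP => ct.
  have c0 : 0 < d%:R * u.
    rewrite ltNge; apply/negP => du0; move: h; rewrite mulrA leNgt => /negP; apply.
    by apply: le_lt_trans ltr01; rewrite mulr_le0_ge0// eucl_ge0.
  have : d%:R * u * eucl c < d%:R * u * t by rewrite ltr_pM2l.
  by rewrite -mulrA; lra.
rewrite -!sqr_eucl -exprMn (_ : t ^+ 4 = (t * t) ^+ 2); last by ring.
rewrite lerXn2r ?nnegrE ?mulr_ge0 ?eucl_ge0 ?(ltW t0)//.
by apply: ler_pM => //; exact: ltW.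
Qed.

Lemma gram_area_le a b t : eucl a <= t -> eucl b <= t ->
  dotp a a * dotp b b - dotp a b ^+ 2 <= t ^+ 4.
Proof.
move=> ta tb; apply: le_trans (_ : dotp a a * dotp b b <= _).
  by rewrite gerBl sqr_ge0.
have -> : t ^+ 4 = t ^+ 2 * t ^+ 2 by ring.
have t0 : 0 <= t by apply: le_trans (eucl_ge0 a) ta.
by rewrite -!sqr_eucl ler_pM ?sqr_ge0// lerXn2r ?nnegrE ?eucl_ge0.
Qed.

End gram.

Section traces.
Context {R : realType} {d : nat} (d1 : (1 < d)%N).
Local Notation E := 'rV[R]_d.
Variables (Omega : set E) (hOmega : convex_polytope Omega) (M : mesh R d).
Hypothesis tri : triangulation M Omega.
Variable Cnu : R.
Hypothesis qu : meshsize M <= Cnu * rho M.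
Local Notation N := (node M).
Local Notation H := (meshsize M).
Implicit Types (K e : {set N}) (f F : E -> R) (w : E).

(** Points of the hull are moved slightly towards the centre of a cube. *)
Lemma cell_dense K w : K \in elts M -> hull (@pos R d M) K w -> closure (cell K) w.
Proof.
move=> KM Kw U /nbhs_box[r r0 rU]; have [c sub] := elt_box d1 hOmega tri qu KM.
have s0 : 0 < shape (d:=d) Cnu * H.
  by rewrite mulr_gt0 ?(shape_gt0 d1)// (meshsize_gt0 d1 hOmega tri).
pose D := 1 + \sum_i `|c 0 i - w 0 i|.
have D1 : 1 <= D by rewrite lerDl sumr_ge0.
pose t := Num.min 1 (r / D).
have D0 : 0 < D by apply: lt_le_trans D1.
have t0 : 0 < t by rewrite lt_min ltr01 divr_gt0.
exists ((1 - t) *: w + t *: c); split.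
  by apply: (hull_shrink_cell s0 sub Kw); rewrite t0 ge_min lexx.
apply: rU => i; rewrite !mxE.
have -> : (1 - t) * w 0 i + t * c 0 i - w 0 i = t * (c 0 i - w 0 i) by ring.
rewrite normrM (gtr0_norm t0); apply: le_trans (_ : t * D <= _).
  rewrite ler_wpM2l ?(ltW t0)// /D (bigD1 i)//= addrCA lerDl addr_ge0//.
  by apply: sumr_ge0.
by rewrite -ler_pdivlMr// ge_min lexx orbT.
Qed.

Lemma trace_eq K f F w : K \in elts M -> continuous F -> (forall y, cell K y -> f y = F y) ->
  hull (@pos R d M) K w -> trace K f w = F w.
Proof.
move=> KM cF fF Kw; have pf := within_nbhs_proper (cell_dense KM Kw).
apply: cvg_lim => //; apply: (@cvg_trans _ (F @ within (cell K) (nbhs w))).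
  by apply: fmap_within_eq => y; rewrite inE => /fF.
by apply: cvg_within_filter; exact: cF.
Qed.

Lemma partial_eq_on (U : set E) f F i w : open U -> U w ->
  (forall y, U y -> f y = F y) -> partial i f w = partial i F w.
Proof.
move=> oU Uw fF; apply: near_eq_derive.
by near=> y; apply: fF; near: y; exact: open_nbhs_nbhs.
Unshelve. all: by end_near. Qed.

Lemma gradient_eq_on (U : set E) f F w : open U -> U w ->
  (forall y, U y -> f y = F y) -> gradient f w = gradient F w.
Proof.
by move=> oU Uw fF; apply/rowP => i; rewrite !mxE (partial_eq_on _ oU Uw fF).
Qed.

Lemma laplacian_eq_on (U : set E) f F w : open U -> U w ->
  (forall y, U y -> f y = F y) -> laplacian f w = laplacian F w.
Proof.
move=> oU Uw fF; apply: eq_bigr => i _; apply: (partial_eq_on _ oU Uw) => y Uy.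
exact: partial_eq_on oU Uy fF.
Qed.

Lemma jump_eq e f (F : {set N} -> E -> R) w :
  (forall K, K \in elts M -> continuous (F K)) ->
  (forall K, K \in elts M -> forall y, cell K y -> f y = F K y) ->
  hull (@pos R d M) e w -> jump e f w = jump_of e F w.
Proof.
move=> cF fF ew; have tr K : K \in sides e -> trace K f w = F K w.
  rewrite mem_sides => /andP[KM eK]; apply: trace_eq => //; first exact: cF.
    exact: fF.
  exact: hullS eK _ ew.
rewrite /jump /jump_of; case: (sides e) tr => [//|A [|B S]] tr.
  by rewrite tr ?mem_head.
by rewrite !tr ?mem_head// !inE eqxx orbT.
Qed.

Lemma normal_derivative_eq e f (F : {set N} -> E -> R) K w :
  (forall K, K \in elts M -> forall y, cell K y -> f y = F K y) ->
  K \in elts M -> cell K w ->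
  normal_derivative e f w = normal_derivative e (F K) w.
Proof.
move=> fF KM Kw; rewrite /normal_derivative; congr dotp.
by apply: (gradient_eq_on _ Kw (fF K KM)); exact: open_interior.
Qed.

End traces.

(** * Integrals over faces *)

Section gram_bounds.
Context {R : realType} {d : nat}.

Lemma gram_bounds n (J : 'M[R]_(n, d)) (t u h : R) : n = 1%N \/ n = 2%N ->
  0 < t -> d%:R * u * t <= 1 -> (forall i, t <= eucl (row i J) <= h) ->
  (forall i j, i != j -> exists g : 'rV[R]_d,
     [/\ dotp g (row i J) = 0, dotp g (row j J) = 1 & forall k, `|g 0 k| <= u]) ->
  t ^+ n <= Num.sqrt (\det (J *m J^T)) <= h ^+ n.
Proof.
move=> hn t0 dut th gP; case: hn => hn; subst n.
  by rewrite det_mx11 gramE !expr1; exact: th.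
have [g [g0 g1 gu]] := gP 0 1 isT.
have /andP[t1 h1] := th 0; have /andP[t2 h2] := th 1.
have h0 : 0 <= h by apply: le_trans (eucl_ge0 _) h1.
rewrite det_gram2 -[t ^+ 2]ger0_norm ?exprn_ge0 ?(ltW t0)// -sqrtr_sqr.
rewrite -[h ^+ 2]ger0_norm ?exprn_ge0// -[`|h ^+ 2|]sqrtr_sqr -!exprM.
have lo := gram_height t0 t1 g0 g1 gu dut.
have hi := gram_area_le h1 h2.
apply/andP; split.
  by rewrite ler_sqrt// (le_trans _ lo)// exprn_ge0// ltW.
by rewrite ler_sqrt// exprn_ge0.
Qed.
End gram_bounds.

Section face_integrals.
Context {R : realType} {d : nat} (d1 : (1 < d)%N).
Local Notation E := 'rV[R]_d.
Variables (Omega : set E) (hOmega : convex_polytope Omega) (M : mesh R d).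
Hypothesis tri : triangulation M Omega.
Variable Cnu : R.
Hypothesis qu : meshsize M <= Cnu * rho M.
Local Notation N := (node M).
Local Notation H := (meshsize M).
Implicit Types (K e : {set N}) (w : E).

Definition face_vertex e i : E := [seq pos x | x <- enum e]`_i.

Definition face_jac e : 'M[R]_(d.-1, d) :=
  \matrix_(i < d.-1) (face_vertex e i.+1 - face_vertex e 0).

Definition face_map e t : E := face_vertex e 0 + t *m face_jac e.

Definition face_area e : R := Num.sqrt (\det (face_jac e *m (face_jac e)^T)).

Definition ref_volume : R := fine (lebesgue d.-1 (@ref_simplex R d.-1)).

Lemma face_integralE e f : face_integral e f =
  face_area e * \int[lebesgue d.-1]_(t in @ref_simplex R d.-1) f (face_map e t).
Proof. by []. Qed.

Lemma face_mapE e t : face_map e t =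
  (1 - \sum_i t 0 i) *: face_vertex e 0 + \sum_i t 0 i *: face_vertex e i.+1.
Proof.
rewrite /face_map mulmx_sum_row.
under eq_bigr do rewrite rowK scalerBr.
by rewrite sumrB -scaler_suml scalerBl scale1r addrCA addrC.
Qed.

Lemma face_map_hull e t : #|e| = d -> ref_simplex t -> hull (@pos R d M) e (face_map e t).
Proof.
move=> ce [t0 t1]; have ze : size (enum e) = d by rewrite -cardE.
have [x0 x0e] : exists x, x \in e by apply/set0Pn; rewrite -card_gt0 ce ltnW.
(* The weight of the vertex that comes in position [i] in the enumeration of [e]. *)
pose wt i : R := if i is j.+1 then (if insub j is Some k then t 0 k else 0)
  else 1 - \sum_i t 0 i.
have sumE (V : nmodType) (F : N -> nat -> V) :
    \sum_(x in e) F x (index x (enum e)) =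
    F (nth x0 (enum e) 0%N) 0%N + \sum_(i < d.-1) F (nth x0 (enum e) i.+1) i.+1.
  rewrite -big_enum/= (big_nth x0) ze -{1}(ltn_predK d1) big_nat_recl// big_mkord.
  have idx i : (i < d)%N -> index (nth x0 (enum e) i) (enum e) = i.
    by move=> id; rewrite index_uniq ?ze ?enum_uniq.
  rewrite (idx _ (ltnW d1)); congr (_ + _); apply: eq_bigr => i _.
  by rewrite idx// -{2}(ltn_predK d1) ltnS.
have wtS (i : 'I_d.-1) : wt i.+1 = t 0 i by rewrite /= valK.
exists (fun x => wt (index x (enum e))); split.
- move=> x _; rewrite /wt; case: index => [|i]; first by rewrite subr_ge0.
  by case: insubP => [k _ _|_].
- rewrite (sumE _ (fun=> wt)); under eq_bigr do rewrite wtS.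
  by rewrite /= subrK.
- rewrite face_mapE (sumE _ (fun x i => wt i *: pos x)).
  rewrite /face_vertex (nth_map x0) ?ze ?(ltnW d1)//; congr (_ + _).
  apply: eq_bigr => i _; rewrite wtS (nth_map x0)// ze.
  by rewrite -{2}(ltn_predK d1) ltnS.
Qed.

(** The linear forms needed by [gram_bounds] are the gradients of the barycentric
    coordinates of an element that contains [e]. *)
Lemma face_area_bounds e : d = 2%N \/ d = 3%N -> e \in faces M ->
  (2 * shape (d:=d) Cnu * H / d%:R) ^+ d.-1 <= face_area e <= H ^+ d.-1.
Proof.
move=> hd /faceP[ce [K KM eK]]; have ze : size (enum e) = d by rewrite -cardE.
have [b [g bar]] := elt_bary tri KM; have [_ _ bd] := bar.
have [c sub] := elt_box d1 hOmega tri qu KM.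
have [x0 x0e] : exists x, x \in e by apply/set0Pn; rewrite -card_gt0 ce ltnW.
have s0 : 0 < shape (d:=d) Cnu * H.
  by rewrite mulr_gt0 ?(shape_gt0 d1)// (meshsize_gt0 d1 hOmega tri).
have d0 : 0 < d%:R :> R by rewrite ltr0n ltnW.
pose x i := nth x0 (enum e) i.
have xe i : (i < d)%N -> x i \in e by move=> id; rewrite -mem_enum mem_nth// ze.
have xK i : (i < d)%N -> x i \in K by move=> /xe; exact: fintype.subsetP eK _.
have xd i j : (i < d)%N -> (j < d)%N -> (x i == x j) = (i == j).
  by move=> id jd; rewrite nth_uniq ?ze ?enum_uniq.
have iS (i : 'I_d.-1) : (i.+1 < d)%N by rewrite -{2}(ltn_predK d1) ltnS.
have rowE i : row i (face_jac e) = pos (x i.+1) - pos (x 0%N).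
  by rewrite rowK /face_vertex !(nth_map x0) ?ze ?(ltnW d1)// iS.
have sh0 := shape_gt0 d1 Cnu (R := R); have H0 := meshsize_gt0 d1 hOmega tri.
apply: (gram_bounds (u := (2 * (shape (d:=d) Cnu * H))^-1)).
- by case: hd => ->; [left|right].
- by rewrite divr_gt0// -mulrA mulr_gt0.
- by rewrite le_eqVlt; apply/orP; left; apply/eqP; field; rewrite !gt_eqF//.
- move=> i; rewrite rowE; apply/andP; split.
    apply: (vertex_dist d1 hOmega tri qu KM); [exact: xK (iS i)|exact: xK (ltnW d1)|].
    by rewrite (xd _ _ (iS i) (ltnW d1)).
  apply: le_trans (elt_le_meshsize KM).
  by apply: eucl_le_diam; apply: hull_vertex; apply: xK; [exact: iS|exact: ltnW].
- move=> i j ij; exists (g (x j.+1)); split.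
  + rewrite rowE dotpBr; have := bd (x j.+1) (x i.+1) (xK _ (iS j)) (xK _ (iS i)).
    have := bd (x j.+1) (x 0%N) (xK _ (iS j)) (xK _ (ltnW d1)).
    rewrite (xd _ _ (iS j) (iS i)) (xd _ _ (iS j) (ltnW d1)).
    have -> : (j.+1 == i.+1 :> nat) = false.
      by rewrite eqSS eq_sym; apply/negbTE; exact: ij.
    by rewrite /=; lra.
  + rewrite rowE dotpBr; have := bd (x j.+1) (x j.+1) (xK _ (iS j)) (xK _ (iS j)).
    have := bd (x j.+1) (x 0%N) (xK _ (iS j)) (xK _ (ltnW d1)).
    rewrite (xd _ _ (iS j) (ltnW d1)) eqxx /=; lra.
  + move=> k; exact: (bary_grad_le bar k s0 sub (xK _ (iS j))).
Qed.

Lemma ref_volume_gt0 : 0 < ref_volume.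
Proof. exact: lebesgue_ref_simplex_gt0. Qed.

Lemma face_integral_ge0 e f : #|e| = d -> (forall w, hull (@pos R d M) e w -> 0 <= f w) ->
  0 <= face_integral e f.
Proof.
move=> ce f0; rewrite face_integralE mulr_ge0 ?sqrtr_ge0//.
by apply: Rintegral_ge0 => t /(face_map_hull ce)/f0.
Qed.

Lemma eq_face_integral e f g : #|e| = d -> (forall w, hull (@pos R d M) e w -> f w = g w) ->
  face_integral e f = face_integral e g.
Proof.
move=> ce fg; rewrite !face_integralE; congr (_ * _); apply: eq_Rintegral => t.
by rewrite inE => /(face_map_hull ce)/fg.
Qed.

Lemma face_integral_cst e c : face_integral e (fun=> c) = face_area e * (c * ref_volume).
Proof.
rewrite face_integralE; congr (_ * _).
by rewrite Rintegral_cst//; exact: measurable_ref_simplex.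
Qed.

(** Makes the measurability and the boundedness of affine traces visible. *)
Lemma affine_face_map e (a : R) (g : E) : exists (c : R) (h : 'rV[R]_d.-1),
  forall t, a + dotp g (face_map e t) = c + \sum_i h 0 i * t 0 i.
Proof.
exists (a + dotp g (face_vertex e 0)), (\row_i dotp g (row i (face_jac e))) => t.
rewrite dotpDr addrA; congr (_ + _); rewrite mulmx_sum_row dotp_sumr.
by apply: eq_bigr => i _; rewrite !mxE mulrC.
Qed.

Lemma face_integral_le e f (a : R) (g : E) (k c : R) : #|e| = d -> 0 <= k -> 0 <= c ->
  (forall w, hull (@pos R d M) e w -> 0 <= f w <= k * (a + dotp g w) ^+ 2 + c) ->
  face_integral e f <= k * face_integral e (fun w => (a + dotp g w) ^+ 2) +
     c * (face_area e * ref_volume).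
Proof.
move=> ce k0 c0 fb; rewrite !face_integralE mulrCA [c * _]mulrCA -mulrDr.
rewrite ler_wpM2l ?sqrtr_ge0//.
have [a' [h hE]] := affine_face_map e a g.
apply: Rintegral_le_sqr => //.
- exact: measurable_ref_simplex.
- exact: lebesgue_ref_simplex_lty.
- apply: measurable_funTS.
  rewrite (_ : (fun t => _) = (fun t : 'rV[R]_d.-1 => a' + \sum_i h 0 i * t 0 i)); last first.
    by apply/funext.
  apply: measurable_funD => //; apply: measurable_sum => i.
  by apply: measurable_funM => //; exact: measurable_rV_coord.
- exists (`|a'| + \sum_i `|h 0 i|) => t /ref_simplex_box t1; rewrite hE.
  apply: le_trans (ler_normD _ _) _; rewrite lerD2l.
  apply: le_trans (ler_norm_sum _ _ _) _; apply: ler_sum => i _.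
  by rewrite normrM ler_piMr//; have := t1 i; rewrite mxE subr0.
- by move=> t /(face_map_hull ce)/fb.
Qed.

End face_integrals.

(** * Patches and the local reconstruction *)

Section patches.
Context {R : realType} {d : nat}.
Local Notation E := 'rV[R]_d.
Variables (Omega : set E) (M : mesh R d).
Hypothesis tri : triangulation M Omega.
Local Notation N := (node M).
Local Notation H := (meshsize M).
Implicit Types (K e : {set N}) (w : E) (S : {set {set N}}) (x : N).

(** Two elements meet in the hull of their common vertices. *)
Lemma neighboursE K K' : K \in elts M ->
  (K' \in neighbours K) = (K' \in elts M) && (K' :&: K != finset.set0)%SET.
Proof.
move=> KM; rewrite inE; have [K'M|] //= := boolP (K' \in elts M).
apply/asboolP/idP => [[w]|/set0Pn[x]]; last first.
  by rewrite inE => /andP[xK' xK]; exists (pos x); split; exact: hull_vertex.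
have [_ _ _ inter _] := tri; rewrite inter// finset.setIC => -[c [_ c1 _]].
apply: contraTneq isT => K0; move: c1; rewrite K0 big_set0 => /eqP.
by rewrite eq_sym oner_eq0.
Qed.

Lemma layers_elts K t K' : K \in elts M -> K' \in layers t K -> K' \in elts M.
Proof.
move=> KM; case: t => [|t] /=; first by rewrite inE => /eqP ->.
by move=> /bigcupP[B _]; rewrite inE => /andP[].
Qed.

Lemma layersS K t K' : K \in elts M -> (K' \in layers t.+1 K) =
  (K' \in elts M) && (K' :&: finset.cover (layers t K) != finset.set0)%SET.
Proof.
move=> KM; apply/idP/idP => [/= /bigcupP[B BL]|/andP[K'M /set0Pn[x]]].
  have BM := layers_elts KM BL; rewrite neighboursE// => /andP[-> /set0Pn[x]].
  rewrite inE => /andP[xK' xB]; apply/set0Pn; exists x; rewrite inE xK'.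
  by apply/bigcupP; exists B.
rewrite inE => /andP[xK' /bigcupP[B BL xB]]; apply/bigcupP; exists B => //.
rewrite (neighboursE _ (layers_elts KM BL)) K'M; apply/set0Pn; exists x.
by rewrite inE xK'.
Qed.

Lemma layers_mono K t : K \in elts M -> layers t K \subset layers t.+1 K.
Proof.
move=> KM; apply/fintype.subsetP => B BL; apply/bigcupP; exists B => //.
have BM := layers_elts KM BL; rewrite neighboursE// BM finset.setIid.
by rewrite -card_gt0 (elt_card tri BM).
Qed.

Lemma mem_layers K t : K \in elts M -> K \in layers t K.
Proof.
move=> KM; elim: t => [|t IH]; first by rewrite inE.
exact: (fintype.subsetP (layers_mono t KM)).
Qed.

Lemma cover_mono K t : K \in elts M ->
  finset.cover (layers t K) \subset finset.cover (layers t.+1 K).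
Proof.
move=> KM; apply/fintype.subsetP => x /bigcupP[B BL xB]; apply/bigcupP; exists B => //.
exact: (fintype.subsetP (layers_mono t KM)).
Qed.

(** If a layer brings no new node, then neither do the following ones, and the depth is
    never reached. So each layer before the depth brings at least one new node. *)
Lemma depth_le Nm K t : (0 < Nm)%N -> K \in elts M -> is_depth Nm K t -> (t <= Nm)%N.
Proof.
move=> Nm0 KM [t1 tN small].
have stable u : finset.cover (layers u K) = finset.cover (layers u.+1 K) ->
    forall r, finset.cover (layers (u + r) K) = finset.cover (layers u K).
  move=> uE; elim=> [|r IH]; first by rewrite addn0.
  rewrite addnS [RHS]uE; congr finset.cover; apply/setP => B.
  by rewrite !layersS// IH.
have grow u : (u < t)%N -> (u <= #|finset.cover (layers u K)|)%N.
  elim: u => [//|u IH] ut; apply: leq_ltn_trans (IH (ltnW ut)) _.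
  apply: proper_card; rewrite finset.properEneq cover_mono// andbT.
  apply/eqP => uE; have := stable u uE (t - u)%N; rewrite subnKC ?(ltnW (ltnW ut))// => tE.
  by have := small u.+1; rewrite /= ut -uE -tE => /(_ isT); rewrite ltnNge tN.
case: t t1 tN small grow stable => [//|[|t]] _ tN small grow _.
  exact: Nm0.
have := small t.+1; rewrite ltnSn /= => /(_ isT).
by apply: leq_ltn_trans; exact: grow.
Qed.

Lemma layers_dist K t K' (u w : E) : K \in elts M -> K' \in layers t K ->
  hull (@pos R d M) K u -> hull (@pos R d M) K' w ->
  forall i, `|u 0 i - w 0 i| <= (t + 1)%:R * H.
Proof.
move=> KM; elim: t K' w => [|t IH] K' w.
  rewrite /= inE => /eqP -> Ku Kw i; rewrite mul1r.
  exact: (elt_coord_le KM).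
move=> /= /bigcupP[B BL]; rewrite inE => /andP[K'M /asboolP[c [Bc K'c]]] Ku K'w i.
have h1 := IH B c BL Ku Bc i; have h2 := elt_coord_le K'M K'c K'w i.
have -> : u 0 i - w 0 i = (u 0 i - c 0 i) + (c 0 i - w 0 i) by ring.
apply: le_trans (ler_normD _ _) _; rewrite addSn -natr1 mulrDl mul1r.
exact: lerD.
Qed.

Lemma patch_sub Nm K t S : K \in elts M -> (1 <= t)%N -> is_patch Nm K t S ->
  K \in S /\ S \subset layers t K.
Proof.
move=> KM t1 [s [sp _ [n [-> _ _]]]]; split.
  by rewrite inE mem_layers.
apply/fintype.subsetP => B; rewrite inE => /orP[BL|].
  by rewrite -(prednK t1); apply: fintype.subsetP BL; exact: layers_mono.
rewrite inE => /mem_take; rewrite (perm_mem sp) mem_enum inE.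
by move=> /andP[].
Qed.

End patches.

Section reconstruction_facts.
Context {R : realType} {d : nat}.
Local Notation E := 'rV[R]_d.
Variables (M : mesh R d) (m : nat) (patch : {set node M} -> {set {set node M}}).
Local Notation N := (node M).
Local Notation I K := (finset.cover (patch K)).
Implicit Types (K : {set N}) (v p q : E -> R).

Lemma rowBE n (u w : 'rV[R]_n) j : (u - w) 0 j = u 0 j - w 0 j.
Proof. by rewrite !mxE. Qed.

(** Subtracting [l] turns the constraints into linear homogeneous ones; what remains is
    an unconstrained least-squares problem on the kernel of the evaluation at the
    vertices of [K]. *)
Lemma local_reconstructionP v K (l : E -> R) : admissible m v K l -> K \subset I K ->
  admissible m v K (local_reconstruction m patch v K) /\
  residual patch v K (local_reconstruction m patch v K) <= residual patch v K l.
Proof.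
move=> [lP lv] KI.
suff ex : exists p, admissible m v K p /\
    forall q, admissible m v K q -> residual patch v K p <= residual patch v K q.
  by have [h1 h2] := getPex ex; split=> //; apply: h2.
(* The rows of [ker] span the coefficients of the polynomials that vanish at the
   vertices of [K]. *)
pose ker := kermx (eval_mx m (@pos R d M) K).
pose A := ker *m eval_mx m (@pos R d M) (I K).
pose b : 'rV[R]_#|N| := \row_j
  (if enum_val j \in I K then v (pos (enum_val j)) - l (pos (enum_val j)) else 0).
have resE w : residual patch v K (fun x => l x + coeff_poly (w *m ker) x) =
    \sum_j ((b - w *m A) 0 j) ^+ 2.
  rewrite /residual big_mkcond/= (reindex _ (onW_bij _ (@enum_val_bij N)))/=.
  apply: eq_bigr => j _; rewrite rowBE.
  have -> : w *m A = w *m ker *m eval_mx m (@pos R d M) (I K) by exact: mulmxA.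
  rewrite mul_eval_mx mxE.
  case: ifP => jI; last by rewrite subrr expr0n.
  by rewrite real_normK ?num_real// -[RHS]sqrrN; congr (_ ^+ 2); ring.
have [u uP] := least_squares A b.
have ker0 w y : y \in K -> coeff_poly (w *m ker) (pos y) = 0.
  move=> yK; have := mul_eval_mx (@pos R d M) K (w *m ker) (enum_rank y).
  by rewrite enum_rankK yK -mulmxA mulmx_ker mulmx0 mxE.
exists (fun x => l x + coeff_poly (u *m ker) x); split.
  split=> [|y yK]; last by rewrite ker0// addr0 lv.
  have := poly_fun_lin 1 lP (coeff_poly_fun (u *m ker)).
  by under eq_fun do rewrite mul1r.
move=> q [qP qv].
have [c cE] := poly_fun_coeff (poly_fun_lin (-1) qP lP).
have /sub_kermxP/submxP[w wE] : c *m eval_mx m (@pos R d M) K = 0.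
  apply/rowP => j; rewrite mul_eval_mx mxE; case: ifP => // jK.
  by rewrite -cE qv// lv// mulN1r subrr.
have -> : q = fun x => l x + coeff_poly (w *m ker) x.
  by apply/funext => x; rewrite -wE -cE mulN1r addrC subrK.
by rewrite !resE.
Qed.

(** Since [l] competes in the least-squares problem, the residuals of the
    reconstruction and of [l] are both at most that of [l]; [q] is their difference. *)
Lemma local_reconstruction_sub v K (l : E -> R) (q := fun x =>
    local_reconstruction m patch v K x - l x) : admissible m v K l -> K \subset I K ->
  poly_fun m q /\
  \sum_(x in I K) q (pos x) ^+ 2 <= 4 * \sum_(x in I K) (l (pos x) - v (pos x)) ^+ 2.
Proof.
move=> lA KI; have [[rP _] rle] := local_reconstructionP lA KI.
split.
  have := poly_fun_lin (-1) rP (proj1 lA); rewrite /q.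
  by under eq_fun do rewrite mulN1r.
have E p : residual patch v K p = \sum_(x in I K) (p (pos x) - v (pos x)) ^+ 2.
  by apply: eq_bigr => x _; rewrite real_normK ?num_real.
rewrite !E in rle.
set r := local_reconstruction m patch v K in q rle *.
apply: le_trans (_ : 2 * (\sum_(x in I K) (r (pos x) - v (pos x)) ^+ 2 +
    \sum_(x in I K) (l (pos x) - v (pos x)) ^+ 2) <= _); last by lra.
rewrite -big_split/= mulr_sumr; apply: ler_sum => x _; rewrite /q.
rewrite -subr_ge0.
have -> : 2 * ((r (pos x) - v (pos x)) ^+ 2 + (l (pos x) - v (pos x)) ^+ 2) -
  (r (pos x) - l (pos x)) ^+ 2 = (r (pos x) + l (pos x) - 2 * v (pos x)) ^+ 2 by ring.
exact: sqr_ge0.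
Qed.

(** On [D(K)] a polynomial is determined by its nodal values, and depends linearly on
    them. *)
Lemma unisolvent_bound K a s : unisolvent m patch -> K \in elts M ->
  exists2 B : R, 0 <= B & forall p, poly_fun m p ->
    forall x, patch_domain (patch K) x -> box a s x ->
      p x ^+ 2 <= B * \sum_(y in I K) p (pos y) ^+ 2.
Proof.
move=> uni KM.
pose A := eval_mx m (@pos R d M) (I K).
have /choice[B0 B0P] : forall j : 'I_#|N|, exists B, 0 <= B /\ forall x, box a s x ->
    `|coeff_poly (row j (pinvmx A)) x| <= B.
  move=> j; have [B B0 BP] := poly_bounded_box a s (coeff_poly_fun (row j (pinvmx A))).
  by exists B.
pose B := \sum_j B0 j; have Bge j : B0 j <= B.
  by rewrite /B (bigD1 j)//= lerDl sumr_ge0// => k _; have [] := B0P k.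
have B_ge0 : 0 <= B by apply: sumr_ge0 => j _; have [] := B0P j.
exists (B ^+ 2 * #|N|%:R ^+ 2); first by rewrite mulr_ge0 ?sqr_ge0.
move=> p pP x Dx xa; have [c cE] := poly_fun_coeff pP.
pose val : 'rV[R]_#|N| := c *m A.
have valE j : val 0 j = if enum_val j \in I K then p (pos (enum_val j)) else 0.
  by rewrite /val mul_eval_mx -cE.
(* The pseudo-inverse yields a polynomial with the same nodal values, whose
   coefficients depend linearly on them. *)
have same : p x = coeff_poly (val *m pinvmx A) x.
  apply/eqP; rewrite -subr_eq0; apply/eqP.
  have := poly_fun_lin (-1) pP (coeff_poly_fun (val *m pinvmx A)).
  move=> /(uni K KM)/(_ _ x Dx); rewrite mulN1r; apply => y yI.
  have := mul_eval_mx (@pos R d M) (I K) (val *m pinvmx A) (enum_rank y).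
  rewrite enum_rankK yI => <-; rewrite mulN1r mulmxKpV ?submxMl//.
  by rewrite valE enum_rankK yI subrr.
have sumE : coeff_poly (val *m pinvmx A) x = \sum_j val 0 j * coeff_poly (row j (pinvmx A)) x.
  rewrite /coeff_poly; under [RHS]eq_bigr do rewrite mulr_sumr.
  rewrite exchange_big/=; apply: eq_bigr => k _; case: ifP => hk; last first.
    by rewrite big1// => j _; rewrite mulr0.
  rewrite [X in X * _]mxE mulr_suml; apply: eq_bigr => j _.
  by rewrite [row _ _ _ _]mxE mulrA.
have le1 : `|p x| <= B * \sum_j `|val 0 j|.
  rewrite same sumE; apply: le_trans (ler_norm_sum _ _ _) _.
  rewrite mulr_sumr; apply: ler_sum => j _; rewrite normrM mulrC ler_wpM2r//.
  by apply: le_trans (Bge j); have [_] := B0P j; exact.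
rewrite -[p x ^+ 2]real_normK ?num_real//.
apply: le_trans (_ : (B * \sum_j `|val 0 j|) ^+ 2 <= _).
  by rewrite lerXn2r ?nnegrE ?mulr_ge0// sumr_ge0.
rewrite exprMn -[X in _ <= X]mulrA ler_wpM2l ?sqr_ge0//.
have -> : \sum_(y in I K) p (pos y) ^+ 2 = \sum_j val 0 j ^+ 2.
  rewrite big_mkcond/= (reindex _ (onW_bij _ (@enum_val_bij N)))/=.
  apply: eq_bigr => j _; rewrite valE.
  by case: ifP; rewrite // expr0n.
have T0 : 0 <= \sum_j val 0 j ^+ 2 by apply: sumr_ge0 => j _; exact: sqr_ge0.
rewrite -[X in _ * X]sqr_sqrtr// -exprMn lerXn2r ?nnegrE ?sumr_ge0 ?mulr_ge0 ?sqrtr_ge0//.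
rewrite mulr_natl -[X in _ *+ X](card_ord #|N|) -sumr_const; apply: ler_sum => j _.
rewrite -sqrtr_sqr ler_sqrt// (bigD1 j)//= lerDl.
by apply: sumr_ge0 => k _; exact: sqr_ge0.
Qed.

End reconstruction_facts.

(** * Nodal errors on a patch *)

Section energy.
Context {R : realType} {d : nat} (d1 : (1 < d)%N).
Local Notation E := 'rV[R]_d.
Variables (Omega : set E) (hOmega : convex_polytope Omega) (M : mesh R d).
Hypothesis tri : triangulation M Omega.
Variable Cnu : R.
Hypothesis qu : meshsize M <= Cnu * rho M.
Variables (m Nm : nat) (Nm0 : (0 < Nm)%N).
Variables (depth : {set node M} -> nat) (patch : {set node M} -> {set {set node M}}).
Hypothesis patchP : forall K, K \in elts M ->
  is_depth Nm K (depth K) /\ is_patch Nm K (depth K) (patch K).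
Hypothesis uni : unisolvent m patch.
Variables (v : E -> R) (a : {set node M} -> R) (G : {set node M} -> E).
Hypothesis vE : forall K, K \in elts M -> forall w, hull (@pos R d M) K w ->
  v w = a K + dotp (G K) w.
Local Notation N := (node M).
Local Notation H := (meshsize M).
Local Notation I K := (finset.cover (patch K)).
Local Notation s := (shape (d:=d) Cnu).
Local Notation Lam := (Lambda m patch depth).
Implicit Types (K e : {set N}) (w : E) (x : N).

(** The depth of a patch is at most [Nm], hence a patch lies within this many mesh
    sizes of its central element. *)
Let k : R := Nm.+1%:R.
Let NB : R := (near_bound (d:=d) Cnu k)%:R.

Let H0 : 0 < H. Proof. exact: (meshsize_gt0 d1 hOmega tri). Qed.
Let s0 : 0 < s. Proof. exact: (shape_gt0 d1 Cnu). Qed.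
Let k1 : 1 <= k. Proof. by rewrite ler1n. Qed.

Lemma elt_diam_gt0 K : K \in elts M -> 0 < h_ K.
Proof.
move=> KM.
have /card_gt1P[x [y [xK yK xy]]] : (1 < #|K|)%N by rewrite (elt_card tri)// ltnS ltnW.
have := eucl_le_diam (hull_vertex (@pos R d M) xK) (hull_vertex (@pos R d M) yK).
apply: lt_le_trans; apply: lt_le_trans (vertex_dist d1 hOmega tri qu KM xK yK xy).
by rewrite divr_gt0 ?mulr_gt0// ltr0n ltnW.
Qed.

Lemma mem_patch K : K \in elts M -> K \in patch K.
Proof.
move=> KM; have [[t1 _ _] pK] := patchP KM.
by have [] := patch_sub tri KM t1 pK.
Qed.

Lemma sub_patch_nodes K : K \in elts M -> K \subset I K.
Proof.
move=> KM; apply/fintype.subsetP => x xK; apply/bigcupP; exists K => //.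
exact: mem_patch.
Qed.

Lemma patch_near K B : K \in elts M -> B \in patch K ->
  [/\ B \in elts M, B \in nearby k K & forall u y : E, hull (@pos R d M) B u ->
     hull (@pos R d M) K y -> forall i, `|u 0 i - y 0 i| <= k * H].
Proof.
move=> KM BK; have [dK pK] := patchP KM; have [t1 _ _] := dK.
have tN := depth_le tri Nm0 KM dK.
have [_ /fintype.subsetP/(_ B BK) BL] := patch_sub tri KM t1 pK.
have BM := layers_elts KM BL.
have dist (u y : E) : hull (@pos R d M) B u -> hull (@pos R d M) K y ->
    forall i, `|u 0 i - y 0 i| <= k * H.
  move=> Bu Ky i; rewrite distrC; apply: le_trans (layers_dist KM BL Ky Bu i) _.
  by rewrite ler_wpM2r ?(ltW H0)// /k ler_nat addn1 ltnS.
split=> //; apply/nearbyP; split=> //.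
have [x xB] : exists x, x \in B.
  by apply/set0Pn; rewrite -card_gt0 (elt_card tri BM).
have [z zK] : exists z, z \in K.
  by apply/set0Pn; rewrite -card_gt0 (elt_card tri KM).
exists (pos z), (pos x); split; [exact: hull_vertex..|] => i.
by rewrite distrC; apply: dist; exact: hull_vertex.
Qed.

Lemma card_patch_nodes K : K \in elts M -> #|I K|%:R <= NB * d.+1%:R.
Proof.
move=> KM; rewrite /NB -natrM ler_nat.
apply: leq_trans (leq_card_cover _) _.
apply: leq_trans (_ : (\sum_(B in nearby k K) d.+1 <= _)%N); last first.
  rewrite sum_nat_const leq_mul2r; apply/orP; right.
  exact: (card_nearby d1 hOmega tri qu (le_trans ler01 k1) KM).
rewrite [leqRHS](bigID (mem (patch K)))/= -[leqLHS]addn0 leq_add//.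
apply: eq_leq; apply: eq_big => [B|B BK]; last first.
  by have [BM _ _] := patch_near KM BK; rewrite (elt_card tri BM).
by apply/idP/idP => [BK|/andP[]//]; rewrite BK andbT; have [] := patch_near KM BK.
Qed.

(** A face is counted once for every nearby element that contains it; these are
    boundedly many, see [sum_near_jumps]. *)
Definition near_jumps K : R := \sum_(B in nearby k K)
  \sum_(e in faces M | e \subset B) grad_jump G e ^+ 2.

Lemma near_jumps_ge0 K : 0 <= near_jumps K.
Proof. by apply: sumr_ge0 => B _; apply: sumr_ge0 => e _; exact: sqr_ge0. Qed.

(** A bounded number of nodes, and at each of them the bound of [extension_error]. *)
Lemma extension_sum K : K \in elts M ->
  \sum_(x in I K) (a K + dotp (G K) (pos x) - v (pos x)) ^+ 2 <=
  NB * d.+1%:R * (NB * (d%:R * ((2 * k + 3) * H))) ^+ 2 * near_jumps K.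
Proof.
move=> KM; pose X := (NB * (d%:R * ((2 * k + 3) * H))) ^+ 2; rewrite -/X.
have X0 : 0 <= X by exact: sqr_ge0.
apply: le_trans (_ : \sum_(x in I K) X * near_jumps K <= _); last first.
  rewrite sumr_const -[_ *+ #|_|]mulr_natl -mulrA ler_wpM2r//.
    by rewrite mulr_ge0// near_jumps_ge0.
  exact: card_patch_nodes.
apply: ler_sum => x /bigcupP[B BK xB].
have [BM _ dist] := patch_near KM BK.
pose J := Num.sqrt (near_jumps K).
have J0 : 0 <= J by exact: sqrtr_ge0.
have Jle e K' : e \in faces M -> e \subset K' -> K' \in nearby k K ->
    `|grad_jump G e| <= J.
  move=> eF eK' K'n; rewrite -sqrtr_sqr ler_sqrt ?near_jumps_ge0//.
  rewrite /near_jumps (bigD1 K')//= (bigD1 e) ?eF//= -addrA lerDl addr_ge0//.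
    by apply: sumr_ge0 => e' _; exact: sqr_ge0.
  by apply: sumr_ge0 => B' _; apply: sumr_ge0 => e' _; exact: sqr_ge0.
have := extension_error d1 hOmega tri qu vE k1 BM KM dist xB J0 Jle.
rewrite -/NB => h; rewrite -[leLHS]real_normK ?num_real//.
have -> : X * near_jumps K = (NB * (J * (d%:R * ((2 * k + 3) * H)))) ^+ 2.
  by rewrite /X -[near_jumps K]sqr_sqrtr ?near_jumps_ge0// -/J; ring.
by rewrite lerXn2r ?nnegrE ?normr_ge0// (le_trans _ h).
Qed.

Lemma cell_sub_patch_domain K : K \in elts M ->
  cell K `<=` patch_domain (patch K).
Proof.
move=> KM; apply: interiorS => w Kw; exists K => //; exact: mem_patch.
Qed.

(** Unisolvence bounds the quotients in the definition of [LambdaK], so that their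
    supremum is indeed an upper bound. *)
Lemma LambdaK_bound K q : K \in elts M -> poly_fun m q ->
  \int[lebesgue d]_(w in cell K) (q w ^+ 2) <=
  LambdaK m patch K ^+ 2 * (h_ K ^+ d * \sum_(x in I K) q (pos x) ^+ 2).
Proof.
move=> KM qP; have h0 := elt_diam_gt0 KM.
have S0 p : 0 <= \sum_(x in I K) p (pos x) ^+ 2 :> R.
  by apply: sumr_ge0 => x _; exact: sqr_ge0.
have [r r0 Kr] := hull_bounded (@pos R d M) K.
have cr : cell K `<=` box 0 r by apply: subset_trans Kr; exact: interior_subset.
have [B B0 BP] := unisolvent_bound 0 r uni KM.
have int_le p : poly_fun m p -> \int[lebesgue d]_(w in cell K) (p w ^+ 2) <=
    B * (\sum_(x in I K) p (pos x) ^+ 2) * (2 * r) ^+ d.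
  move=> pP; apply: (Rintegral_le_box (a := 0)) => //; first exact: mulr_ge0.
  move=> w Kw; rewrite sqr_ge0/= BP//; [exact: cell_sub_patch_domain|exact: cr].
have [[y Dy qy]|q0] := pselect (exists2 y, patch_domain (patch K) y & q y != 0);
    last first.
  rewrite (@eq_Rintegral _ _ _ _ _ (fun=> 0)); last first.
    move=> w; rewrite inE => Kw; rewrite (_ : q w = 0) ?expr0n//.
    apply/eqP/negPn/negP => qw; apply: q0; exists w => //.
    exact: cell_sub_patch_domain.
  rewrite /Rintegral integral0/= mulr_ge0 ?sqr_ge0// mulr_ge0// exprn_ge0//.
  exact: ltW.
have Sq : 0 < \sum_(x in I K) q (pos x) ^+ 2.
  rewrite lt_neqAle S0 andbT eq_sym; apply: contraNneq qy => Sq0.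
  apply/eqP; apply: (uni KM qP) => // x xI; apply/eqP; rewrite -sqrf_eq0.
  by rewrite (psumr_eq0P (fun z _ => sqr_ge0 (q (pos z))) Sq0).
rewrite /LambdaK; set S := [set _ | _].
have ubS : has_ubound S.
  exists (B * (2 * r) ^+ d / h_ K ^+ d) => _ [p [pP _ ->]].
  have [->|Sp] := eqVneq (\sum_(x in I K) p (pos x) ^+ 2) 0.
    by rewrite mulr0 invr0 mulr0 divr_ge0 ?mulr_ge0 ?exprn_ge0 ?(ltW h0)// mulr_ge0.
  have {}Sp : 0 < \sum_(x in I K) p (pos x) ^+ 2 by rewrite lt_neqAle eq_sym Sp S0.
  rewrite ler_pdivrMr ?mulr_gt0 ?exprn_gt0//.
  apply: le_trans (int_le p pP) _; rewrite le_eqVlt; apply/orP; left; apply/eqP.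
  by field; rewrite expf_neq0 ?gt_eqF.
have Sr : S ((\int[lebesgue d]_(w in cell K) (q w ^+ 2)) /
    (h_ K ^+ d * \sum_(x in I K) q (pos x) ^+ 2)).
  by exists q; split=> //; exists y.
have := ub_le_sup ubS Sr.
rewrite ler_pdivrMr ?mulr_gt0 ?exprn_gt0// => h.
rewrite sqr_sqrtr//; apply: le_trans (ub_le_sup ubS Sr).
rewrite divr_ge0//; first by apply: Rintegral_ge0 => w _; exact: sqr_ge0.
by rewrite mulr_ge0// exprn_ge0// ltW.
Qed.

(** The depth and the number of nodes of a patch are at least 1. *)
Lemma Lambda_ge K : K \in elts M -> 1 <= Lam /\ LambdaK m patch K <= Lam.
Proof.
move=> KM; have [[t1 _ _] _] := patchP KM.
have L0 : 0 <= LambdaK m patch K by exact: sqrtr_ge0.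
have := (@le_sup_finType _ _ (mem (elts M)) (fun K =>
  1 + LambdaK m patch K * (depth K)%:R * Num.sqrt #|I K|%:R) K KM).
rewrite -/(Lambda _ _ _) => h.
have I1 : 1 <= Num.sqrt #|I K|%:R :> R.
  rewrite -[leLHS]sqrtr1 ler_sqrt// ler1n card_gt0.
  have [x xK] : exists x, x \in K by apply/set0Pn; rewrite -card_gt0 (elt_card tri KM).
  by apply/set0Pn; exists x; exact: fintype.subsetP (sub_patch_nodes KM) x xK.
have LI : LambdaK m patch K <= LambdaK m patch K * (depth K)%:R * Num.sqrt #|I K|%:R.
  by rewrite -mulrA ler_peMr// mulr_ege1// ler1n.
by split; lra.
Qed.

End energy.

(** * Stability of the reconstruction *)

Section stability.
Context {R : realType} {d : nat} (d1 : (1 < d)%N).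
Local Notation E := 'rV[R]_d.
Variables (Omega : set E) (hOmega : convex_polytope Omega) (M : mesh R d).
Hypothesis tri : triangulation M Omega.
Variable Cnu : R.
Hypothesis qu : meshsize M <= Cnu * rho M.
Variables (m Nm : nat) (m1 : (1 <= m)%N) (Nm0 : (0 < Nm)%N).
Variables (depth : {set node M} -> nat) (patch : {set node M} -> {set {set node M}}).
Hypothesis patchP : forall K, K \in elts M ->
  is_depth Nm K (depth K) /\ is_patch Nm K (depth K) (patch K).
Hypothesis uni : unisolvent m patch.
Variables (v : E -> R) (a : {set node M} -> R) (G : {set node M} -> E).
Hypothesis vE : forall K, K \in elts M -> forall w, hull (@pos R d M) K w ->
  v w = a K + dotp (G K) w.
Local Notation N := (node M).
Local Notation H := (meshsize M).
Local Notation I K := (finset.cover (patch K)).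
Local Notation s := (shape (d:=d) Cnu).
Local Notation Lam := (Lambda m patch depth).
Local Notation vol := (ref_volume (R:=R) (d:=d)).
Local Notation NB := ((near_bound (d:=d) Cnu (Nm.+1%:R : R))%:R : R).
Implicit Types (K e : {set N}) (w : E) (x : N).

Let H0 : 0 < H. Proof. exact: (meshsize_gt0 d1 hOmega tri). Qed.
Let s0 : 0 < s. Proof. exact: (shape_gt0 d1 Cnu). Qed.

(** The affine function that extends [v] from the element [K] to the whole space. *)
Definition extension K w := a K + dotp (G K) w.

Definition correction K w := local_reconstruction m patch v K w - extension K w.

Local Notation r := (local_reconstruction m patch v).
Local Notation L := extension.
Local Notation q := correction.

Lemma partial_affine (b : R) (g : E) i w :
  derivable (fun w => b + dotp g w) w (delta_mx 0 i) /\
  partial i (fun w => b + dotp g w) w = g 0 i.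
Proof.
have [h|h1 h2] := @derive_line R d (fun w => b + dotp g w) w (delta_mx 0 i)
    (g 0 i *: 'X + (b + dotp g w)%:P).
  rewrite dotpDr dotpZr dotp_delta hornerD hornerZ hornerX hornerC; ring.
split=> //; rewrite /partial h2 derivD derivZ derivX derivC addr0.
by rewrite hornerZ hornerC mulr1.
Qed.

Lemma extension_admissible K : K \in elts M -> admissible m v K (L K).
Proof.
move=> KM; split; first exact: poly_fun_affine.
by move=> y yK; rewrite (vE KM)//; exact: hull_vertex.
Qed.

Lemma correction_poly K : K \in elts M -> poly_fun m (q K) /\ poly_fun m (r K).
Proof.
move=> KM; have KI := sub_patch_nodes tri patchP KM.
have [h _] := local_reconstruction_sub (extension_admissible KM) KI.
by have [[h' _] _] := local_reconstructionP (extension_admissible KM) KI.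
Qed.

Lemma reconstruction_cell K w : K \in elts M -> cell K w ->
  reconstruction m patch v w = r K w.
Proof.
move=> KM Kw; rewrite /reconstruction; case: pickP => [K'|/(_ K)]; last first.
  by rewrite KM/= mem_set.
move=> /andP[K'M]; rewrite inE => K'w.
by rewrite (cell_hull_eq tri KM K'M Kw (interior_subset K'w)).
Qed.

Lemma gradient_split K w : K \in elts M -> gradient (r K) w = G K + gradient (q K) w.
Proof.
move=> KM; have [qP rP] := correction_poly KM; apply/rowP => i; rewrite !mxE.
have [dl pl] := partial_affine (a K) (G K) i w.
have -> : r K = q K \+ (fun w => a K + dotp (G K) w).
  by apply/funext => y /=; rewrite /correction /extension subrK.
rewrite /partial deriveD//; last exact: poly_derivable qP.
by rewrite -/(partial _ _ _) -/(partial _ (fun w => a K + dotp (G K) w) _) pl addrC.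
Qed.

Lemma laplacian_split K w : K \in elts M -> laplacian (r K) w = laplacian (q K) w.
Proof.
move=> KM; have [qP rP] := correction_poly KM; apply: eq_bigr => i _.
have -> : partial i (r K) = partial i (q K) \+ cst (G K 0 i).
  apply/funext => y /=; have := gradient_split y KM => /rowP/(_ i).
  by rewrite !mxE addrC.
rewrite {1}/partial deriveD//; last exact: poly_partial_derivable qP.
by rewrite derive_cst addr0.
Qed.

Lemma jump_reconstruction e w : hull (@pos R d M) e w ->
  jump e (reconstruction m patch v) w = jump_of e L w + jump_of e q w.
Proof.
move=> ew; rewrite (jump_eq d1 hOmega tri qu (F := r)) => //.
- rewrite -jump_ofD; congr (jump_of e _ w); apply/funext => K; apply/funext => y.
  by rewrite /correction addrC subrK.
- by move=> K KM; apply: (@poly_continuous _ _ m); have [] := correction_poly KM.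
- by move=> K KM y; exact: reconstruction_cell.
Qed.

Lemma jump_piecewise e w : hull (@pos R d M) e w -> jump e v w = jump_of e L w.
Proof.
move=> ew; rewrite (jump_eq d1 hOmega tri qu (F := L)) => //.
- by move=> K KM; exact: continuous_affine.
- by move=> K KM y Ky; rewrite (vE KM)//; exact: interior_subset.
Qed.

Lemma normal_derivative_poly e (p : E -> R) : poly_fun m p ->
  continuous (normal_derivative e p).
Proof.
move=> pP; apply: continuous_sum_fun => i; apply: continuous_mul_fun.
  exact: cst_continuous.
rewrite (_ : (fun w => gradient p w 0 i) = partial i p); last first.
  by apply/funext => w; rewrite mxE.
exact: poly_partial_continuous pP.
Qed.

Lemma jump_normal_reconstruction e w : hull (@pos R d M) e w ->
  jump e (normal_derivative e (reconstruction m patch v)) w =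
  grad_jump G e + jump_of e (fun K => normal_derivative e (q K)) w.
Proof.
move=> ew.
rewrite (jump_eq d1 hOmega tri qu (F := fun K => normal_derivative e (r K))) => //.
- rewrite (_ : grad_jump G e = jump_of e (fun K _ => dotp (face_normal e) (G K)) w) //.
  rewrite -jump_ofD /jump_of.
  have nE K : K \in sides e -> normal_derivative e (r K) w =
      dotp (face_normal e) (G K) + normal_derivative e (q K) w.
    rewrite mem_sides => /andP[KM _].
    by rewrite /normal_derivative gradient_split// dotpDr.
  case: (sides e) nE => [//|A [|B S]] nE; first by rewrite nE ?mem_head.
  by rewrite !nE ?mem_head// !inE eqxx orbT.
- move=> K KM; apply: normal_derivative_poly; exact: (correction_poly KM).2.
- move=> K KM y Ky; apply: (normal_derivative_eq _ (F := r)) => //.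
  by move=> K' K'M z; exact: reconstruction_cell.
Qed.

Lemma jump_normal_piecewise e w : hull (@pos R d M) e w ->
  jump e (normal_derivative e v) w = grad_jump G e.
Proof.
move=> ew; rewrite (jump_eq d1 hOmega tri qu
  (F := fun K _ => dotp (face_normal e) (G K))) => //.
  by move=> K KM; exact: cst_continuous.
move=> K KM y Ky; rewrite (normal_derivative_eq _ (F := L) _ KM Ky); last first.
  by move=> K' K'M z K'z; rewrite (vE K'M)//; exact: interior_subset.
rewrite /normal_derivative; congr dotp; apply/rowP => i; rewrite mxE.
by have [] := partial_affine (a K) (G K) i y.
Qed.

Lemma jump_of_affine e : exists (b : R) (g : E), forall w, jump_of e L w = b + dotp g w.
Proof.
rewrite /jump_of; case: (sides e) => [|A [|B S]].
- by exists 0, 0 => w; rewrite dotp0l addr0.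
- by exists (a A), (G A).
- by exists (a A - a B), (G A - G B) => w; rewrite dotpBl /extension; ring.
Qed.

Lemma jump_of_sqr e (F : {set N} -> E -> R) (B : {set N} -> R) w :
  (forall K, K \in elts M -> e \subset K -> `|F K w| <= B K) ->
  jump_of e F w ^+ 2 <= 2 * \sum_(K in elts M | e \subset K) B K ^+ 2.
Proof.
move=> FB.
have {}FB K : K \in sides e -> F K w ^+ 2 <= B K ^+ 2.
  rewrite mem_sides => /andP[KM eK]; rewrite -[leLHS]real_normK ?num_real//.
  have h := FB K KM eK.
  by rewrite lerXn2r ?nnegrE// (le_trans _ h).
have -> : \sum_(K in elts M | e \subset K) B K ^+ 2 = \sum_(K <- sides e) B K ^+ 2.
  by rewrite /sides big_enum/=; apply: eq_bigl => K; rewrite inE.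
have ge0 (S : seq {set N}) : 0 <= \sum_(K <- S) B K ^+ 2.
  by apply: sumr_ge0 => K _; exact: sqr_ge0.
rewrite /jump_of; case: (sides e) FB => [|A [|C S]] FB.
- by rewrite big_nil mulr0 expr0n.
- have := FB A (mem_head _ _); have := sqr_ge0 (B A); rewrite big_seq1; lra.
have hA := FB A (mem_head _ _); have hC : F C w ^+ 2 <= B C ^+ 2.
  by apply: FB; rewrite !inE eqxx orbT.
rewrite !big_cons; have := ge0 S.
have : (F A w - F C w) ^+ 2 <= 2 * (F A w ^+ 2 + F C w ^+ 2).
  rewrite -subr_ge0 (_ : _ - _ = (F A w + F C w) ^+ 2) ?sqr_ge0//; ring.
lra.
Qed.

Variable C0 : R.
Hypothesis C0_gt0 : 0 < C0.
(** The inverse estimates on the cubes of half side [s * H / 2] contained in the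
    elements; the cubes [1 + 2 / s] times larger contain the elements. *)
Hypothesis inverse : forall (p : E -> R) c t, poly_fun m p -> 0 < t ->
  exists B : R, [/\ 0 <= B, poly_bounds (1 + 2 / s) t B c p &
    forall (D : set E) a' s', box c t `<=` D -> D `<=` box a' s' -> 0 <= s' ->
      t ^+ d * B ^+ 2 <= C0 * \int[lebesgue d]_(x in D) (p x ^+ 2)].

Let t := s * H / 2.
Let t0 : 0 < t. Proof. by rewrite /t divr_gt0 ?mulr_gt0. Qed.

Definition local_const : R := C0 * (2 / s) ^+ d * 4 * (NB * d.+1%:R) *
  (NB * (d%:R * (2 * Nm.+1%:R + 3))) ^+ 2.

Lemma local_const_ge0 : 0 <= local_const.
Proof.
rewrite /local_const !mulr_ge0 ?sqr_ge0 ?exprn_ge0 ?divr_ge0//; exact: ltW.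
Qed.

(** The inverse estimates, the definition of [LambdaK], the least-squares property and
    [extension_sum] in a row; the powers of [H] other than the square cancel. *)
Lemma correction_bound K : K \in elts M -> exists B, [/\ 0 <= B,
  forall w, hull (@pos R d M) K w -> [/\ `|q K w| <= B,
     forall i, `|partial i (q K) w| <= B / t & `|laplacian (q K) w| <= B / t ^+ 2] &
  B ^+ 2 <= local_const * Lam ^+ 2 * H ^+ 2 * near_jumps Nm G K].
Proof.
move=> KM; have [qP rP] := correction_poly KM; have [c sub] := elt_box d1 hOmega tri qu KM.
have Kc : hull (@pos R d M) K c by apply/sub/box_center; rewrite mulr_ge0// ltW.
have [B [B0 Bb Bint]] := inverse c qP t0.
exists B; split=> //.
  move=> w Kw; apply: Bb => i.
  apply: le_trans (elt_coord_le KM Kw Kc i) _.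
  rewrite mulrDl mul1r (_ : 2 / s * t = H); first by rewrite lerDr ltW.
  by rewrite /t; field; rewrite gt_eqF.
have KI := sub_patch_nodes tri patchP KM.
have [_ qsum] := local_reconstruction_sub (extension_admissible KM) KI.
have ext := extension_sum d1 hOmega tri qu Nm0 patchP vE KM.
have Lb := LambdaK_bound d1 hOmega tri qu patchP uni KM qP.
have [Lam1 LK] := Lambda_ge tri m patchP KM.
have cellbox : cell K `<=` box c H.
  by move=> w /interior_subset Kw i; exact: (elt_coord_le KM).
have tcell : box c t `<=` cell K.
  move=> w wc; apply/interior_box; exists t => // y yw; apply: sub => i.
  have := wc i; have := yw i; have := ler_normD (y 0 i - w 0 i) (w 0 i - c 0 i).
  rewrite addrA subrK (_ : s * H = t + t); last by rewrite /t; field.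
  lra.
have := Bint _ _ _ tcell cellbox (ltW H0).
have S0 : 0 <= \sum_(x in I K) q K (pos x) ^+ 2.
  by apply: sumr_ge0 => x _; exact: sqr_ge0.
have hd : h_ K ^+ d <= H ^+ d.
  by rewrite lerXn2r ?nnegrE ?(ltW H0) ?elt_le_meshsize// (diam_ge0 Kc).
have LK2 : LambdaK m patch K ^+ 2 <= Lam ^+ 2.
  by rewrite lerXn2r ?nnegrE ?sqrtr_ge0//; lra.
move=> h; rewrite -(ler_pM2l (exprn_gt0 d t0)); apply: le_trans h _.
apply: le_trans (_ : C0 * (Lam ^+ 2 * (H ^+ d * (4 * (NB * d.+1%:R *
    (NB * (d%:R * ((2 * Nm.+1%:R + 3) * H))) ^+ 2 * near_jumps Nm G K)))) <= _).
  rewrite ler_wpM2l ?(ltW C0_gt0)//; apply: le_trans Lb _.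
  apply: ler_pM => //; rewrite ?sqr_ge0//.
    by rewrite mulr_ge0// exprn_ge0// (diam_ge0 Kc).
  apply: ler_pM => //; first by rewrite exprn_ge0// (diam_ge0 Kc).
  apply: le_trans qsum _; rewrite ler_wpM2l//; exact: ext.
rewrite le_eqVlt; apply/orP; left; apply/eqP.
rewrite /local_const /t !exprMn !exprVn; field.
by have := s0; rewrite /shape invr_gt0 => h; rewrite !gt_eqF ?exprn_gt0//.
Qed.

Lemma laplacian_integral K (B : R) : K \in elts M ->
  (forall w, hull (@pos R d M) K w -> `|laplacian (q K) w| <= B / t ^+ 2) ->
  \int[lebesgue d]_(w in cell K) (laplacian (reconstruction m patch v) w ^+ 2) <=
    (B / t ^+ 2) ^+ 2 * (2 * H) ^+ d.
Proof.
move=> KM qB; have [c sub] := elt_box d1 hOmega tri qu KM.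
have Kc : hull (@pos R d M) K c by apply/sub/box_center; rewrite mulr_ge0// ltW.
apply: (Rintegral_le_box (a := c)); [exact: ltW|exact: sqr_ge0| |].
  by move=> w /interior_subset Kw i; exact: (elt_coord_le KM).
move=> w Kw; rewrite sqr_ge0/=.
rewrite (laplacian_eq_on (@open_interior _ _) Kw (F := r K)); last first.
  by move=> y; exact: reconstruction_cell.
rewrite laplacian_split// -[leLHS]real_normK ?num_real//.
have h := qB w (interior_subset Kw).
by rewrite lerXn2r ?nnegrE// (le_trans _ h).
Qed.

Lemma sqr_sum_le (x y b : R) : y ^+ 2 <= b -> (x + y) ^+ 2 <= 2 * x ^+ 2 + 2 * b.
Proof.
move=> yb; rewrite -subr_ge0.
have -> : 2 * x ^+ 2 + 2 * b - (x + y) ^+ 2 = (x - y) ^+ 2 + 2 * (b - y ^+ 2) by ring.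
by rewrite addr_ge0 ?sqr_ge0// mulr_ge0// subr_ge0.
Qed.

Variable B : {set N} -> R.
Hypothesis B0 : forall K, K \in elts M -> 0 <= B K.
Hypothesis qB : forall K, K \in elts M ->
  forall w, hull (@pos R d M) K w -> [/\ `|q K w| <= B K,
     forall i, `|partial i (q K) w| <= B K / t & `|laplacian (q K) w| <= B K / t ^+ 2].

Let Q e := 2 * \sum_(K in elts M | e \subset K) B K ^+ 2.

Lemma Q_ge0 e : 0 <= Q e.
Proof. by rewrite mulr_ge0// sumr_ge0// => K _; exact: sqr_ge0. Qed.

Hypothesis hd : d = 2%N \/ d = 3%N.

Lemma face_area_le e : e \in faces M -> face_area e * vol <= H ^+ d.-1 * vol.
Proof.
move=> eF; have /andP[_ h] := face_area_bounds d1 hOmega tri qu hd eF.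
by rewrite ler_wpM2r// ltW// ref_volume_gt0.
Qed.

Lemma value_jump_integral e : e \in faces M ->
  face_integral e (fun w => jump e (reconstruction m patch v) w ^+ 2) <=
  2 * face_integral e (fun w => jump e v w ^+ 2) + 2 * Q e * (H ^+ d.-1 * vol).
Proof.
move=> eF; have [ce _] := faceP eF; have [b [g bg]] := jump_of_affine e.
rewrite [X in _ <= 2 * X + _](eq_face_integral d1 (g := fun w => (b + dotp g w) ^+ 2) ce);
  last by move=> w ew; rewrite jump_piecewise// bg.
apply: le_trans (face_integral_le d1 (a := b) (g := g) (k := 2) (c := 2 * Q e) ce _ _ _) _ => //.
- by rewrite mulr_ge0// Q_ge0.
- move=> w ew; rewrite sqr_ge0/= jump_reconstruction// bg; apply: sqr_sum_le.
  apply: jump_of_sqr => K KM eK.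
  by have [] := qB KM (hullS eK ew).
- by rewrite lerD2l ler_wpM2l ?face_area_le// mulr_ge0// Q_ge0.
Qed.

Lemma normal_jump_integral e : e \in faces M ->
  face_integral e (fun w =>
    jump e (normal_derivative e (reconstruction m patch v)) w ^+ 2) <=
  2 * face_integral e (fun w => jump e (normal_derivative e v) w ^+ 2) +
    2 * ((d%:R / t) ^+ 2 * Q e) * (H ^+ d.-1 * vol).
Proof.
move=> eF; have [ce _] := faceP eF; have [n1 _] := face_normalP d1 tri eF.
have c0 : 0 <= 2 * ((d%:R / t) ^+ 2 * Q e).
  by rewrite mulr_ge0// mulr_ge0 ?sqr_ge0 ?Q_ge0.
rewrite [X in _ <= 2 * X + _](eq_face_integral d1
  (g := fun w => (grad_jump G e + dotp 0 w) ^+ 2) ce); last first.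
  by move=> w ew; rewrite jump_normal_piecewise// dotp0l addr0.
apply: le_trans (face_integral_le d1 (a := grad_jump G e) (g := 0) (k := 2)
  (c := 2 * ((d%:R / t) ^+ 2 * Q e)) ce _ _ _) _ => //.
- move=> w ew; rewrite sqr_ge0/= jump_normal_reconstruction// dotp0l addr0.
  apply: sqr_sum_le.
  apply: le_trans (jump_of_sqr (B := fun K => d%:R * (1 * (B K / t))) _) _.
    move=> K KM eK; apply: normr_dotp => i; first by rewrite -n1 coord_le_eucl.
    by rewrite mxE; have [_ h _] := qB KM (hullS eK ew).
  rewrite le_eqVlt; apply/orP; left; apply/eqP.
  rewrite /Q mulrCA; congr (_ * _); rewrite mulr_sumr; apply: eq_bigr => K _.
  by field; rewrite gt_eqF.
- by rewrite lerD2l ler_wpM2l ?face_area_le.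
Qed.

Let gj2 := \sum_(e in faces M) grad_jump G e ^+ 2.

(** The elements that contain a given face are near each other. *)
Lemma sum_face_elts (F : {set N} -> R) : (forall e, 0 <= F e) ->
  \sum_(K in elts M) \sum_(e in faces M | e \subset K) F e <= NB * \sum_(e in faces M) F e.
Proof.
move=> F0; rewrite (exchange_big_dep (mem (faces M)))/=; last by move=> K e _ /andP[].
rewrite mulr_sumr; apply: ler_sum => e eF; rewrite sumr_const -[leLHS]mulr_natl.
rewrite ler_wpM2r// ler_nat.
have [ce [K0 K0M eK0]] := faceP eF.
apply: leq_trans (card_nearby d1 hOmega tri qu (k := Nm.+1%:R) (ler0n _ _) K0M).
apply: subset_leq_card; apply/fintype.subsetP => K /andP[KM /andP[_ eK]].
apply/nearbyP; split=> //.
have [x xe] : exists x, x \in e by apply/set0Pn; rewrite -card_gt0 ce ltnW.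
exists (pos x), (pos x); split.
- by apply: hull_vertex; exact: fintype.subsetP eK0 x xe.
- by apply: hull_vertex; exact: fintype.subsetP eK x xe.
- by move=> i; rewrite subrr normr0 mulr_ge0// ltW.
Qed.

(** Being nearby is symmetric, so that an element is near boundedly many others. *)
Lemma sum_near_jumps : \sum_(K in elts M) near_jumps Nm G K <= NB ^+ 2 * gj2.
Proof.
rewrite /near_jumps (exchange_big_dep (mem (elts M)))/=; last by move=> K K' _ /nearbyP[].
rewrite expr2 -mulrA; apply: le_trans (_ : NB *
    \sum_(K in elts M) \sum_(e in faces M | e \subset K) grad_jump G e ^+ 2 <= _).
  rewrite mulr_sumr; apply: ler_sum => K KM; rewrite sumr_const -[leLHS]mulr_natl.
  rewrite ler_wpM2r//; first by apply: sumr_ge0 => e _; exact: sqr_ge0.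
  rewrite ler_nat; apply: leq_trans (card_nearby d1 hOmega tri qu (ler0n _ _) KM).
  apply: subset_leq_card; apply/fintype.subsetP => K' /andP[K'M K'K].
  exact: nearby_sym.
by rewrite ler_wpM2l// sum_face_elts// => e; exact: sqr_ge0.
Qed.

(** An element has at most [2 ^ d.+1] faces. *)
Lemma sum_Q : \sum_(e in faces M) Q e <= 2 * 2 ^+ d.+1 * \sum_(K in elts M) B K ^+ 2.
Proof.
rewrite /Q -mulr_sumr -mulrA ler_wpM2l//.
rewrite (exchange_big_dep (mem (elts M)))/=; last by move=> e K _ /andP[].
rewrite mulr_sumr; apply: ler_sum => K KM; rewrite sumr_const -[leLHS]mulr_natl.
rewrite ler_wpM2r ?sqr_ge0// -natrX ler_nat -(elt_card tri KM) -card_powerset.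
apply: subset_leq_card; apply/fintype.subsetP => e /andP[_ /andP[_ eK]].
by rewrite powersetE.
Qed.

(** The gradient jump is constant along a face, whose measure is comparable to the
    (d-1)-st power of the mesh size. *)
Lemma grad_jump_le e : e \in faces M ->
  grad_jump G e ^+ 2 <= H / ((2 * s * H / d%:R) ^+ d.-1 * vol) *
    ((h_ e)^-1 * face_integral e (fun w => jump e (normal_derivative e v) w ^+ 2)).
Proof.
move=> eF; have [ce _] := faceP eF.
rewrite (eq_face_integral d1 (g := fun=> grad_jump G e ^+ 2) ce); last first.
  by move=> w ew; rewrite jump_normal_piecewise.
rewrite face_integral_cst; have /andP[lo _] := face_area_bounds d1 hOmega tri qu hd eF.
have V0 : 0 < vol by exact: ref_volume_gt0.
have d0 : 0 < d%:R :> R by rewrite ltr0n ltnW.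
have tau0 : 0 < 2 * s * H / d%:R by rewrite divr_gt0// !mulr_gt0.
have he0 : 0 < h_ e by apply: lt_le_trans (face_diam_ge d1 hOmega tri qu eF).
have hH : 1 <= H / h_ e by rewrite ler_pdivlMr// mul1r; exact: face_diam_le.
have lo' : 1 <= face_area e / (2 * s * H / d%:R) ^+ d.-1.
  by rewrite ler_pdivlMr ?exprn_gt0// mul1r.
have -> : H / ((2 * s * H / d%:R) ^+ d.-1 * vol) *
    ((h_ e)^-1 * (face_area e * (grad_jump G e ^+ 2 * vol))) =
  (H / h_ e) * (face_area e / (2 * s * H / d%:R) ^+ d.-1) * grad_jump G e ^+ 2.
  move: (_ ^+ d.-1) (exprn_gt0 d.-1 tau0) => T T0.
  by field; rewrite !gt_eqF.
by rewrite ler_peMl ?sqr_ge0// mulr_ege1.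
Qed.

Hypothesis BG : forall K, K \in elts M ->
  B K ^+ 2 <= local_const * Lam ^+ 2 * H ^+ 2 * near_jumps Nm G K.

Let energy (f : E -> R) : R :=
  \sum_(K in elts M) \int[lebesgue d]_(w in cell K) (laplacian f w ^+ 2)
  + \sum_(e in faces M) h_ e ^- 3 * face_integral e (fun w => jump e f w ^+ 2)
  + \sum_(e in faces M) (h_ e)^-1 *
      face_integral e (fun w => jump e (normal_derivative e f) w ^+ 2).

(** The factor of [H ^+ d / H ^+ 4] in the bound of the energy of the corrections
    by the sum of their squared sizes. *)
Definition inverse_const : R :=
  2 ^+ d * (2 / s) ^+ 4 + 2 ^+ d.+3 * vol *
    ((d%:R / (2 * s)) ^+ 3 + d%:R / (2 * s) * (2 * d%:R / s) ^+ 2).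

Definition energy_const : R := 2 + inverse_const * local_const * NB ^+ 2 *
  (d%:R / (2 * s)) ^+ d.-1 / vol.

Lemma inverse_const_ge0 : 0 <= inverse_const.
Proof.
have V0 : 0 < vol by exact: ref_volume_gt0.
have X1 : 0 <= 2 / s by rewrite divr_ge0// ltW.
have X2 : 0 <= d%:R / (2 * s) by rewrite divr_ge0// mulr_ge0// ltW.
rewrite /inverse_const addr_ge0//; first by rewrite mulr_ge0// exprn_ge0.
rewrite mulr_ge0//; first by rewrite mulr_ge0 ?exprn_ge0// ltW.
by rewrite addr_ge0 ?exprn_ge0// mulr_ge0// sqr_ge0.
Qed.

Lemma energy_const_gt0 : 0 < energy_const.
Proof.
have V0 : 0 < vol by exact: ref_volume_gt0.
have X0 : 0 <= d%:R / (2 * s) by rewrite divr_ge0// mulr_ge0// ltW.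
rewrite /energy_const ltr_pwDl// divr_ge0 ?(ltW V0)// mulr_ge0 ?exprn_ge0//.
rewrite mulr_ge0 ?sqr_ge0//.
by apply: mulr_ge0; [exact: inverse_const_ge0|exact: local_const_ge0].
Qed.

(** The factor 2 comes from [(x + y)^2 <= 2 x^2 + 2 y^2], applied to the jumps of [v]
    and of the corrections. *)
Lemma energy_le_corrections :
  energy (reconstruction m patch v) <= 2 * energy v +
    inverse_const * (H ^+ d / H ^+ 4) * \sum_(K in elts M) B K ^+ 2.
Proof.
have V0 : 0 < vol by exact: ref_volume_gt0.
have d0 : 0 < d%:R :> R by rewrite ltr0n ltnW.
set S := \sum_(K in elts M) B K ^+ 2.
set tau := 2 * s * H / d%:R.
have tau0 : 0 < tau by rewrite divr_gt0// !mulr_gt0.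
have S0 : 0 <= S by apply: sumr_ge0 => K _; exact: sqr_ge0.
have HP0 : 0 < H ^+ d.-1 by rewrite exprn_gt0.
have he e : e \in faces M -> 0 < h_ e /\ tau <= h_ e.
  move=> eF; have h := face_diam_ge d1 hOmega tri qu eF; split=> //.
  exact: lt_le_trans h.
pose S1 := \sum_(K in elts M) \int[lebesgue d]_(w in cell K) (laplacian v w ^+ 2).
pose S2 := \sum_(e in faces M) h_ e ^- 3 * face_integral e (fun w => jump e v w ^+ 2).
pose S3 := \sum_(e in faces M) (h_ e)^-1 *
  face_integral e (fun w => jump e (normal_derivative e v) w ^+ 2).
pose SQ := \sum_(e in faces M) Q e.
have EE : energy v = S1 + S2 + S3 by [].
have T1 : \sum_(K in elts M) \int[lebesgue d]_(w in cell K)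
    (laplacian (reconstruction m patch v) w ^+ 2) <=
    (2 * H) ^+ d / t ^+ 4 * S.
  rewrite mulr_sumr; apply: ler_sum => K KM.
  apply: le_trans (laplacian_integral (B := B K) KM _) _.
    by move=> w Kw; have [] := qB KM Kw.
  rewrite le_eqVlt; apply/orP; left; apply/eqP.
  by move: (_ ^+ d) => X; field; rewrite gt_eqF.
have QV e : 0 <= Q e * (H ^+ d.-1 * vol).
  by rewrite mulr_ge0 ?Q_ge0// mulr_ge0// ltW.
have T2 : \sum_(e in faces M) h_ e ^- 3 *
    face_integral e (fun w => jump e (reconstruction m patch v) w ^+ 2) <=
    2 * S2 + tau ^- 3 * 2 * (H ^+ d.-1 * vol) * SQ.
  rewrite /S2 /SQ !mulr_sumr -big_split/=; apply: ler_sum => e eF.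
  have [h1 h2] := he e eF.
  apply: le_trans (ler_wpM2l _ (value_jump_integral eF)) _.
    by rewrite invr_ge0 exprn_ge0// ltW.
  rewrite mulrDr mulrCA lerD2l.
  have -> : tau ^- 3 * 2 * (H ^+ d.-1 * vol) * Q e =
    tau ^- 3 * (2 * (Q e * (H ^+ d.-1 * vol))) by ring.
  rewrite -[2 * Q e * _]mulrA ler_wpM2r//; first by rewrite mulr_ge0.
  by rewrite lef_pV2 ?posrE ?exprn_gt0// lerXn2r// nnegrE ltW.
have T3 : \sum_(e in faces M) (h_ e)^-1 * face_integral e (fun w =>
      jump e (normal_derivative e (reconstruction m patch v)) w ^+ 2) <=
    2 * S3 + tau^-1 * 2 * (d%:R / t) ^+ 2 * (H ^+ d.-1 * vol) * SQ.
  rewrite /S3 /SQ !mulr_sumr -big_split/=; apply: ler_sum => e eF.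
  have [h1 h2] := he e eF.
  apply: le_trans (ler_wpM2l _ (normal_jump_integral eF)) _.
    by rewrite invr_ge0 ltW.
  rewrite mulrDr mulrCA lerD2l.
  have -> : tau^-1 * 2 * (d%:R / t) ^+ 2 * (H ^+ d.-1 * vol) * Q e =
    tau^-1 * ((d%:R / t) ^+ 2 * (2 * (Q e * (H ^+ d.-1 * vol)))) by ring.
  have -> : 2 * ((d%:R / t) ^+ 2 * Q e) * (H ^+ d.-1 * vol) =
    (d%:R / t) ^+ 2 * (2 * (Q e * (H ^+ d.-1 * vol))) by ring.
  rewrite ler_wpM2r//; first by rewrite mulr_ge0 ?sqr_ge0// mulr_ge0.
  by rewrite lef_pV2.
have S10 : 0 <= S1.
  by apply: sumr_ge0 => K _; apply: Rintegral_ge0 => w _; exact: sqr_ge0.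
apply: le_trans (lerD (lerD T1 T2) T3) _.
set W := tau ^- 3 * 2 * (H ^+ d.-1 * vol) + tau^-1 * 2 * (d%:R / t) ^+ 2 * (H ^+ d.-1 * vol).
have W0 : 0 <= W.
  have HV : 0 <= H ^+ d.-1 * vol by rewrite mulr_ge0// ltW.
  have i3 : 0 <= tau ^- 3 by rewrite invr_ge0 exprn_ge0// ltW.
  have i1 : 0 <= tau^-1 by rewrite invr_ge0 ltW.
  by rewrite /W addr_ge0// mulr_ge0// mulr_ge0 ?sqr_ge0// mulr_ge0.
have WQ : W * SQ <= W * (2 * 2 ^+ d.+1 * S).
  by rewrite ler_wpM2l// sum_Q.
have dE : H ^+ d = H * H ^+ d.-1 by rewrite -exprS prednK// ltnW.
have E1 : inverse_const * (H ^+ d / H ^+ 4) * S =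
    (2 * H) ^+ d / t ^+ 4 * S + W * (2 * 2 ^+ d.+1 * S).
  rewrite /inverse_const /W /tau [(2 * H) ^+ d]exprMn dE !exprS /t.
  move: (2 ^+ d) (H ^+ d.-1) => X Y.
  move: s s0 => s' s'0.
  by field; rewrite !gt_eqF.
rewrite E1 EE; move: WQ; rewrite {1}/W mulrDl.
move: (_ * SQ) (_ * SQ) (W * _) (_ / _ * S) => x1 x2 x3 x4.
move: S10; move: (S1) (S2) (S3) => y1 y2 y3; lra.
Qed.

(** The powers of [H] in [energy_le_corrections], [correction_bound] and
    [grad_jump_le] cancel. *)
Lemma energy_stable : energy (reconstruction m patch v) <=
  energy_const * Lam ^+ 2 * energy v.
Proof.
have V0 : 0 < vol by exact: ref_volume_gt0.
have d0 : 0 < d%:R :> R by rewrite ltr0n ltnW.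
have [K KM] := elts_neq0 hOmega tri; have [Lam1 _] := Lambda_ge tri m patchP KM.
have tau0 : 0 < 2 * s * H / d%:R by rewrite divr_gt0// !mulr_gt0.
apply: le_trans energy_le_corrections _.
set S3 := \sum_(e in faces M) (h_ e)^-1 *
      face_integral e (fun w => jump e (normal_derivative e v) w ^+ 2).
have fi0 e f : e \in faces M -> 0 <= face_integral e (fun w => jump e f w ^+ 2).
  move=> eF; have [ce _] := faceP eF; apply: (face_integral_ge0 d1 ce) => w _.
  exact: sqr_ge0.
have h0 e : e \in faces M -> 0 <= h_ e.
  by move=> eF; apply: le_trans (face_diam_ge d1 hOmega tri qu eF); exact: ltW.
have S3E : S3 <= energy v.
  rewrite lerDr addr_ge0//.
    by apply: sumr_ge0 => K' _; apply: Rintegral_ge0 => w _; exact: sqr_ge0.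
  by apply: sumr_ge0 => e eF; rewrite mulr_ge0 ?invr_ge0 ?exprn_ge0 ?h0 ?fi0.
have S30 : 0 <= S3.
  by apply: sumr_ge0 => e eF; rewrite mulr_ge0 ?invr_ge0 ?h0 ?fi0.
set T := (2 * s * H / d%:R) ^+ d.-1.
have T0 : 0 < T by rewrite exprn_gt0.
have gjS : gj2 <= H / (T * vol) * S3.
  by rewrite mulr_sumr; apply: ler_sum => e eF; exact: grad_jump_le.
have lc0 : 0 <= local_const * Lam ^+ 2 * H ^+ 2.
  by apply: mulr_ge0; [apply: mulr_ge0; [exact: local_const_ge0|exact: sqr_ge0]|exact: sqr_ge0].
have BS : \sum_(K in elts M) B K ^+ 2 <=
    local_const * Lam ^+ 2 * H ^+ 2 * (NB ^+ 2 * (H / (T * vol) * S3)).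
  apply: le_trans (_ : local_const * Lam ^+ 2 * H ^+ 2 *
      \sum_(K in elts M) near_jumps Nm G K <= _).
    by rewrite mulr_sumr; apply: ler_sum => K' K'M; exact: BG.
  rewrite ler_wpM2l//; apply: le_trans sum_near_jumps _.
  by rewrite ler_wpM2l// sqr_ge0.
have HH : 0 <= inverse_const * (H ^+ d / H ^+ 4).
  by rewrite mulr_ge0 ?inverse_const_ge0// divr_ge0// exprn_ge0// ltW.
have := ler_wpM2l HH BS.
have dE : H ^+ d = H * H ^+ d.-1 by rewrite -exprS prednK// ltnW.
have -> : inverse_const * (H ^+ d / H ^+ 4) * (local_const * Lam ^+ 2 * H ^+ 2 *
    (NB ^+ 2 * (H / (T * vol) * S3))) =
  inverse_const * local_const * NB ^+ 2 * (d%:R / (2 * s)) ^+ d.-1 / vol *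
    Lam ^+ 2 * S3.
  have -> : T = H ^+ d.-1 / (d%:R / (2 * s)) ^+ d.-1.
    by rewrite /T -expr_div_n; congr (_ ^+ _); field; rewrite !gt_eqF.
  rewrite dE; have X0 : 0 < H ^+ d.-1 by rewrite exprn_gt0.
  have Y0 : 0 < (d%:R / (2 * s)) ^+ d.-1 by rewrite exprn_gt0// divr_gt0// mulr_gt0.
  move: (H ^+ d.-1) X0 ((d%:R / (2 * s)) ^+ d.-1) Y0 => X X0 Y Y0.
  move: inverse_const local_const NB => u1 u2 u3.
  by field; rewrite !gt_eqF.
set Z := _ / vol => h.
have Z0 : 0 <= Z.
  have X0 : 0 <= d%:R / (2 * s) by rewrite divr_ge0// mulr_ge0// ltW.
  rewrite /Z divr_ge0 ?(ltW V0)// mulr_ge0 ?exprn_ge0// mulr_ge0 ?sqr_ge0//.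
  by apply: mulr_ge0; [exact: inverse_const_ge0|exact: local_const_ge0].
have Lam2 : 1 <= Lam ^+ 2 by rewrite exprn_ege1.
have En0 : 0 <= energy v by exact: le_trans S3E.
have -> : energy_const * Lam ^+ 2 * energy v =
    2 * Lam ^+ 2 * energy v + Z * Lam ^+ 2 * energy v.
  by rewrite -!mulrDl.
apply: lerD.
  by rewrite -mulrA ler_wpM2l// ler_peMl.
by apply: le_trans h _; rewrite ler_wpM2l// mulr_ge0// sqr_ge0.
Qed.

Lemma broken_norm_stable : broken_norm M (reconstruction m patch v) <=
  Num.sqrt energy_const * Lam * broken_norm M v.
Proof.
have [K KM] := elts_neq0 hOmega tri; have [Lam1 _] := Lambda_ge tri m patchP KM.
have c0 := ltW energy_const_gt0.
have BN f : broken_norm M f = Num.sqrt (energy f) by [].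
rewrite !BN; apply: le_trans (ler_wsqrtr energy_stable) _.
rewrite sqrtrM; last by rewrite mulr_ge0 ?sqr_ge0.
by rewrite sqrtrM// sqrtr_sqr ger0_norm//; lra.
Qed.

End stability.

Theorem lemma8 (R : realType) (d : nat) (hd : d = 2%N \/ d = 3%N)
    (Omega : set 'rV[R]_d) (hOmega : convex_polytope Omega)
    (m : nat) (hm : (1 <= m)%N) (Nm : nat) (hNm : (d.+1 < Nm)%N) (Cnu : R) :
  exists C : R, 0 < C /\
    forall (M : mesh R d) (depth : {set node M} -> nat)
        (patch : {set node M} -> {set {set node M}}),
      triangulation M Omega ->
      meshsize M <= Cnu * rho M ->
      (forall K, K \in elts M ->
         is_depth Nm K (depth K) /\ is_patch Nm K (depth K) (patch K)) ->
      unisolvent m patch ->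
      forall v, Vh0 M Omega v ->
        broken_norm M (reconstruction m patch v) <=
          C * Lambda m patch depth * broken_norm M v.
Proof.
have d1 : (1 < d)%N by case: hd => ->.
have s0 := shape_gt0 d1 Cnu.
have k1 : 1 <= 1 + 2 / shape (d:=d) Cnu by rewrite lerDl divr_ge0// ltW.
have [C0 C0_gt0 inv] := poly_inverse_estimates d m k1.
have Nm0 : (0 < Nm)%N by apply: leq_ltn_trans hNm.
exists (Num.sqrt (energy_const (d:=d) Cnu Nm C0)); split.
  by rewrite sqrtr_gt0 energy_const_gt0.
move=> M depth patch tri qu pP uni v [[_ vP] _].
have /choice[ag agP] : forall K, exists ag : R * 'rV[R]_d, K \in elts M ->
    forall w, hull (@pos R d M) K w -> v w = ag.1 + dotp ag.2 w.
  move=> K; have [KM|] := boolP (K \in elts M); last by exists (0, 0).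
  have [p /affine_poly_fun1[b [g pE]] vp] := vP K KM.
  by exists (b, g) => _ w Kw; rewrite vp ?pE// inE.
have vE K : K \in elts M -> forall w, hull (@pos R d M) K w ->
    v w = (ag K).1 + dotp (ag K).2 w by exact: agP.
have cb := correction_bound d1 hOmega tri qu hm Nm0 pP uni vE C0_gt0 inv.
pose B K := if pselect (K \in elts M) is left KM then projT1 (cid (cb K KM)) else 0.
apply: (broken_norm_stable d1 hOmega tri qu hm pP vE C0_gt0 (B := B)) => // K KM;
  by rewrite /B; case: pselect => // KM'; case: cid => /= b [].
Qed.
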